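(* Let $s>0$ with $s\notin\mathcal{S}$, put $p=1/s$, and let $k^*(s)\in\{\lfloor s+1\rfloor,\lceil s+1\rceil\}$ denote the unique integer that minimizes $g_s$ over the integers $x\ge 2$. Then: (a) the hopcount $H_n=H_n(s)$ converges in probability to $k^*(s)$ as $n\to\infty$: $$\mathbb{P}\bigl(H_n=k^*(s)\bigr)\to 1;$$ (b) with $k=k^*(s)$, the optimal weight $W_n=W_n(s)$ satisfies, for every $t\in\mathbb{R}$, as $n\to\infty$, $$\mathbb{P}\left(\frac{k-1}{s\,g_s(k)}(\log n)^{s+1}\left(W_n-\frac{g_s(k)}{(\log n)^s}\right)+\frac{k-1}{2}\log\log n-\frac{p(k-1)\log g_s(k)}{2}>t\right)\to\exp(-a_k e^t).$$
   Context: Let $K_n$ be the complete graph on vertex set $\{1,\dots,n\}$. Fix $s>0$ and put $p=1/s$. Attach to the edges $\{i,j\}$, $1\le i<j\le n$, the weights $E_{\{i,j\}}^{-s}$, where the $E_{\{i,j\}}$ are i.i.d. exponential random variables with mean $1$. The weight of a path is the sum of the weights of its edges. The optimal path is the (almost surely unique) path between vertex $1$ and vertex $n$ of minimal weight; $W_n=W_n(s)$ denotes its weight and $H_n=H_n(s)$ (the hopcount) its number of edges. Define $g_s(x)=\dfrac{x^{s+1}}{(x-1)^s}$ for $x\ge 2$. Define $\mathcal{S}=\{s_2,s_3,\dots\}$ with $s_j=\dfrac{\log(1+j^{-1})}{\log(1+(j^2-1)^{-1})}\in(j-1,j)$, $j=2,3,\dots$; $s_j$ is the solution $s$ of $g_s(j)=g_s(j+1)$.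 For $s\notin\mathcal{S}$ there is a unique integer minimizing $g_s$ over the integers $x\ge2$. Define, for $k\ge1$, $a_k=\left(\dfrac{2\pi p}{1+p}\right)^{(k-1)/2}k^{((k-1)p-1)/2}$. *)

(* Defs.v *)
From HB Require Import structures.
From mathcomp Require Import all_boot all_order all_algebra.
From mathcomp Require Import all_classical all_reals all_analysis.
Set Implicit Arguments.
Unset Strict Implicit.
Unset Printing Implicit Defensive.
Import Order.TTheory GRing.Theory Num.Theory.
Import numFieldNormedType.Exports.
Local Open Scope classical_set_scope.
Local Open Scope ring_scope.

Definition mutually_independent d (T : measurableType d) (R : realType)
    (P : probability T R) (I : finType) (D : {set I})
    (X : I -> {RV P >-> R}) : Prop :=
  forall J : {set I}, J \subset D ->
  forall B : I -> set R, (forall i, i \in J -> measurable (B i)) ->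
  P (\bigcap_(i in [set` J]) (X i @^-1` B i)) =
  (\prod_(i in J) P (X i @^-1` B i))%E.

(* Mean 1, i.e. rate 1. *)
Definition iid_exponential d (T : measurableType d) (R : realType)
    (P : probability T R) (I : finType) (D : {set I})
    (X : I -> {RV P >-> R}) : Prop :=
  mutually_independent D X /\
  forall i, i \in D -> forall B : set R, measurable B ->
    distribution P (X i) B = exponential_prob (1 : R) B.

(* The complete graph has the vertex set 'I_m.+2: it has m + 2 >= 2 vertices,
   and ord0 and ord_max are the first and the last vertex.  An edge is a
   two-element set of vertices. *)
Definition complete_edges (m : nat) : {set {set 'I_m.+2}} :=
  [set e : {set 'I_m.+2} | #|e| == 2]%SET.

Section OptimalPath.
Context (R : realType) (m : nat).
Implicit Types (c : {set 'I_m.+2} -> R) (q : m.+1.-bseq 'I_m.+2).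

(* A path from the first vertex is given by the sequence q of its subsequent
   vertices.  As all vertices are distinct, consecutive ones are adjacent in the
   complete graph, and m + 1 bounds the number of edges. *)
Definition is_path q : bool :=
  uniq (ord0 :: q) && (last ord0 q == ord_max).

Definition path_weight c q : R :=
  \sum_(w <- pairmap (fun u v => c [set u; v]%SET) ord0 q) w.

(* The one-edge path only serves as a witness that there is a path; ties between
   minimal paths are broken by an arbitrary fixed choice. *)
Definition optimal_path c : m.+1.-bseq 'I_m.+2 :=
  [arg min_(q < [bseq ord_max] | is_path q) path_weight c q]%O.

Definition optimal_weight c : R := path_weight c (optimal_path c).

Definition hopcount c : nat := size (optimal_path c).

End OptimalPath.

(* Where x <= 0 the library's powR does not give x^(-s) its usual meaning; this
   only affects an event of probability 0. *)
Definition edge_weight (R : realType) (s : R) d (T : measurableType d)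
    (P : probability T R) (m : nat) (E : {set 'I_m.+2} -> {RV P >-> R})
    (w : T) : {set 'I_m.+2} -> R :=
  fun e => (E e w) `^ (- s).

Definition g (R : realType) (s x : R) : R := x `^ (s + 1) / (x - 1) `^ s.

Definition s_ (R : realType) (j : nat) : R :=
  ln (1 + j%:R^-1) / ln (1 + (j%:R ^+ 2 - 1)^-1).

Definition exceptional_set (R : realType) : set R :=
  [set s_ R j | j in [set j : nat | (2 <= j)%N]].

Definition minimizes_g (R : realType) (s : R) (k : nat) : Prop :=
  (2 <= k)%N /\ forall j : nat, (2 <= j)%N -> g s k%:R <= g s j%:R.

Definition a_ (R : realType) (s : R) (k : nat) : R :=
  let p := s^-1 in
  (2 * pi * p / (1 + p)) `^ ((k%:R - 1) / 2) *
  k%:R `^ (((k%:R - 1) * p - 1) / 2).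

(* Centred and rescaled value of an optimal weight W for N vertices. *)
Definition rescaled_weight (R : realType) (s : R) (k : nat) (N W : R) : R :=
  let p := s^-1 in
  (k%:R - 1) / (s * g s k%:R) * ln N `^ (s + 1) * (W - g s k%:R / ln N `^ s)
  + (k%:R - 1) / 2 * ln (ln N)
  - p * (k%:R - 1) * ln (g s k%:R) / 2.

(* Main.v *)
(* A path with j edges is light when its weight is at most w.  For w of order
   g_s(k) / (log n)^s, the expected number of light paths is governed by the
   probability that a sum of j independent copies of E^(-s) is at most w, times
   n^(j-1).  By convexity of x^(-s), such a sum is small only if the sum of the
   exponentials is large, and a Chernoff bound shows that for j <> k, with k the
   strict minimizer of g_s, the expected number of light paths tends to 0.  For
   j = k, Laplace's method, applied inductively by splitting off the first edge,
   gives the limit a_k e^t of the expected number.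

   The number of light paths with k edges is asymptotically Poisson.  A direct
   second moment estimate fails, as one exceptionally cheap edge is shared by many
   light paths; but in a light path all the exponentials are typically close to
   (k-1)/k log n, so only paths whose exponentials all exceed a slightly smaller
   cutoff are counted.  A path that shares edges with a given one and has r other
   inner vertices has at least r + 1 new edges, each above the cutoff, and this
   compensates for the n^r choices.  So the probability that no path is light
   tends to exp(-a_k e^t), which is (b).  For large t it is small, and then the
   optimal path is light and hence has k edges, which is (a). *)

(* Weights and exponentials are linked by the point y with j y^(-s) = w: if j edges share the weight
   w equally, all their exponentials equal y. For w = g_s(j) / (log n)^s this gives y = (j - 1)/j
   log n, and e^(-j y) cancels the n^(j-1) paths; this is the origin of g_s. The factor (sqrt
   y)^(k-1) in the Laplace asymptotics is the origin of the log log n term. One Chernoff estimate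
   has three uses. With a convexity defect recorded for one edge, it bounds the region away from the
   saddle in the Laplace step and the light paths with an exponential below the cutoff; there the
   parameter 1 - 1/y costs only a power of y. Without the defect it excludes the other lengths;
   there the parameter stays fixed, because lengths grow up to n - 1, and a gap uniform in j is
   required. The Poisson limit uses no moments: events are added one at a time, and each multiplies
   the probability that none has occurred by about 1 - q. This rests on exact independence of a path
   from all paths that do not meet it at an inner vertex, hence the sigma-algebras generated by sets
   of edges. *)
Require Import Defs.
From HB Require Import structures.
From mathcomp Require Import all_boot all_order all_algebra.
From mathcomp Require Import all_classical all_reals all_analysis.
From mathcomp Require Import measurable_realfun zify ring lra.
Set Implicit Arguments.
Unset Strict Implicit.
Unset Printing Implicit Defensive.
Import Order.TTheory GRing.Theory Num.Theory.
Import numFieldNormedType.Exports.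
Local Open Scope classical_set_scope.
Local Open Scope ring_scope.

(** * The minimizer of g *)

Section Minimizer.
Context (R : realType) (s : R) (s0 : 0 < s).

Lemma ln_step (j : nat) : (1 <= j)%N -> ln (1 + j%:R^-1) = ln j.+1%:R - ln j%:R :> R.
Proof.
move=> j1; have j0 : 0 < j%:R :> R by rewrite ltr0n.
rewrite -ln_div ?posrE ?ltr0n//; congr ln.
by rewrite -natr1; field; rewrite gt_eqF.
Qed.

Lemma ln_step2 (j : nat) : (2 <= j)%N ->
  ln (1 + (j%:R ^+ 2 - 1)^-1) = 2 * ln j%:R - ln (j%:R - 1) - ln j.+1%:R :> R.
Proof.
move=> j2; have j20 : 2 <= j%:R :> R by rewrite ler_nat.
have j1 : 0 < j%:R - 1 :> R by lra.
have jp : 0 < j%:R :> R by lra.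
have jp1 : 0 < j%:R + 1 :> R by lra.
have -> : 1 + (j%:R ^+ 2 - 1)^-1 = j%:R * j%:R / ((j%:R - 1) * (j%:R + 1)) :> R.
  have -> : j%:R ^+ 2 - 1 = (j%:R - 1) * (j%:R + 1) :> R by ring.
  by field; rewrite ?(gt_eqF j1) ?(gt_eqF jp1).
rewrite ln_div ?posrE ?mulr_gt0// !lnM ?posrE// natr1.
by ring.
Qed.

(** The inverse of 1 + 1/(j^2 - 1) is 1 - 1/j^2, and ln (1 + x) <= x at x = -1/j^2 bounds its
    logarithm from above. *)
Lemma ln_step2_ge (j : nat) : (2 <= j)%N ->
  (j%:R * j%:R)^-1 <= ln (1 + (j%:R ^+ 2 - 1)^-1) :> R.
Proof.
move=> j2; have j20 : 2 <= j%:R :> R by rewrite ler_nat.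
have jp : 0 < j%:R :> R by lra.
have q0 : 0 < j%:R ^+ 2 - 1 :> R by nra.
have h := @le_ln1Dx R (- (j%:R * j%:R)^-1).
have jj : (j%:R * j%:R)^-1 < 1 :> R by rewrite invf_lt1 ?mulr_gt0//; nra.
have E : ln (1 - (j%:R * j%:R)^-1) = - ln (1 + (j%:R ^+ 2 - 1)^-1) :> R.
  rewrite -lnV ?posrE ?addr_gt0 ?invr_gt0//; congr ln.
  by field; rewrite (gt_eqF jp) (gt_eqF q0)/= subrK sqrf_eq0 gt_eqF.
by rewrite -lerN2 -E; apply: h; lra.
Qed.

Lemma ln_step2_gt0 (j : nat) : (2 <= j)%N -> 0 < ln (1 + (j%:R ^+ 2 - 1)^-1) :> R.
Proof.
move=> j2; apply: lt_le_trans (ln_step2_ge j2).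
by rewrite invr_gt0 mulr_gt0// ltr0n; case: j j2.
Qed.

(** From 1/(j + 1) <= ln (1 + 1/j) <= 1/j and 1/j^2 <= ln (1 + 1/(j^2 - 1)) <= 1/(j^2 - 1). The
    intervals [j - 1, j] are consecutive, so these bounds already make [s_] nondecreasing. *)
Lemma s_bounds (j : nat) : (2 <= j)%N -> j%:R - 1 <= s_ R j <= j%:R.
Proof.
move=> j2; have B0 := ln_step2_gt0 j2.
have j20 : 2 <= j%:R :> R by rewrite ler_nat.
have jp : 0 < j%:R :> R by lra.
have q0 : 0 < j%:R ^+ 2 - 1 :> R by nra.
rewrite /s_ ler_pdivlMr// ler_pdivrMr//; apply/andP; split.
  have h1 : ln (1 + (j%:R ^+ 2 - 1)^-1) <= (j%:R ^+ 2 - 1)^-1 :> R.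
    by apply: le_ln1Dx; rewrite (lt_trans (ltrN10 _))// invr_gt0.
  have h2 : (j%:R + 1)^-1 <= ln (1 + j%:R^-1) :> R.
    have h := @le_ln1Dx R (- (j%:R + 1)^-1).
    have jj : (j%:R + 1)^-1 < 1 :> R by rewrite invf_lt1; lra.
    have E : ln (1 - (j%:R + 1)^-1) = - ln (1 + j%:R^-1) :> R.
      rewrite -lnV ?posrE ?addr_gt0 ?invr_gt0//; congr ln.
      by field; rewrite !gt_eqF//; lra.
    by rewrite -lerN2 -E; apply: h; lra.
  apply: le_trans h2; apply: le_trans (ler_wpM2l _ h1) _; first by lra.
  rewrite (_ : j%:R ^+ 2 - 1 = (j%:R - 1) * (j%:R + 1)); last by ring.
  by rewrite invfM mulrA divff ?mul1r// gt_eqF//; lra.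
apply: (@le_trans _ _ j%:R^-1).
  by apply: le_ln1Dx; rewrite (lt_trans (ltrN10 _))// invr_gt0.
apply: le_trans (ler_wpM2l (ltW jp) (ln_step2_ge j2)).
by rewrite invfM mulrA divff ?mul1r// gt_eqF.
Qed.

Lemma g_gt0 (j : nat) : (2 <= j)%N -> 0 < g s j%:R.
Proof.
move=> j2; have j20 : 2 <= j%:R :> R by rewrite ler_nat.
by rewrite /g divr_gt0// powR_gt0; lra.
Qed.

Lemma ln_g (j : nat) : (2 <= j)%N ->
  ln (g s j%:R) = (s + 1) * ln j%:R - s * ln (j%:R - 1).
Proof.
move=> j2; have j20 : 2 <= j%:R :> R by rewrite ler_nat.
by rewrite /g ln_div ?posrE ?powR_gt0 ?ln_powR//; lra.
Qed.

(** This difference has the sign of s_j - s, so s_j is the value of s at which the step from j to j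
    + 1 turns from an increase into a decrease. *)
Lemma ln_gS (j : nat) : (2 <= j)%N ->
  ln (g s j.+1%:R) - ln (g s j%:R) =
  ln (1 + j%:R^-1) - s * ln (1 + (j%:R ^+ 2 - 1)^-1).
Proof.
move=> j2; rewrite !ln_g// ?(leq_trans j2)// ln_step ?ln_step2//; last exact: ltnW.
by rewrite -natr1 addrK; ring.
Qed.

Lemma g_ltS (j : nat) : (2 <= j)%N -> s < s_ R j -> g s j%:R < g s j.+1%:R.
Proof.
move=> j2; rewrite /s_ ltr_pdivlMr ?ln_step2_gt0// => h.
rewrite -ltr_ln ?posrE ?g_gt0 ?(leq_trans j2)// -subr_gt0 ln_gS//.
by rewrite subr_gt0.
Qed.

Lemma g_gtS (j : nat) : (2 <= j)%N -> s_ R j < s -> g s j.+1%:R < g s j%:R.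
Proof.
move=> j2; rewrite /s_ ltr_pdivrMr ?ln_step2_gt0// => h.
rewrite -ltr_ln ?posrE ?g_gt0 ?(leq_trans j2)// -subr_lt0 ln_gS//.
by rewrite subr_lt0.
Qed.

(** The minimizer is the least n >= 2 with s < s_n: as [s_] is monotone, g_s decreases up to n and
    increases after it. A factor 1 + c valid for all j at once therefore comes from the neighbours
    of n alone. *)
Lemma g_minimizer : ~ exceptional_set s -> exists k : nat,
  [/\ (2 <= k)%N, k%:Z = Num.floor (s + 1) \/ k%:Z = Num.ceil (s + 1) &
   exists2 c : R, 0 < c & forall j : nat, (2 <= j)%N -> j != k ->
     (1 + c) * g s k%:R <= g s j%:R].
Proof.
move=> gen.
have ex : exists j : nat, (2 <= j)%N && (s < s_ R j).
  exists ((Num.truncn s).+3); rewrite /=.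
  have /andP[h _] := @s_bounds (Num.truncn s).+3 isT.
  apply: lt_le_trans h; apply: lt_le_trans (truncnS_gt s) _.
  by rewrite -[X in _ <= X - 1]natr1 addrK ler_nat.
case: (ex_minnP ex) => n /andP[n2 sn] nmin {ex}.
have up j : (n <= j)%N -> s < s_ R j.
  rewrite leq_eqVlt => /predU1P[<-//|nj].
  have j2 : (2 <= j)%N by rewrite (leq_trans n2)// ltnW.
  have /andP[_ h1] := s_bounds n2; have /andP[h2 _] := s_bounds j2.
  apply: lt_le_trans sn _; apply: le_trans h1 _; apply: le_trans _ h2.
  by rewrite lerBrDr natr1 ler_nat.
(* Minimality of n gives only s_j <= s; the exceptional set excludes equality. *)
have down j : (2 <= j)%N -> (j < n)%N -> s_ R j < s.
  move=> j2 jn; rewrite lt_neqAle; apply/andP; split.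
    by apply/eqP => E; apply: gen; exists j.
  rewrite leNgt; apply/negP => h; have := nmin j; rewrite j2 h => /(_ isT).
  by rewrite leqNgt jn.
have upmono j : (n < j)%N -> g s n.+1%:R <= g s j%:R.
  elim: j => // j IH; rewrite ltnS leq_eqVlt => /predU1P[<-//|nj].
  apply: le_trans (IH nj) _; apply/ltW/g_ltS; last exact/up/ltnW.
  by rewrite (leq_trans n2)// ltnW.
have downmono j i : (2 <= j)%N -> (j + i < n)%N -> g s (j + i)%:R <= g s j%:R.
  move=> j2; elim: i => [|i IH]; first by rewrite addn0.
  rewrite addnS => h; apply: le_trans (IH (ltnW h)).
  apply/ltW/g_gtS; first exact: leq_trans (leq_addr _ _).
  by apply: down; [exact: leq_trans (leq_addr _ _)|exact: ltnW].
have gn0 := g_gt0 n2.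
have gup : g s n%:R < g s n.+1%:R by apply: g_ltS => //; exact: up.
exists n; split => //.
  (* The bounds s_n <= n and s_(n-1) >= n - 2 put s + 1 strictly between n - 1 and n + 1; for n = 2
     the lower one is s > 0. *)
  have sn1 : s < n%:R by have /andP[_ h] := s_bounds n2; exact: lt_le_trans sn h.
  have ns : n%:R - 1 < s + 1.
    move: n2; rewrite leq_eqVlt => /predU1P[<-|n3]; first by rewrite -natr1 addrK ltrDr.
    have p1 : (2 <= n.-1)%N by lia.
    have : s_ R n.-1 < s by apply: down => //; lia.
    have /andP[h _] := s_bounds p1.
    have -> : n%:R = n.-1%:R + 1 :> R by rewrite natr1; congr _%:R; lia.
    by lra.
  case: (leP n%:R (s + 1)) => h.
    left; apply/esym/floor_def; rewrite -pmulrn h/=.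
    by rewrite intrD -pmulrn; lra.
  right; apply/esym/ceil_def; rewrite -pmulrn ltW// andbT.
  by rewrite intrB -pmulrn.
(* For n = 2 there is no left neighbour, and [dn] repeats the right one. *)
pose dn := if (2 < n)%N then g s n.-1%:R else g s n.+1%:R.
have gdn : g s n%:R < dn.
  rewrite /dn; case: ifP => // n3.
  have {1}-> : n = n.-1.+1 by lia.
  by apply: g_gtS; [lia|apply: down; lia].
pose b := Num.min (g s n.+1%:R) dn.
exists (b / g s n%:R - 1).
  by rewrite subr_gt0 ltr_pdivlMr// mul1r lt_min gup.
move=> j j2 jn; rewrite addrC subrK divfK ?gt_eqF// ge_min; apply/orP.
case: (ltngtP j n) jn => // jn _; last by left; exact: upmono.
right; have n3 : (2 < n)%N by exact: leq_ltn_trans jn.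
rewrite /dn n3; have jn1 : (j <= n.-1)%N by lia.
by rewrite -(subnKC jn1); apply: downmono => //; lia.
Qed.

Lemma minimizes_g_unique k : (2 <= k)%N ->
  (exists2 c : R, 0 < c & forall j : nat, (2 <= j)%N -> j != k ->
     (1 + c) * g s k%:R <= g s j%:R) -> unique (minimizes_g s) k.
Proof.
move=> k2 [c c0 gap]; have gk := g_gt0 k2.
have lt j : (2 <= j)%N -> j != k -> g s k%:R < g s j%:R.
  by move=> j2 jk; apply: lt_le_trans (gap j j2 jk); rewrite ltr_pMl// ltrDl.
split; first split => // j j2.
  by have [->//|jk] := eqVneq j k; exact/ltW/lt.
move=> j [j2 jmin]; apply/eqP/negP => /negP kj.
by have := jmin k k2; rewrite leNgt lt// eq_sym.
Qed.

End Minimizer.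

(** With p = 1/s this says (x / g_s(x))^p = (x - 1)/x: if x equal edges have total weight g_s(x)
    L^(-s), each exponential is (x - 1)/x L. *)
Lemma g_powR (R : realType) (s x : R) : 0 < s -> 1 < x ->
  g s x `^ s^-1 = x `^ s^-1 * (x / (x - 1)).
Proof.
move=> s0 x1; have x0 : 0 < x by rewrite (lt_trans ltr01).
have x10 : 0 < x - 1 by rewrite subr_gt0.
have sp : s * s^-1 = 1 by rewrite divff// gt_eqF.
move: (s^-1) sp => p sp.
rewrite /g powRM ?powR_ge0 ?invr_ge0 ?powR_ge0// -powR_inv1 ?powR_ge0// -!powRrM.
rewrite (_ : (s + 1) * p = p + 1); last by rewrite mulrDl sp mul1r addrC.
rewrite (_ : s * (- 1 * p) = - 1); last by rewrite mulN1r mulrN sp.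
rewrite powR_inv1 ?(ltW x10)// powRD ?(gt_eqF x0) ?implybT//.
by rewrite powRr1 ?(ltW x0)// mulrA.
Qed.

(** * Independence and the weight of a path *)

Section Independence.
Context d (T : measurableType d) (R : realType) (P : probability T R).
Context (I : finType) (D : {set I}) (X : I -> {RV P >-> R}).
Hypothesis indep : mutually_independent D X.
Implicit Types J : {set I}.

(** A pi-system for the events that depend only on the variables indexed by J; it generates their
    sigma-algebra [<<s cylinders J >>]. *)
Definition cylinders J : set (set T) :=
  [set A | exists2 B : I -> set R, (forall i, measurable (B i)) &
    A = \bigcap_(i in [set` J]) X i @^-1` B i].

Lemma cylinders_measurable J : cylinders J `<=` measurable.
Proof.
move=> _ [B mB ->]; apply: fin_bigcap_measurable => // i _.
by rewrite -[X in measurable X]setTI; exact: measurable_funPT.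
Qed.

Lemma cylinders_setI J : setI_closed (cylinders J).
Proof.
move=> _ _ [A mA ->] [B mB ->]; exists (fun i => A i `&` B i).
  by move=> i; exact: measurableI.
by rewrite -bigcapI.
Qed.

Lemma cylindersT J : cylinders J setT.
Proof.
exists (fun=> setT) => //.
by apply/esym; rewrite -subTset => x _ i _.
Qed.

Lemma sub_sigma_cylinders J : <<s cylinders J >> `<=` measurable.
Proof.
by apply: smallest_sub; [exact: sigma_algebra_measurable|
  exact: cylinders_measurable].
Qed.

Lemma cylinders_indep J1 J2 A B : J1 \subset D -> J2 \subset D ->
  [disjoint J1 & J2]%B -> cylinders J1 A -> cylinders J2 B ->
  P (A `&` B) = (P A * P B)%E.
Proof.
move=> J1D J2D J12 [B1 mB1 ->] [B2 mB2 ->].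
pose B0 i := if i \in J1 then B1 i else B2 i.
have mB0 i : measurable (B0 i) by rewrite /B0; case: ifP.
have E1 : \bigcap_(i in [set` J1]) X i @^-1` B1 i =
          \bigcap_(i in [set` J1]) X i @^-1` B0 i.
  by apply: eq_bigcapr => i /= iJ; rewrite /B0 iJ.
have nJ i : i \in J2 -> i \in J1 = false.
  by move=> iJ; apply/negP => /(disjointFr J12); rewrite iJ.
have E2 : \bigcap_(i in [set` J2]) X i @^-1` B2 i =
          \bigcap_(i in [set` J2]) X i @^-1` B0 i.
  by apply: eq_bigcapr => i /= iJ; rewrite /B0 nJ.
have -> : (\bigcap_(i in [set` J1]) X i @^-1` B1 i) `&`
    (\bigcap_(i in [set` J2]) X i @^-1` B2 i) =
    \bigcap_(i in [set` (J1 :|: J2)%SET]) X i @^-1` B0 i.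
  rewrite E1 E2 -bigcap_setU; congr (\bigcap_(i in _) _).
  apply/seteqP; split=> i /=; rewrite inE; first by case=> ->; rewrite ?orbT.
  by move/orP.
rewrite E1 E2 !indep ?finset.subUset ?J1D ?J2D//.
rewrite (eq_bigl [predU J1 & J2]) ?bigU//.
by move=> i; rewrite !inE.
Qed.

(** Uniqueness of measures on a pi-system, used twice: for fixed C, the measures of A given by P (A
    [&] C) and P A * P C agree on cylinders. The first use frees A, the second frees B. *)
Lemma sigma_indep J1 J2 A B : J1 \subset D -> J2 \subset D ->
  [disjoint J1 & J2]%B -> <<s cylinders J1 >> A -> <<s cylinders J2 >> B ->
  P (A `&` B) = (P A * P B)%E.
Proof.
move=> J1D J2D J12; pose G1 := cylinders J1; pose G2 := cylinders J2.
have step (G : set (set T)) C : G `<=` measurable -> setI_closed G ->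
    G setT -> measurable C ->
    (forall A, G A -> P (A `&` C) = (P A * P C)%E) ->
    forall A, <<s G >> A -> P (A `&` C) = (P A * P C)%E.
  move=> Gm GI GT mC h A' sA.
  have C0 : 0 <= fine (P C) by exact: fine_ge0.
  have PC : P C = (NngNum C0)%:num%:E by rewrite /= fineK// fin_num_measure.
  rewrite PC muleC.
  have := @g_sigma_algebra_measure_unique _ R T G Gm (fun=> setT) _ _
    (mrestr P mC) (mscale (NngNum C0) P).
  rewrite /mrestr /= /mscale /=; apply=> //.
  - by rewrite bigcup_const//; exists 0%N.
  - by move=> A0 GA0; rewrite /mrestr h// PC muleC.
  - move=> _; rewrite /mrestr setTI /=.
    by rewrite (le_lt_trans (probability_le1 P mC))// ltry.
move=> sA sB.
apply: (step (cylinders J1)) => //.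
- exact: cylinders_measurable.
- exact: cylinders_setI.
- exact: cylindersT.
- exact: sub_sigma_cylinders sB.
move=> A' cA'; rewrite setIC muleC.
apply: (step (cylinders J2)) => //.
- exact: cylinders_measurable.
- exact: cylinders_setI.
- exact: cylindersT.
- exact: cylinders_measurable cA'.
by move=> B' cB'; rewrite setIC muleC; exact: (@cylinders_indep J1 J2).
Qed.

Lemma measurable_cylinders J i : i \in J ->
  measurable_fun setT (X i : g_sigma_algebraType (cylinders J) -> R).
Proof.
move=> iJ _ B mB; rewrite setTI; apply: sub_sigma_algebra.
exists (fun j => if j == i then B else setT); first by move=> j; case: ifP.
apply/seteqP; split=> x /=.
  by move=> Bx j _ /=; case: eqP => // ->.
by move=> /(_ i iJ)/=; rewrite eqxx.
Qed.

Lemma sub_cylinders J1 J2 : J1 \subset J2 ->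
  <<s cylinders J1 >> `<=` <<s cylinders J2 >>.
Proof.
move=> /fintype.subsetP J12; apply: sub_sigma_algebra2 => _ [B mB ->].
exists (fun i => if i \in J1 then B i else setT); first by move=> i; case: ifP.
apply/seteqP; split=> x /= h i /= iJ.
  by case: ifP => // iJ1; exact: h.
by have := h i (J12 _ iJ); rewrite /= iJ.
Qed.

End Independence.

Definition exp1 (R : realType) : probability (measurableTypeR R) R :=
  exponential_distribution_exponential_prob__canonical__probability_measure_Probability
    (@ltr01 R).

Section PartialSums.
Context (R : realType) (s : R).

(** The distribution function of a sum of j independent copies of E^(-s), as an iterated
    convolution. It does not refer to a probability space, which varies with m, and it is the form
    on which the inductions for the Chernoff bound and for Laplace's method run. *)
Fixpoint sum_cdf (j : nat) (w : R) : R :=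
  if j is j'.+1 then
    fine (\int[exp1 R]_u (sum_cdf j' (w - u `^ (- s)))%:E)
  else (0 <= w)%R%:R.

Lemma measurable_shift_powR (w : R) :
  measurable_fun setT (fun u : R => w - u `^ (- s)).
Proof. by apply: measurable_funB => //; exact: measurable_powR. Qed.

(** Proved together, because monotonicity makes the integrand of the next step measurable and the
    bounds make its integral finite. *)
Lemma sum_cdfP j : [/\ forall w, 0 <= sum_cdf j w, forall w, sum_cdf j w <= 1 &
  {homo sum_cdf j : v w / v <= w}].
Proof.
elim: j => [|j [IH0 IH1 IHm]].
  split=> [w|w|v w vw] /=; rewrite ?ler0n ?lern1 ?leq_b1// ler_nat.
  by case: (leP 0 v) => // v0; rewrite (le_trans v0).
have mF w : measurable_fun setT (fun u : R => (sum_cdf j (w - u `^ (- s)))%:E).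
  apply/measurable_EFinP; apply: (measurableT_comp (f := sum_cdf j)).
    exact: nondecreasing_measurable.
  exact: measurable_shift_powR.
have I0 w : (0 <= \int[exp1 R]_u
    (sum_cdf j (w - u `^ (- s)))%:E)%E.
  by apply: integral_ge0 => u _; rewrite lee_fin.
have I1 w : (\int[exp1 R]_u
    (sum_cdf j (w - u `^ (- s)))%:E <= 1)%E.
  apply: (@le_trans _ _ (\int[exp1 R]_u cst 1%E u)%E).
    apply: ge0_le_integral => //=.
    - by move=> u _; rewrite lee_fin.
    - exact: mF.
    - by move=> u _; rewrite lee_fin.
  by rewrite integral_cst// mul1e probability_le1.
have Ifin w : (\int[exp1 R]_u
    (sum_cdf j (w - u `^ (- s)))%:E)%E \is a fin_num.
  by rewrite ge0_fin_numE// (le_lt_trans (I1 w))// ltry.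
split=> [w|w|v w vw] /=.
- exact: fine_ge0.
- by rewrite -lee_fin fineK.
- apply: fine_le => //; apply: ge0_le_integral => //; [|exact: mF|exact: mF|].
  + by move=> u _; rewrite lee_fin.
  + by move=> u _; rewrite lee_fin; apply: IHm; rewrite lerD2r.
Qed.

Lemma sum_cdf_ge0 j w : 0 <= sum_cdf j w.
Proof. by have [] := sum_cdfP j. Qed.

Lemma sum_cdf_le1 j w : sum_cdf j w <= 1.
Proof. by have [] := sum_cdfP j. Qed.

Lemma sum_cdf_homo j : {homo sum_cdf j : v w / v <= w}.
Proof. by have [] := sum_cdfP j. Qed.

Lemma measurable_sum_cdf j w :
  measurable_fun setT (fun u : R => (sum_cdf j (w - u `^ (- s)))%:E).
Proof.
apply/measurable_EFinP; apply: (measurableT_comp (f := sum_cdf j)).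
  by apply: nondecreasing_measurable => //; exact: sum_cdf_homo.
exact: measurable_shift_powR.
Qed.

Lemma sum_cdf_fin j (B : set R) (w : R) : measurable B ->
  (\int[exp1 R]_(u in B)
    (sum_cdf j (w - u `^ (- s)))%:E)%E \is a fin_num.
Proof.
move=> mB; rewrite ge0_fin_numE; last first.
  by apply: integral_ge0 => u _; rewrite lee_fin sum_cdf_ge0.
apply: (@le_lt_trans _ _ (\int[exp1 R]_(u in B) cst 1%E u)%E).
  apply: ge0_le_integral => //=.
  - by move=> u _; rewrite lee_fin sum_cdf_ge0.
  - by apply: measurable_funTS; exact: measurable_sum_cdf.
  - by move=> u _; rewrite lee_fin sum_cdf_le1.
by rewrite integral_cst//= mul1e (le_lt_trans _ (ltry 1))// probability_le1.
Qed.

Lemma sum_cdfS j (w : R) : (sum_cdf j.+1 w)%:E =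
  (\int[exp1 R]_u (sum_cdf j (w - u `^ (- s)))%:E)%E.
Proof. by rewrite /= fineK// sum_cdf_fin. Qed.

Context d (T : measurableType d) (P : probability T R).
Context (I : finType) (D : {set I}) (X : I -> {RV P >-> R}).
Hypothesis iid : iid_exponential D X.
Let c i x := (X i x) `^ (- s).

Lemma measurable_sum_powR (J : {set I}) (es : seq I) : {subset es <= J} ->
  measurable_fun setT
    ((fun x => \sum_(e <- es) c e x) : g_sigma_algebraType (cylinders X J) -> R).
Proof.
elim: es => [|e es IH] sub.
  by under eq_fun do rewrite big_nil; exact: measurable_cst.
under eq_fun do rewrite big_cons.
apply: measurable_funD; last by apply: IH => x xe; rewrite sub// inE xe orbT.
apply: (measurableT_comp (measurable_powR (- s))).
by apply: measurable_cylinders; rewrite sub// mem_head.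
Qed.

Lemma sum_powR_le_cylinders (J : {set I}) (es : seq I) w : {subset es <= J} ->
  <<s cylinders X J >> [set x | \sum_(e <- es) c e x <= w].
Proof.
move=> sub; have := @measurable_sum_powR J es sub measurableT
  `]-oo, w]%classic (measurable_itv _).
by rewrite setTI; congr (<<s _ >> _); apply/seteqP; split=> x /=; rewrite in_itv.
Qed.

(** The first exponential is independent of the sum over the other edges, so their joint law is a
    product measure and the probability is an integral over sections. The set [B] is carried along
    because later the exponential of one edge is confined to small values. *)
Lemma prob_first_edge e0 (es : seq I) (B : set R) (w : R) :
  uniq (e0 :: es) -> {subset e0 :: es <= D} -> measurable B ->
  P (X e0 @^-1` B `&` [set x | \sum_(e <- e0 :: es) c e x <= w]) =
  (\int[exp1 R]_(u in B)
     (sum_cdf (size es) (w - u `^ (- s)))%:E)%E.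
Proof.
elim: es e0 B w => [|e1 es IH] e0 B w.
  move=> _ /(_ e0 (mem_head _ _)) e0D mB.
  under eq_set do rewrite big_seq1.
  pose C := B `&` [set u : R | 0 <= w - u `^ (- s)].
  have mC : measurable C.
    apply: measurableI => //; rewrite -[X in measurable X]setTI.
    rewrite (_ : [set u : R | _] = (fun u => w - u `^ (- s)) @^-1` `[0, +oo[).
      exact: measurable_shift_powR.
    by apply/seteqP; split=> x /=; rewrite in_itv/= andbT.
  transitivity (P (X e0 @^-1` C)).
    by congr (P _); apply/seteqP; split=> x; rewrite /C /= subr_ge0.
  have [_ /(_ _ e0D _ mC)] := iid; rewrite /distribution /pushforward => ->.
  transitivity (\int[exp1 R]_(u in B) (\1_C u)%:E)%E.
    by rewrite integral_indic// setIidl// => x [].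
  apply: eq_integral => u /set_mem Bu /=.
  congr (_%:E); rewrite indicE; congr (nat_of_bool _)%:R.
  by apply/idP/idP => [/set_mem[]//|h]; rewrite inE; split.
move=> U sub mB.
set es' := e1 :: es in U sub *.
have e0D : e0 \in D by rewrite sub// mem_head.
have es'D : {subset es' <= D} by move=> x xe; rewrite sub// inE xe orbT.
have Ues' : uniq es' by case/andP: U.
pose Z x := \sum_(e <- es') c e x.
(* Measurability for the sigma-algebra of the remaining edges, not merely for that of [T], is what
   makes [sigma_indep] applicable. *)
have mZs : measurable_fun setT (Z : g_sigma_algebraType
    (cylinders X [set e in es']%SET) -> R).
  by apply: measurable_sum_powR => x xe; rewrite inE.
have mZ : measurable_fun setT Z.
  move=> mT B' mB'; rewrite setTI.
  apply: (@sub_sigma_cylinders _ _ _ P _ X [set e in es']%SET).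
  have := mZs (@measurableT _ _) _ mB'.
  by rewrite setTI.
pose Zm : {RV P >-> R} := HB.pack Z (isMeasurableFun.Build _ _ _ _ Z mZ).
pose X0 : T -> measurableTypeR R := X e0.
have mX0 : measurable_fun setT X0 by exact: measurable_funPT (X e0).
pose XZ x : measurableTypeR R * R := (X0 x, Z x).
have mXZ : measurable_fun setT XZ by exact: measurable_fun_pair.
pose XZm : {mfun T >-> (measurableTypeR R * R)%type} :=
  HB.pack XZ (isMeasurableFun.Build _ _ _ _ XZ mXZ).
have indepZ (A1 : set (measurableTypeR R)) (A2 : set R) :
    measurable A1 -> measurable A2 ->
    distribution P XZm (A1 `*` A2) =
    (exp1 R A1 * distribution P Zm A2)%E.
  move=> mA1 mA2; have [ind law] := iid.
  have -> : exp1 R A1 = distribution P (X e0) A1 by rewrite law.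
  rewrite /distribution /pushforward /=.
  rewrite -(sigma_indep ind (J1 := [set e0]%SET) (J2 := [set e in es']%SET)).
  - by congr (P _).
  - by rewrite finset.sub1set.
  - by apply/fintype.subsetP => x; rewrite inE; exact: es'D.
  - rewrite disjoints1 inE; by case/andP: U.
  - have := @measurable_cylinders _ _ _ P _ X [set e0]%SET e0 _ measurableT A1 mA1.
    by rewrite setTI; apply; rewrite inE.
  - by have := mZs measurableT _ mA2; rewrite setTI.
pose A := [set uz : measurableTypeR R * R | B uz.1 /\ uz.1 `^ (- s) + uz.2 <= w].
have mA : measurable A.
  rewrite (_ : A = (fst @^-1` B) `&`
      ((fun uz : measurableTypeR R * R => uz.1 `^ (- s) + uz.2) @^-1` `]-oo, w])); last first.
    by apply/seteqP; split=> x /=; rewrite in_itv.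
  apply: measurableI; rewrite -[X in measurable X]setTI.
    exact: measurable_fst.
  apply: measurable_funD => //.
  apply: measurableT_comp (measurable_powR _) _.
  exact: measurable_fst.
transitivity (distribution P XZm A).
  rewrite /distribution /pushforward; congr (P _); apply/seteqP.
  by split=> x /=; rewrite big_cons.
rewrite -(product_measure_unique (m1 := exp1 R)
  (m2 := distribution P Zm) indepZ mA).
rewrite /product_measure1 [RHS]integral_mkcond.
apply: eq_integral => u _ /=; rewrite patchE.
case: ifPn => [/set_mem Bu|/negP uB]; last first.
  rewrite (_ : xsection A u = set0) ?measure0//.
  rewrite /xsection; apply/seteqP; split=> z //=.
  by rewrite inE => -[/= Bu _]; apply: uB; rewrite inE.
have -> : xsection A u = `]-oo, w - u `^ (- s)]%classic.
  rewrite /xsection; apply/seteqP; split=> z /=.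
    by rewrite inE in_itv/= => -[_ /=]; rewrite lerBrDl.
  by rewrite inE in_itv/= lerBrDl; split.
rewrite /distribution /pushforward.
transitivity (P (X e1 @^-1` setT `&`
  [set x | \sum_(e <- es') c e x <= w - u `^ (- s)])).
  by congr (P _); apply/seteqP; split=> x /=; rewrite in_itv/= => // -[].
by rewrite IH// -sum_cdfS.
Qed.

Lemma prob_sum_powR (es : seq I) w : uniq es -> {subset es <= D} ->
  P [set x | \sum_(e <- es) c e x <= w] = (sum_cdf (size es) w)%:E.
Proof.
case: es => [|e0 es] U sub.
  under eq_set do rewrite big_nil.
  rewrite /=; case: (leP 0 w) => w0.
    by rewrite (_ : [set _ | _] = setT) ?probability_setT//; apply/seteqP; split.
  by rewrite (_ : [set _ | _] = set0) ?measure0//; apply/seteqP; split.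
rewrite [size _]/= sum_cdfS -(prob_first_edge w U sub measurableT).
by rewrite preimage_setT setTI.
Qed.

End PartialSums.

(** * Chernoff bound *)

Section ExponentialIntegral.
Context (R : realType).
Notation mu := (@lebesgue_measure R).
Implicit Types (f phi : R -> R) (B : set R).

Lemma exp1_dominated : exp1 R `<< mu.
Proof.
apply/null_content_dominatesP => A mA muA0.
rewrite /exp1 /= /exponential_prob; apply: null_set_integral => //=.
by apply: measurable_funTS; apply/measurable_EFinP;
  exact: measurable_exponential_pdf.
Qed.

(** The change of variables yields an abstract Radon-Nikodym derivative; it equals the exponential
    density almost everywhere because both have the same integral over every measurable set. *)
Lemma integral_exp1 f B : measurable B -> measurable_fun setT f ->
  (forall u, 0 <= f u <= 1) ->
  (\int[exp1 R]_(u in B) (f u)%:E =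
   \int[mu]_(u in B) (f u * exponential_pdf 1 u)%:E)%E.
Proof.
move=> mB mf f01.
have mfE : measurable_fun B (EFin \o f).
  by apply: measurable_funTS; exact/measurable_EFinP.
have intf : (exp1 R).-integrable B (EFin \o f).
  apply: (@le_integrable _ (measurableTypeR R) _ (exp1 R) B mB (EFin \o f) (cst 1%E)) => //.
    move=> u _ /=; have /andP[f0 f1] := f01 u.
    by rewrite lee_fin !ger0_norm.
  apply/integrableP; split; first exact: measurable_cst.
  under eq_integral do rewrite /= normr1.
  by rewrite integral_cst//= mul1e (le_lt_trans _ (ltry 1))// probability_le1.
rewrite -(Radon_Nikodym_change_of_variables exp1_dominated mB intf).
under [RHS]eq_integral do rewrite EFinM.
apply: ae_eq_integral => //.
- apply: emeasurable_funM => //; apply: (measurable_int mu).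
  apply: (integrableS measurableT) => //.
  by apply: Radon_Nikodym_integrable; exact: exp1_dominated.
- apply: emeasurable_funM => //; apply: measurable_funTS.
  by apply/measurable_EFinP; exact: measurable_exponential_pdf.
apply: ae_eqe_mul2l.
apply: integral_ae_eq => //.
- apply: (integrableS measurableT) => //.
  by apply: Radon_Nikodym_integrable; exact: exp1_dominated.
- apply: measurable_funTS.
  by apply/measurable_EFinP; exact: measurable_exponential_pdf.
move=> A AB mA.
by rewrite -Radon_Nikodym_integral//; exact: exp1_dominated.
Qed.

Lemma exp1_integral_ub f phi B (C I : R) : measurable B ->
  measurable_fun setT f -> (forall u, 0 <= f u <= 1) ->
  measurable_fun setT phi -> (forall u, 0 <= phi u) -> 0 <= C ->
  (\int[mu]_u (phi u)%:E <= I%:E)%E ->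
  (forall u, B u -> 0 < u -> f u * expR (- u) <= C * phi u) ->
  fine (\int[exp1 R]_(u in B) (f u)%:E) <= C * I.
Proof.
move=> mB mf f01 mphi phi0 C0 phiI fphi.
have f0 u : 0 <= f u by have /andP[] := f01 u.
have pdf0 u : 0 <= exponential_pdf (1:R) u by exact: exponential_pdf_ge0.
have mfp : measurable_fun setT (fun u => (f u * exponential_pdf 1 u)%:E).
  apply/measurable_EFinP; apply: measurable_funM => //.
  exact: measurable_exponential_pdf.
suff H : (\int[exp1 R]_(u in B) (f u)%:E <= (C * I)%:E)%E.
  rewrite -lee_fin fineK// ge0_fin_numE; first by rewrite (le_lt_trans H)// ltry.
  by apply: integral_ge0 => u _; rewrite lee_fin.
(* Domination is assumed for u > 0 only, while the density is 1 at 0; the point 0 is null. *)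
pose B0 : set R := B `\ (0:R).
have mB0 : measurable B0 by exact: measurableD.
rewrite integral_exp1// -(integral_setD1 mB0); last exact: measurable_funTS.
have mCphi : measurable_fun setT (fun u => (C * phi u)%:E).
  by apply/measurable_EFinP; exact: measurable_funM.
apply: (@le_trans _ _ (\int[mu]_(u in B0) (C * phi u)%:E)%E).
  apply: ge0_le_integral => //.
  - by move=> u _; rewrite lee_fin mulr_ge0.
  - exact: measurable_funTS.
  - exact: measurable_funTS.
  move=> u [Bu /= /eqP u0]; rewrite lee_fin.
  case: (ltP u 0) => [ul|ug].
    by rewrite lt0_exponential_pdf// mulr0 mulr_ge0.
  by rewrite exponential_pdfE// mul1r mulN1r fphi// lt_neqAle eq_sym u0.
apply: (@le_trans _ _ (\int[mu]_u (C * phi u)%:E)%E).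
  apply: ge0_subset_integral => //.
  by move=> u _; rewrite lee_fin mulr_ge0.
under eq_integral do rewrite EFinM.
rewrite ge0_integralZl//.
- by rewrite EFinM lee_pmul// ?lee_fin//; apply: integral_ge0 => u _; rewrite lee_fin.
- exact/measurable_EFinP.
- by move=> u _; rewrite lee_fin.
Qed.

Lemma exp1_integral_lb f phi B (C I : R) : measurable B ->
  measurable_fun setT f -> (forall u, 0 <= f u <= 1) ->
  measurable_fun setT phi -> (forall u, 0 <= phi u) -> 0 <= C ->
  (I%:E <= \int[mu]_(u in B) (phi u)%:E)%E ->
  (forall u, B u -> 0 <= u) ->
  (forall u, B u -> C * phi u <= f u * expR (- u)) ->
  C * I <= fine (\int[exp1 R]_(u in B) (f u)%:E).
Proof.
move=> mB mf f01 mphi phi0 C0 phiI B0 fphi.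
have f0 u : 0 <= f u by have /andP[] := f01 u.
have pdf0 u : 0 <= exponential_pdf (1:R) u by exact: exponential_pdf_ge0.
have fin : (\int[exp1 R]_(u in B) (f u)%:E)%E \is a fin_num.
  rewrite ge0_fin_numE; last by apply: integral_ge0 => u _; rewrite lee_fin.
  apply: (@le_lt_trans _ _ (\int[exp1 R]_(u in B) cst 1%E u)%E).
    apply: ge0_le_integral => //=.
    - by move=> u _; rewrite lee_fin.
    - by apply: measurable_funTS; exact/measurable_EFinP.
    - by move=> u _; rewrite lee_fin; have /andP[] := f01 u.
  by rewrite integral_cst//= mul1e (le_lt_trans _ (ltry 1))// probability_le1.
rewrite -lee_fin fineK// integral_exp1//.
apply: (@le_trans _ _ (\int[mu]_(u in B) (C%:E * (phi u)%:E))%E).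
  rewrite ge0_integralZl//.
  - by rewrite EFinM lee_wpmul2l.
  - by apply: measurable_funTS; exact/measurable_EFinP.
  - by move=> u _; rewrite lee_fin.
apply: ge0_le_integral => //.
- by move=> u _; rewrite -EFinM lee_fin mulr_ge0.
- by apply: measurable_funTS; apply/measurable_EFinP; exact: measurable_funM.
- apply: measurable_funTS; apply/measurable_EFinP; apply: measurable_funM => //.
  exact: measurable_exponential_pdf.
move=> u Bu; rewrite -EFinM lee_fin.
by rewrite exponential_pdfE ?B0// mul1r mulN1r fphi.
Qed.

Lemma measurable_gauss (a m : R) :
  measurable_fun setT (fun x : R => expR (- (a * (x - m) ^+ 2))).
Proof.
apply: measurableT_comp => //; apply: measurableT_comp => //.
apply: measurable_funM => //; apply: measurable_funX.
exact: measurable_funB.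
Qed.

Lemma integral_gauss (a m : R) : 0 < a ->
  (\int[mu]_x (expR (- (a * (x - m) ^+ 2)))%:E = (Num.sqrt (pi / a))%:E)%E.
Proof.
move=> a0; pose sg := Num.sqrt (2 * a)^-1.
have sg0 : 0 < sg by rewrite sqrtr_gt0 invr_gt0 mulr_gt0.
have sg2 : sg ^+ 2 = (2 * a)^-1 by rewrite sqr_sqrtr// invr_ge0 mulr_ge0// ltW.
have E x : (expR (- (a * (x - m) ^+ 2)))%:E =
    ((Num.sqrt (pi / a))%:E * (normal_pdf m sg x)%:E)%E.
  rewrite -EFinM; congr _%:E; rewrite normal_pdfE ?gt_eqF//.
  rewrite /normal_peak /normal_fun sg2 [RHS]mulrA.
  rewrite (_ : (2 * a)^-1 * pi *+ 2 = pi / a); last first.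
    by rewrite -mulr_natl; field; rewrite gt_eqF.
  rewrite divff ?mul1r; last by rewrite gt_eqF// sqrtr_gt0 divr_gt0// pi_gt0.
  by congr expR; rewrite -mulr_natl; field; rewrite gt_eqF.
under eq_integral do rewrite E.
rewrite ge0_integralZl//.
- by rewrite integral_normal_pdf mule1.
- by apply/measurable_EFinP; exact: measurable_normal_pdf.
- by move=> x _; rewrite lee_fin normal_pdf_ge0.
Qed.

(** Outside the window half of the exponent is bounded by means of (x - m)^2 >= r^2, and the other
    half keeps the integrand integrable. *)
Lemma gauss_window_lb (a m r : R) : 0 < a -> 0 <= r ->
  ((Num.sqrt (pi / a) - expR (- (a / 2 * r ^+ 2)) * Num.sqrt (pi / (a / 2)))%:E
   <= \int[mu]_(x in `[(m - r)%R, (m + r)%R]) (expR (- (a * (x - m) ^+ 2)))%:E)%E.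
Proof.
move=> a0 r0.
have mg : measurable_fun setT (fun x : R => (expR (- (a * (x - m) ^+ 2)))%:E).
  by apply/measurable_EFinP; exact: measurable_gauss.
have a20 : 0 < a / 2 by rewrite divr_gt0.
have mW : measurable (~` `[m - r, m + r]%classic) by exact: measurableC.
have := integral_gauss m a0.
rewrite -(setUv `[m - r, m + r]%classic) ge0_integral_setU//; last 2 first.
- by rewrite setUv.
- exact/disj_setPCl.
move=> sumE; rewrite EFinB -sumE leeBlDr//; apply: leeD => //.
apply: (@le_trans _ _ (\int[mu]_(x in ~` `[(m - r)%R, (m + r)%R])
  ((expR (- (a / 2 * r ^+ 2)))%:E * (expR (- (a / 2 * (x - m) ^+ 2)))%:E))%E).
  apply: ge0_le_integral => //.
  - exact: measurable_funTS.
  - apply: measurable_funTS; apply/measurable_EFinP; apply: measurable_funM => //.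
    exact: measurable_gauss.
  move=> x /= xr; rewrite -EFinM lee_fin -expRD ler_expR.
  have : r ^+ 2 <= (x - m) ^+ 2.
    rewrite -(real_normK (num_real (x - m))) lerXn2r ?nnegrE//.
    rewrite leNgt; apply/negP => h; apply: xr; rewrite in_itv/=.
    by move: h; rewrite ltr_norml => /andP[]; lra.
  by move=> h; have := ler_pM2l a20 (r ^+ 2) ((x - m) ^+ 2); rewrite h; lra.
rewrite ge0_integralZl//.
- rewrite EFinM lee_wpmul2l//.
  rewrite -(integral_gauss m a20); apply: ge0_subset_integral => //.
  by apply/measurable_EFinP; exact: measurable_gauss.
- by apply: measurable_funTS; apply/measurable_EFinP; exact: measurable_gauss.
Qed.

Lemma integral_expR_halfline (a : R) : 0 < a ->
  (\int[mu]_x (a^-1 * exponential_pdf a x)%:E = (a^-1)%:E)%E.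
Proof.
move=> a0; under eq_integral do rewrite EFinM.
rewrite ge0_integralZl//.
- by rewrite integral_exponential_pdf// mule1.
- by apply/measurable_EFinP; exact: measurable_exponential_pdf.
- by move=> x _; rewrite lee_fin exponential_pdf_ge0// ltW.
- by rewrite lee_fin invr_ge0 ltW.
Qed.

End ExponentialIntegral.

Section Chernoff.
Context (R : realType) (s : R) (s0 : 0 < s).

(** The excess of x^(-s) over its tangent at 1. *)
Definition convexity_gap (x : R) := x `^ (- s) - 1 + s * (x - 1).

(** Twice the inequality ln r <= r - 1 at r = sqrt x. *)
Lemma ln_le_sqrt (x : R) : 0 < x -> x - 1 - ln x >= (Num.sqrt x - 1) ^+ 2.
Proof.
move=> x0; have r0 : 0 < Num.sqrt x by rewrite sqrtr_gt0.
have xE : x = Num.sqrt x * Num.sqrt x by rewrite -expr2 sqr_sqrtr// ltW.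
have lE : ln x = ln (Num.sqrt x) + ln (Num.sqrt x) by rewrite {1}xE lnM.
have : ln (Num.sqrt x) <= Num.sqrt x - 1.
  have := @le_ln1Dx R (Num.sqrt x - 1).
  by rewrite (_ : 1 + _ = Num.sqrt x); [apply; lra|ring].
set q := Num.sqrt x in r0 xE lE * => h; rewrite lE; nra.
Qed.

(** As x^(-s) = e^(-s ln x) >= 1 - s ln x, the gap is at least s (x - 1 - ln x). *)
Lemma convexity_gap_ge (x : R) : 0 < x ->
  s * (Num.sqrt x - 1) ^+ 2 <= convexity_gap x.
Proof.
move=> x0; rewrite /convexity_gap /powR gt_eqF//.
have h1 := expR_ge1Dx (- s * ln x).
have h2 := ler_wpM2l (ltW s0) (ln_le_sqrt x0).
nra.
Qed.

Lemma convexity_gap_ge0 (x : R) : 0 < x -> 0 <= convexity_gap x.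
Proof.
by move=> x0; apply: le_trans (convexity_gap_ge x0); rewrite mulr_ge0 ?sqr_ge0// ltW.
Qed.

Lemma convexity_gap_away (del : R) : 0 < del ->
  exists2 eta : R, 0 < eta &
    forall x, 0 < x -> del < `|x - 1| -> s * eta <= convexity_gap x.
Proof.
move=> d0; pose e1 := Num.sqrt (1 + del) - 1.
have e10 : 0 < e1 by rewrite subr_gt0 -[X in X < _]sqrtr1 ltr_sqrt; lra.
(* The two entries bound (sqrt x - 1)^2 for x > 1 and for x < 1; in the latter case 1 - sqrt x = (1
   - x)/(1 + sqrt x) >= (1 - x)/2. *)
exists (Num.min (e1 ^+ 2) ((del / 2) ^+ 2)).
  by rewrite lt_min !exprn_gt0// divr_gt0.
move=> x x0 xd; apply: le_trans (convexity_gap_ge x0); rewrite ler_pM2l//.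
have r0 : 0 < Num.sqrt x by rewrite sqrtr_gt0.
have xE : x = Num.sqrt x * Num.sqrt x by rewrite -expr2 sqr_sqrtr// ltW.
rewrite ge_min; apply/orP; case: (ltP 1 x) => x1.
  left; rewrite gtr0_norm in xd; last by lra.
  have : Num.sqrt (1 + del) <= Num.sqrt x by rewrite ler_sqrt; lra.
  by rewrite /e1 in e10 *; nra.
right; rewrite ler0_norm in xd; last by lra.
have r1 : Num.sqrt x <= 1 by rewrite -[leRHS]sqrtr1 ler_sqrt.
have : del / 2 <= 1 - Num.sqrt x by nra.
nra.
Qed.

(* As u^(-s) >= y^(-s) (1 - s (u / y - 1)), a sum of j terms u^(-s) at most w
   forces the sum of the u to be at least the first two terms in the bracket;
   Markov's inequality for exp(th * sum) then gives the bound.  The excess [x]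
   records the defect of the tangent inequality. *)
Definition chernoff_bound (j : nat) (w y th x : R) :=
  ((1 - th) ^- j) * expR (- (th * (j%:R * y + (j%:R * y `^ (- s) - w) *
     (y `^ (s + 1) / s) + x))).

(** The slope of u^(-s) at y is -1/Y with Y = y^(s+1)/s, so the tangent inequality with defect [eta]
    reads u - y - y eta >= -(u^(-s) - y^(-s)) Y. Used with weight th it leaves e^(-(1 - th) u),
    whose integral is the new factor 1/(1 - th). Only this exponential is confined to [B], hence a
    single defect. *)
Lemma chernoff_step (f : R -> R) (B : set R) j (w y th eta : R) : measurable B ->
  measurable_fun setT f -> (forall u, 0 <= f u <= 1) ->
  0 < y -> 0 < th < 1 -> 
  (forall u, B u -> 0 < u -> s * eta <= convexity_gap (u / y)) ->
  (forall u, f u <= chernoff_bound j (w - u `^ (- s)) y th 0) ->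
  fine (\int[exp1 R]_(u in B) (f u)%:E) <= chernoff_bound j.+1 w y th (y * eta).
Proof.
move=> mB mf f01 y0 /andP[th0 th1] gap fub.
have t10 : 0 < 1 - th by rewrite subr_gt0.
pose phi u := (1 - th)^-1 * exponential_pdf (1 - th) u.
pose C := (1 - th) ^- j * expR (- (th * (j.+1%:R * y + (j.+1%:R * y `^ (- s) - w) *
     (y `^ (s + 1) / s) + y * eta))).
have C0 : 0 <= C by rewrite mulr_ge0 ?expR_ge0// invr_ge0 exprn_ge0// ltW.
rewrite (_ : chernoff_bound _ _ _ _ _ = C * (1 - th)^-1); last first.
  by rewrite /chernoff_bound /C exprSr invfM; ring.
apply: (exp1_integral_ub (phi := phi)) => //.
- apply: measurable_funM => //; exact: measurable_exponential_pdf.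
- by move=> u; rewrite mulr_ge0 ?exponential_pdf_ge0// ?invr_ge0 ltW.
- by rewrite integral_expR_halfline.
move=> u Bu u0; rewrite /phi exponential_pdfE ?(ltW u0)// mulKf ?gt_eqF//.
apply: (@le_trans _ _ (chernoff_bound j (w - u `^ (- s)) y th 0 * expR (- u))).
  by rewrite ler_pM2r ?expR_gt0.
rewrite /chernoff_bound /C -!mulrA -!expRD.
rewrite ler_pM2l ?invr_gt0 ?exprn_gt0// ler_expR.
have uE : u `^ (- s) = y `^ (- s) * (u / y) `^ (- s).
  by rewrite -powRM ?ltW ?divr_gt0// mulrC divfK ?gt_eqF.
have := gap u Bu u0; rewrite /convexity_gap => g.
have yE : y `^ (- s) * y `^ (s + 1) = y.
  rewrite -powRD; last by rewrite (gt_eqF y0) implybT.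
  by rewrite addKr powRr1// ltW.
have sN : s != 0 by rewrite gt_eqF.
have E1 : (u `^ (- s) - y `^ (- s)) * (y `^ (s + 1) / s) =
   y / s * ((u / y) `^ (- s) - 1).
  transitivity (y `^ (- s) * y `^ (s + 1) / s * ((u / y) `^ (- s) - 1)).
    by rewrite uE; ring.
  by rewrite yE.
have E2 : y * eta + y - u <= (u `^ (- s) - y `^ (- s)) * (y `^ (s + 1) / s).
  rewrite E1 -subr_ge0.
  rewrite (_ : _ - _ = y / s * ((u / y) `^ (- s) - 1 + s * (u / y - 1) - s * eta)).
    by rewrite mulr_ge0 ?divr_ge0 ?(ltW y0) ?(ltW s0)// subr_ge0.
  by field; rewrite sN gt_eqF.
rewrite -natr1; set Y := y `^ (s + 1) / s in E2 *.
by have := ler_wpM2l (ltW th0) E2; lra.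
Qed.

(** The tangent point y is free; the choice j y^(-s) = w leaves the bound (1 - th)^(-j) e^(-th j
    y). *)
Lemma sum_cdf_chernoff j (w y th : R) : 0 < y -> 0 < th < 1 ->
  sum_cdf s j w <= chernoff_bound j w y th 0.
Proof.
move=> y0 /andP[th0 th1]; elim: j w => [|j IH] w.
  rewrite /= /chernoff_bound expr0 invr1 mul1r !mul0r add0r addr0.
  case: (leP 0 w) => w0 /=; last exact: expR_ge0.
  rewrite -[leLHS]expR0 ler_expR sub0r mulNr mulrN opprK.
  apply: mulr_ge0; first exact: ltW.
  apply: mulr_ge0 => //; apply: divr_ge0; [exact: powR_ge0|exact: ltW].
rewrite -[X in chernoff_bound _ _ _ _ X](mulr0 y).
apply: chernoff_step => //.
- by apply/measurable_EFinP; exact: measurable_sum_cdf.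
- by move=> u; rewrite sum_cdf_ge0 sum_cdf_le1.
- exact/andP.
- by move=> u _ u0; rewrite mulr0 convexity_gap_ge0// divr_gt0.
Qed.

Lemma sum_cdf_chernoff_gap j (B : set R) (w y th eta : R) : measurable B ->
  0 < y -> 0 < th < 1 ->
  (forall u, B u -> 0 < u -> s * eta <= convexity_gap (u / y)) ->
  fine (\int[exp1 R]_(u in B) (sum_cdf s j (w - u `^ (- s)))%:E) <=
  chernoff_bound j.+1 w y th (y * eta).
Proof.
move=> mB y0 th01 gap; apply: chernoff_step => //.
- by apply/measurable_EFinP; exact: measurable_sum_cdf.
- by move=> u; rewrite sum_cdf_ge0 sum_cdf_le1.
- by move=> u; exact: sum_cdf_chernoff.
Qed.

End Chernoff.

(** * Laplace asymptotics *)

Section Taylor.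
Context (R : realType).

Lemma near_delta (m : R) (Q : R -> Prop) : (\forall x \near m, Q x) ->
  exists2 del : R, 0 < del & forall x, `|x - m| <= del -> Q x.
Proof.
move=> /nbhs_ballP[e /= e0 h]; exists (e / 2); first by rewrite divr_gt0.
move=> x xm; apply: h; rewrite /ball /= distrC (le_lt_trans xm)//.
by rewrite ltr_pdivrMr// ltr_pMr// ltr1n.
Qed.

(** Only differentiability of D at 1 is at hand, not a second derivative nearby. By Caratheodory D x
    = g x (x - 1) with g continuous at 1, so the derivative of the remainder is at most eps |x - 1|,
    and the mean value theorem finishes. *)
Lemma taylor2 (f D : R -> R) (kappa eps : R) : 0 < eps ->
  (\forall x \near (1 : R), is_derive (x : R) (1 : R) f (D x)) -> f 1 = 0 -> D 1 = 0 ->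
  is_derive (1 : R) (1 : R) D kappa ->
  \forall x \near (1 : R),
    `|f x - kappa / 2 * (x - 1) ^+ 2| <= eps * (x - 1) ^+ 2.
Proof.
move=> eps0 df f1 D1 /is_derive1_caratheodory[g [Dg gc g1]].
have gn : \forall x \near (1 : R), `|g x - kappa| <= eps.
  have gk : g x @[x --> (1 : R)] --> kappa by rewrite -g1; exact: gc.
  move: gk => /cvgrPdist_le /(_ _ eps0).
  by apply: filterS => x; rewrite distrC.
have [d1 d10 h1] := near_delta df.
have [d2 d20 h2] := near_delta gn.
pose dd := Num.min d1 d2.
have dd0 : 0 < dd by rewrite lt_min d10.
exists dd => //= x; rewrite /= distrC => /ltW xdd.
pose F z := f z - kappa / 2 * (z - 1) ^+ 2.
have dF z : `|z - 1| <= dd -> is_derive z 1 F (D z - kappa * (z - 1)).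
  rewrite le_min => /andP[z1 _]; have dfz := h1 z z1.
  pose G := f - (kappa / 2) \*: ((id - cst 1) ^+ 2).
  have -> : F = G by apply/funext => t; rewrite /F /G /= !fctE.
  apply: is_derive_eq.
  rewrite subr0 /GRing.scale /= !fctE /= expr1.
  by field.
have F1 : F 1 = 0 by rewrite /F f1 subrr expr0n mulr0 subr0.
have DB z : `|z - 1| <= dd -> `|D z - kappa * (z - 1)| <= eps * `|z - 1|.
  rewrite le_min => /andP[_ z2].
  have := Dg z; rewrite D1 subr0 => ->.
  by rewrite -mulrBl normrM ler_wpM2r// h2.
have Fx : `|F x| <= (eps * `|x - 1|) * `|x - 1|.
  have cont a b : (forall z, z \in `[a, b] -> `|z - 1| <= dd) ->
      {within `[a, b], continuous F}.
    move=> ab; apply: derivable_within_continuous => z zab.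
    by have [] := dF z (ab z zab).
  have [x1|x1] := leP 1 x.
    have inn z : z \in `[1, x] -> `|z - 1| <= `|x - 1|.
      by rewrite in_itv/= => /andP[z1 zx]; rewrite !ger0_norm ?lerD2r ?subr_ge0.
    have [||c /inn ci] := @MVT_segment _ F (fun z => D z - kappa * (z - 1)) _ _ x1.
    - move=> z zi; apply: dF; apply: le_trans xdd; apply: inn.
      exact: subset_itv_oo_cc zi.
    - by apply: cont => z /inn h; exact: le_trans h xdd.
    rewrite F1 subr0 => ->; rewrite normrM ler_wpM2r//.
    apply: le_trans (DB c (le_trans ci xdd)) _.
    by rewrite ler_pM2l.
  have inn z : z \in `[x, 1] -> `|z - 1| <= `|x - 1|.
    by rewrite in_itv/= => /andP[z1 zx]; rewrite !ler0_norm ?lerN2 ?lerD2r ?subr_le0 ?(ltW x1).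
  have [||c /inn ci] := @MVT_segment _ F (fun z => D z - kappa * (z - 1)) _ _ (ltW x1).
  - move=> z zi; apply: dF; apply: le_trans xdd; apply: inn.
    exact: subset_itv_oo_cc zi.
  - by apply: cont => z /inn h; exact: le_trans h xdd.
  rewrite F1 sub0r => /eqP; rewrite eqr_oppLR -mulrN opprB => /eqP ->.
  rewrite normrM ler_wpM2r//.
  apply: le_trans (DB c (le_trans ci xdd)) _.
  by rewrite ler_pM2l.
by move: Fx; rewrite -mulrA -expr2 real_normK ?num_real.
Qed.

End Taylor.

Section LaplaceStep.
Context (R : realType) (s : R) (s0 : 0 < s) (K : R) (K0 : 0 < K).
Let p := s^-1.
Let p0 : 0 < p. Proof. by rewrite invr_gt0. Qed.

(* If a first edge x y leads to the total weight (K + 1) y^(-s), then the K other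
   edges have weight K (rest_point x * y)^(-s). *)
Definition rest_weight (x : R) := (K + 1 - x `^ (- s)) / K.
Definition rest_point (x : R) := rest_weight x `^ (- s^-1).
Definition rest_point_deriv (x : R) :=
  1 - rest_weight x `^ (- s^-1 - 1) * x `^ (- s - 1).

Lemma is_derive_rest_weight (x : R) : 0 < x ->
  is_derive x 1 rest_weight (s * x `^ (- s - 1) / K).
Proof.
move=> x0; pose G := K^-1 \*: (cst (K + 1) - (@powR R ^~ (- s))).
have -> : rest_weight = G.
  by apply/funext => t; rewrite /G /rest_weight /= !fctE /= mulrC.
have dp := is_derive1_powR (- s) x0.
apply: is_derive_eq; rewrite /GRing.scale /= sub0r mulNr opprK.
by rewrite mulrC.
Qed.

Lemma rest_weight1 : rest_weight 1 = 1.
Proof. by rewrite /rest_weight powR1 addrK divff ?gt_eqF. Qed.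

Lemma rest_weight_near : \forall x \near (1 : R), 0 < x /\ 0 < rest_weight x.
Proof.
near=> x; split; first by near: x; exact: lt_nbhsr.
near: x; have c : rest_weight x @[x --> (1 : R)] --> (1 : R).
  rewrite -[X in _ --> X]rest_weight1.
  apply: differentiable_continuous; apply/derivable1_diffP.
  by have [] := @is_derive_rest_weight 1 ltr01.
by move: c => /cvgr_gt /(_ 0 ltr01).
Unshelve. all: by end_near. Qed.

Lemma is_derive_rest_point (x : R) : 0 < x -> 0 < rest_weight x ->
  is_derive x 1 rest_point
    (- (rest_weight x `^ (- s^-1 - 1) * x `^ (- s - 1) / K)).
Proof.
move=> x0 b0.
have dp := is_derive1_powR (- s^-1) b0.
have db := is_derive_rest_weight x0.
have := is_derive1_comp dp db.
rewrite (_ : _ * _ = - (rest_weight x `^ (- s^-1 - 1) * x `^ (- s - 1) / K))//.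
by field; rewrite !gt_eqF.
Qed.

Lemma rest_point1 : rest_point 1 = 1.
Proof. by rewrite /rest_point rest_weight1 powR1. Qed.

(** The second derivative at x = 1 of K [rest_point] x + x, which is the sum of the exponentials in
    units of y when the K other edges are equal: s + 1 comes from x^(-s-1) and (s + 1)/K from
    [rest_weight]. *)
Definition rest_kappa := (s + 1) * (K + 1) / K.

Lemma rest_kappa_gt0 : 0 < rest_kappa.
Proof. by rewrite divr_gt0// mulr_gt0// addr_gt0. Qed.

Lemma rest_point_taylor (eps : R) : 0 < eps -> \forall x \near (1 : R),
  `|K * rest_point x + x - (K + 1) - rest_kappa / 2 * (x - 1) ^+ 2| <=
    eps * (x - 1) ^+ 2.
Proof.
move=> eps0.
apply: (@taylor2 _ (fun x => K * rest_point x + x - (K + 1)) rest_point_deriv) => //.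
- apply: filterS rest_weight_near => x [x0 b0].
  have da := is_derive_rest_point x0 b0.
  pose G := K \*: rest_point + id - cst (K + 1).
  rewrite (_ : (fun _ => _) = G); last by apply/funext => t; rewrite /G /= !fctE.
  apply: is_derive_eq; rewrite subr0 /GRing.scale /= /rest_point_deriv.
  by field; rewrite !gt_eqF.
- by rewrite rest_point1; ring.
- by rewrite /rest_point_deriv rest_weight1 !powR1 mulr1 subrr.
have b1 : 0 < rest_weight 1 by rewrite rest_weight1.
have dp := is_derive1_powR (- s^-1 - 1) b1.
have db := is_derive_rest_weight (@ltr01 R).
have dc := is_derive1_comp dp db.
have dx := @is_derive1_powR R (- s - 1) 1 ltr01.
pose G := cst 1 - (((@powR R ^~ (- s^-1 - 1)) \o rest_weight) * (@powR R ^~ (- s - 1))).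
rewrite (_ : rest_point_deriv = G); last first.
  by apply/funext => t; rewrite /G /rest_point_deriv /= !fctE.
apply: is_derive_eq.
rewrite /GRing.scale /= rest_weight1 !powR1 /rest_kappa.
by field; rewrite !gt_eqF.
Qed.

Lemma rest_point_cvg : rest_point x @[x --> (1 : R)] --> (1 : R).
Proof.
rewrite -[X in _ --> X]rest_point1.
apply: differentiable_continuous; apply/derivable1_diffP.
have b1 : 0 < rest_weight 1 by rewrite rest_weight1.
by have [] := is_derive_rest_point ltr01 b1.
Qed.

(** In the Laplace step the induction hypothesis is applied at [rest_point] x times y. This point
    must tend to infinity with y, hence the bound 1/2, and the factor sqrt([rest_point] x)^j that it
    produces must be close to 1. *)
Lemma rest_point_window (j : nat) (eps : R) : 0 < eps -> exists2 del : R,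
  0 < del < 1 & forall x, `|x - 1| <= del ->
    [/\ 0 < x, 0 < rest_weight x, 2^-1 <= rest_point x,
     1 - eps <= Num.sqrt (rest_point x) ^+ j <= 1 + eps &
     (1 - eps) * (rest_kappa / 2) * (x - 1) ^+ 2 <=
       K * rest_point x + x - (K + 1) <=
     (1 + eps) * (rest_kappa / 2) * (x - 1) ^+ 2].
Proof.
move=> eps0.
have k0 := rest_kappa_gt0.
have e0 : 0 < eps * (rest_kappa / 2) by rewrite mulr_gt0// divr_gt0.
have h1 := rest_weight_near.
have h2 := rest_point_taylor e0.
have h3 : \forall x \near (1 : R), 2^-1 <= rest_point x.
  move: rest_point_cvg => /cvgr_gt /(_ 2^-1); rewrite invf_lt1 ?ltr1n// => /(_ isT).
  by apply: filterS => x /ltW.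
have h4 : \forall x \near (1 : R),
    1 - eps <= Num.sqrt (rest_point x) ^+ j <= 1 + eps.
  have b1 : 0 < rest_weight 1 by rewrite rest_weight1.
  have a1 : 0 < rest_point 1 by rewrite rest_point1.
  have dr := is_derive_rest_point ltr01 b1.
  have dq := is_derive1_comp (is_derive1_sqrt a1) dr.
  have [dj _] := is_deriveX j dq.
  have : ((Num.sqrt \o rest_point) ^+ j) x @[x --> (1 : R)] -->
      ((Num.sqrt \o rest_point) ^+ j) 1.
    by apply: differentiable_continuous; apply/derivable1_diffP.
  rewrite !fctE /= rest_point1.
  rewrite sqrtr1 expr1n => /cvgrPdist_le /(_ _ eps0); apply: filterS => x.
  by rewrite ler_distlC.
have [d d0 h] := near_delta (filterI (filterI h1 h2) (filterI h3 h4)).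
exists (Num.min d 2^-1).
  by rewrite lt_min d0/= invr_gt0 ltr0n/= gt_min invf_lt1 ?ltr1n// orbT.
move=> x; rewrite le_min => /andP[xd _].
have [[[x0 b0] t] [a2 a4]] := h x xd.
split => //.
by move: t; rewrite ler_norml => /andP[]; lra.
Qed.

End LaplaceStep.

Section LaplaceAsymptotics.
Context (R : realType) (s : R) (s0 : 0 < s).
Notation mu := (@lebesgue_measure R).

(** The bound e^z >= (z/(n + 1))^(n + 1) has one power more than y^n, so the product is at most M /
    y. *)
Lemma poly_expR_small (n : nat) (eta C eps : R) : 0 < eta -> 0 < eps -> 0 <= C ->
  exists2 Y : R, 0 < Y & forall y, Y <= y -> C * y ^+ n * expR (- (eta * y)) <= eps.
Proof.
move=> eta0 eps0 C0; pose M := C * (n.+1%:R / eta) ^+ n.+1.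
have M0 : 0 <= M by rewrite mulr_ge0// exprn_ge0// divr_ge0// ltW.
exists (M / eps + 1); first by rewrite ltr_wpDl// divr_ge0// ltW.
move=> y yY; have y0 : 0 < y.
  by apply: lt_le_trans yY; rewrite ltr_wpDl// divr_ge0// ltW.
have n0 : n.+1%:R != 0 :> R by rewrite pnatr_eq0.
have E : expR (eta * y) = expR (eta * y / n.+1%:R) ^+ n.+1.
  by rewrite -expRM_natl; congr expR; field.
have h : (eta * y / n.+1%:R) ^+ n.+1 <= expR (eta * y).
  rewrite E lerXn2r ?nnegrE ?expR_ge0//.
    by rewrite divr_ge0// mulr_ge0// ltW.
  by apply: le_trans (expR_ge1Dx _); rewrite lerDr.
rewrite expRN ler_pdivrMr ?expR_gt0//.
apply: le_trans (ler_wpM2l (ltW eps0) h).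
have -> : eta * y / n.+1%:R = y / (n.+1%:R / eta).
  by move: (n.+1%:R : R) n0 => N n0; field; rewrite ?n0 ?gt_eqF.
rewrite expr_div_n mulrA ler_pdivlMr ?exprn_gt0 ?divr_gt0//.
rewrite (_ : _ * _ * _ = M * y ^+ n); last by rewrite /M; ring.
rewrite exprS mulrA ler_wpM2r ?exprn_ge0 ?(ltW y0)//.
have : M / eps <= y by lra.
by rewrite ler_pdivrMr// mulrC.
Qed.

Lemma exp1_tail (y : R) : 0 <= y ->
  (\int[mu]_(x in `[y, +oo[) (exponential_pdf 1 x)%:E = (expR (- y))%:E)%E.
Proof.
move=> y0.
have cE (z : R) : {for z, continuous (fun x : R^o => - expR (- 1 * x))}.
  apply: differentiable_continuous; apply/derivable1_diffP.
  exact: ex_derive.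
rewrite (@ge0_continuous_FTC2y _ _ (fun x => - (expR (- 1 * x))) _ 0)//.
- by rewrite sub0e mulN1r -EFinN opprK.
- by move=> x _; exact: exponential_pdf_ge0.
- apply: (@continuous_subspaceW R^o _ _ [set` `[0, +oo[%R]).
    by apply: subset_itvr; rewrite bnd_simp.
  exact: within_continuous_exponential_pdf.
- rewrite -oppr0; apply: cvgN.
  rewrite (_ : (fun x => _) = (fun z : R => expR (- z))); last first.
    by apply: eq_fun => x; rewrite mulN1r.
  exact: cvgr_expR.
- by apply/cvg_at_right_filter; exact: cE.
- move=> x; rewrite in_itv/= andbT => xy; apply: derive1_exponential_pdf.
  by rewrite in_itv/= andbT (le_lt_trans y0).
Qed.

Lemma exp1_ge (y : R) : 0 <= y -> exp1 R `[y, +oo[%classic = (expR (- y))%:E.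
Proof. exact: exp1_tail. Qed.

Lemma powRN_le (u y : R) : 0 < u -> 0 < y -> u `^ (- s) <= y `^ (- s) -> y <= u.
Proof.
move=> u0 y0; rewrite !powRN lef_pV2 ?posrE ?powR_gt0//.
apply: contraTT; rewrite -!ltNge => uy.
by apply: gt0_ltr_powR => //; rewrite nnegrE ltW.
Qed.

Lemma sum_cdf1 (y : R) : 0 < y -> sum_cdf s 1 (y `^ (- s)) = expR (- y).
Proof.
move=> y0; pose f u := sum_cdf s 0 (y `^ (- s) - u `^ (- s)).
have mf : measurable_fun setT f.
  by apply/measurable_EFinP; exact: measurable_sum_cdf.
have f01 u : 0 <= f u <= 1 by rewrite sum_cdf_ge0 sum_cdf_le1.
have mpdf := measurable_exponential_pdf (1 : R).
have mW : measurable `[y, +oo[%classic by [].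
apply/eqP; rewrite eq_le; apply/andP; split.
  rewrite -[leRHS]mul1r /=.
  apply: (exp1_integral_ub (phi := fun u => exponential_pdf 1 u * \1_`[y, +oo[ u)) => //.
  - by apply: measurable_funM => //; exact: measurable_indic.
  - by move=> u; rewrite mulr_ge0// exponential_pdf_ge0.
  - rewrite -exp1_tail ?(ltW y0)// [in leRHS]integral_mkcond le_eqVlt.
    apply/orP; left; apply/eqP; apply: eq_integral => u _.
    rewrite patchE indicE; case: ifP => h; rewrite ?mulr1 ?mulr0//.
  move=> u _ u0; rewrite mul1r /f /= subr_ge0.
  case: (leP (u `^ (- s)) (y `^ (- s))) => h; last first.
    by rewrite mul0r mulr_ge0// exponential_pdf_ge0.
  have yu := powRN_le u0 y0 h.
  rewrite indicE mem_set ?mulr1/=; last by rewrite in_itv/= yu.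
  by rewrite exponential_pdfE ?(ltW u0)// !mul1r mulN1r.
apply: (@le_trans _ _ (fine (\int[exp1 R]_(u in `[y, +oo[) (f u)%:E))%E).
  rewrite -[leLHS]mul1r.
  apply: (exp1_integral_lb (phi := exponential_pdf 1)) => //.
  - by move=> u; exact: exponential_pdf_ge0.
  - by rewrite exp1_tail// ltW.
  - by move=> u; rewrite /= in_itv/= andbT => /(le_trans (ltW y0)).
  move=> u; rewrite /= in_itv/= andbT => yu.
  have u0 := lt_le_trans y0 yu.
  rewrite exponential_pdfE ?(ltW u0)// !mul1r mulN1r /f /= subr_ge0.
  have -> : u `^ (- s) <= y `^ (- s).
    rewrite !powRN lef_pV2 ?posrE ?powR_gt0//.
    by apply: ge0_ler_powR; rewrite ?nnegrE ?(ltW s0) ?(ltW y0) ?(ltW u0).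
  by rewrite mul1r.
rewrite -lee_fin sum_cdfS fineK ?sum_cdf_fin//.
apply: ge0_subset_integral => //.
  exact/measurable_EFinP.
by move=> u _; rewrite lee_fin; have /andP[] := f01 u.
Qed.

(** [laplace_main] j y is the asymptotic value for j + 1 edges of total weight at most (j + 1)
    y^(-s): e^(-(j+1) y) belongs to the point where all exponentials equal y, and each of the j
    splittings contributes a Gaussian factor of order sqrt y. *)
Definition laplace_const (j : nat) : R :=
  Num.sqrt (2 * pi / (s + 1)) ^+ j / Num.sqrt j.+1%:R.

Definition laplace_main (j : nat) (y : R) : R :=
  laplace_const j * Num.sqrt y ^+ j * expR (- (j.+1%:R * y)).

Lemma laplace_const_gt0 j : 0 < laplace_const j.
Proof.
rewrite divr_gt0 ?sqrtr_gt0// exprn_gt0// sqrtr_gt0.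
by rewrite divr_gt0 ?addr_gt0// mulr_gt0// pi_gt0.
Qed.

(** The Gaussian factor of one more edge is sqrt(2 pi y K / ((s + 1)(K + 1))) with K = j + 1; the
    quotients K/(K + 1) telescope, which explains the root in the denominator of [laplace_const]. *)
Lemma laplace_mainS j y : 0 < y -> laplace_main j.+1 y =
  laplace_const j * Num.sqrt y ^+ j * expR (- (j.+2%:R * y)) *
  Num.sqrt (pi / (rest_kappa s j.+1%:R / (2 * y))).
Proof.
move=> y0; rewrite /laplace_main /laplace_const.
have K0 : 0 < j.+1%:R :> R by rewrite ltr0n.
have K20 : 0 < j.+2%:R :> R by rewrite ltr0n.
have s1 : 0 < s + 1 by rewrite addr_gt0.
have pi0 := pi_gt0 R.
have E : pi / (rest_kappa s j.+1%:R / (2 * y)) =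
   (2 * pi / (s + 1)) * y * j.+1%:R / j.+2%:R.
  rewrite /rest_kappa natr1.
  move: (j.+1%:R : R) (j.+2%:R : R) K0 K20 => K K2 K0 K20.
  by field; rewrite !gt_eqF.
rewrite E; set c := 2 * pi / (s + 1).
have c0 : 0 < c by rewrite divr_gt0// mulr_gt0.
clearbody c.
rewrite sqrtrM; last by rewrite !mulr_ge0 ?(ltW c0) ?(ltW y0) ?(ltW K0).
rewrite sqrtrV ?(ltW K20)//.
rewrite sqrtrM; last by rewrite !mulr_ge0 ?(ltW c0) ?(ltW y0).
rewrite sqrtrM ?(ltW c0)//.
rewrite !exprS; field.
by rewrite !gt_eqF ?sqrtr_gt0.
Qed.

Lemma sum_cdf_window (j : nat) (u y : R) : 0 < y -> 0 < u ->
  0 < rest_weight s j.+1%:R (u / y) ->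
  j.+1%:R * (rest_point s j.+1%:R (u / y) * y) `^ (- s) =
  j.+2%:R * y `^ (- s) - u `^ (- s).
Proof.
move=> y0 u0 b0; have uE : u `^ (- s) = y `^ (- s) * (u / y) `^ (- s).
  by rewrite -powRM ?ltW ?divr_gt0// mulrC divfK ?gt_eqF.
rewrite powRM ?powR_ge0 ?(ltW y0)// /rest_point -powRrM.
rewrite mulrN mulNr opprK mulVf ?gt_eqF// powRr1 ?ltW// uE /rest_weight.
rewrite natr1; have : j.+1%:R != 0 :> R by rewrite pnatr_eq0.
by move: (j.+1%:R : R) (j.+2%:R : R) => K K2 KN; field.
Qed.

(** Let u be the first exponential. For u near y, the induction hypothesis times e^(-u) is nearly
    Gaussian in u with variance y / [kap]; the window has radius del y, far beyond the standard
    deviation of order sqrt y. Outside the window the convexity defect makes the Chernoff bound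
    exponentially smaller than the main term. *)
Lemma sum_cdf_laplace j (eps : R) : 0 < eps <= 1 ->
  exists2 Y : R, 0 < Y & forall y, Y <= y ->
    (1 - eps) * laplace_main j y <= sum_cdf s j.+1 (j.+1%:R * y `^ (- s))
    <= (1 + eps) * laplace_main j y.
Proof.
elim: j eps => [|j IH] eps /andP[eps0 eps1].
  exists 1 => // y y1; have y0 : 0 < y by lra.
  rewrite mul1r sum_cdf1// /laplace_main /laplace_const sqrtr1 !expr0 !mulr1 mul1r.
  by rewrite invr1 !mul1r; have := expR_gt0 (- y); nra.
pose K : R := j.+1%:R; have K0 : 0 < K by rewrite ltr0n.
have K1 : j.+2%:R = K + 1 by rewrite natr1.
(* The accumulated factors are (1 - e)^4 below and (1 + e)^2 (1 + 2 e) + e above; for e <= 1/8 both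
   are within 8 e of 1. *)
pose e := eps / 8.
have e0 : 0 < e by rewrite divr_gt0.
have e8 : e <= 8^-1 by rewrite /e; lra.
have em0 : 0 < 1 - e by lra.
have ep0 : 0 < 1 + e by lra.
have [del /andP[d0 d1] win] := rest_point_window s0 K0 j e0.
have [eta eta0 away] := convexity_gap_away s0 d0.
have [Y0 Y00 hY0] : exists2 Y : R, 0 < Y & forall y, Y <= y ->
    (1 - e) * laplace_main j y <= sum_cdf s j.+1 (K * y `^ (- s))
    <= (1 + e) * laplace_main j y by apply: IH; lra.
pose kap := rest_kappa s K.
have kap0 : 0 < kap by exact: rest_kappa_gt0.
have kapE : rest_kappa s K = kap by [].
rewrite kapE in win; clearbody kap.
have c1 := laplace_const_gt0 j.+1.
have ec0 : 0 < e * laplace_const j.+1 by rewrite mulr_gt0.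
have [Y1 Y10 hY1] := poly_expR_small j.+2 eta0 ec0 (expR_ge0 (K + 1 + eta)).
have kd0 : 0 < kap * del ^+ 2 / 4 by rewrite divr_gt0// mulr_gt0// exprn_gt0.
have [Y2 Y20 hY2] := poly_expR_small 0 kd0 e0 (ler0n R 2).
(* The factor 2 pays for [rest_point] >= 1/2, so that the induction hypothesis still applies at the
   rescaled point. *)
exists (2 * Y0 + Y1 + Y2 + 2); first by rewrite !addr_gt0// mulr_gt0.
move=> y yY.
have y2 : 2 <= y by lra.
have y0 : 0 < y := lt_le_trans (ltr0Sn R 1) y2.
have y1 : 1 <= y by apply: le_trans y2; rewrite ler1n.
have {}hY1 : expR (K + 1 + eta) * y ^+ j.+2 * expR (- (eta * y)) <= e * laplace_const j.+1.
  by apply: hY1; lra.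
have {}hY2 : 2 * expR (- (kap * del ^+ 2 / 4 * y)) <= e.
  by have := hY2 y; rewrite expr0 mulr1; apply; lra.
pose w := j.+2%:R * y `^ (- s).
pose f u := sum_cdf s j.+1 (w - u `^ (- s)).
have mf : measurable_fun setT f.
  by apply/measurable_EFinP; exact: measurable_sum_cdf.
have f01 u : 0 <= f u <= 1 by rewrite sum_cdf_ge0 sum_cdf_le1.
pose W : set R := `[y - del * y, y + del * y]%classic.
have mW : measurable W by exact: measurable_itv.
have Wx u : W u -> `|u / y - 1| <= del.
  rewrite /W /= in_itv/= => /andP[h1 h2].
  rewrite ler_norml lerBrDr lerBlDr ler_pdivlMr// ler_pdivrMr//.
  by apply/andP; split; lra.
have WxN u : (~` W) u -> del < `|u / y - 1|.
  move=> nW; rewrite ltNge; apply/negP => h; apply: nW.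
  move: h; rewrite /W /= in_itv/= ler_norml lerBrDr lerBlDr ler_pdivlMr//.
  by rewrite ler_pdivrMr// => /andP[h1 h2]; apply/andP; split; lra.
pose base := laplace_const j * Num.sqrt y ^+ j * expR (- (j.+2%:R * y)).
have base0 : 0 < base.
  rewrite /base mulr_gt0 ?expR_gt0// mulr_gt0 ?laplace_const_gt0//.
  by rewrite exprn_gt0// sqrtr_gt0.
have fW u : W u ->
  (1 - e) ^+ 2 * base * expR (- ((1 + e) * kap / (2 * y) * (u - y) ^+ 2))
    <= f u * expR (- u) <=
  (1 + e) ^+ 2 * base * expR (- ((1 - e) * kap / (2 * y) * (u - y) ^+ 2)).
  move=> Wu; have [x0 b0 a2 a3 a4] := win _ (Wx u Wu).
  set x := u / y in x0 b0 a2 a3 a4; set a := rest_point s K x in a2 a3 a4.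
  have uE : u = x * y by rewrite /x divfK// gt_eqF.
  have u0 : 0 < u by rewrite uE mulr_gt0.
  have a0 : 0 < a by apply: lt_le_trans a2; rewrite invr_gt0.
  have fE : f u = sum_cdf s j.+1 (K * (a * y) `^ (- s)).
    by rewrite /f /w /a /x sum_cdf_window.
  have /hY0 : Y0 <= a * y by nra.
  rewrite -fE /laplace_main sqrtrM ?(ltW a0)// exprMn.
  set q := Num.sqrt a ^+ j in a3 *.
  have ex : expR (- (K * (a * y))) * expR (- u) =
     expR (- (j.+2%:R * y)) * expR (- (y * (K * a + x - (K + 1)))).
    by rewrite -!expRD; congr expR; rewrite K1 uE; ring.
  have ymx : (u - y) ^+ 2 = y ^+ 2 * (x - 1) ^+ 2 by rewrite uE; ring.
  have g1 : (1 - e) * kap / (2 * y) * (u - y) ^+ 2 <= y * (K * a + x - (K + 1)).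
    rewrite ymx (_ : (1 - e) * kap / (2 * y) * (y ^+ 2 * (x - 1) ^+ 2) = y * ((1 - e) * (kap / 2) * (x - 1) ^+ 2)); last first.
      by field; rewrite gt_eqF.
    by rewrite ler_pM2l//; case/andP: a4.
  have g2 : y * (K * a + x - (K + 1)) <= (1 + e) * kap / (2 * y) * (u - y) ^+ 2.
    rewrite ymx (_ : (1 + e) * kap / (2 * y) * (y ^+ 2 * (x - 1) ^+ 2) = y * ((1 + e) * (kap / 2) * (x - 1) ^+ 2)); last first.
      by field; rewrite gt_eqF.
    by rewrite ler_pM2l//; case/andP: a4.
  have q0 : 0 <= q by rewrite exprn_ge0// sqrtr_ge0.
  have nE : 0 < expR (- u) by exact: expR_gt0.
  rewrite -(ler_pM2r nE) -[X in _ && X -> _](ler_pM2r nE).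
  have regroup z : z * (laplace_const j * (q * Num.sqrt y ^+ j) *
      expR (- (K * (a * y)))) * expR (- u) =
      (z * q) * base * expR (- (y * (K * a + x - (K + 1)))).
    transitivity (z * q * (laplace_const j * Num.sqrt y ^+ j) *
      (expR (- (K * (a * y))) * expR (- u))); first by ring.
    by rewrite ex /base; ring.
  rewrite !regroup => /andP[l1 l2].
  case/andP: a3 => q1 q2.
  apply/andP; split.
    apply: le_trans l1; apply: ler_pM => //.
    - by rewrite mulr_ge0 ?sqr_ge0// ltW.
    - by rewrite ler_pM2r// expr2 ler_wpM2l// ltW.
    - by rewrite ler_expR lerN2.
  apply: (le_trans l2); apply: ler_pM => //.
  - exact: mulr_ge0 (mulr_ge0 (ltW ep0) q0) (ltW base0).
  - by rewrite ler_pM2r// expr2 ler_wpM2l// ltW.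
  - by rewrite ler_expR lerN2.
have pi0 := pi_gt0 R.
pose S := Num.sqrt (pi / (kap / (2 * y))).
have S0 : 0 < S by rewrite /S sqrtr_gt0 divr_gt0// divr_gt0// mulr_gt0.
have mainE : laplace_main j.+1 y = base * S by rewrite laplace_mainS// -/K kapE.
have SE : Num.sqrt (pi / (kap / (2 * y))) = S by [].
clearbody base S.
have sumE : sum_cdf s j.+2 w = fine (\int[exp1 R]_(u in W) (f u)%:E) +
    fine (\int[exp1 R]_(u in ~` W) (f u)%:E).
  rewrite -fineD; [|exact: sum_cdf_fin|by apply: sum_cdf_fin; exact: measurableC].
  rewrite -ge0_integral_setU ?setUv//.
  - exact: measurableC.
  - exact/measurable_EFinP.
  - by move=> u _; rewrite lee_fin; case/andP: (f01 u).
  - exact/disj_setPCl.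
have out0 : 0 <= fine (\int[exp1 R]_(u in ~` W) (f u)%:E).
  by apply: fine_ge0; apply: integral_ge0 => u _; rewrite lee_fin; case/andP: (f01 u).
have outU : fine (\int[exp1 R]_(u in ~` W) (f u)%:E) <= e * laplace_main j.+1 y.
  (* With th = 1 - 1/y the prefactor is y^(j+2) and e^(-th (j+2) y) exceeds e^(-(j+2) y) only by a
     constant factor, so the defect e^(-eta y) prevails. *)
  have th : 0 < 1 - y^-1 < 1.
    rewrite subr_gt0 invf_lt1// (lt_le_trans _ y2) ?ltr1n//=.
    by rewrite ltrBlDr ltrDl invr_gt0.
  apply: (le_trans (@sum_cdf_chernoff_gap _ s s0 j.+1 (~` W) w y (1 - y^-1) eta _ y0 th _)).
  - exact: measurableC.
  - by move=> u nW u0; apply: away; [rewrite divr_gt0|exact: WxN].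
  rewrite /chernoff_bound /w subrr mul0r addr0 subKr -exprVn invrK.
  rewrite (_ : - _ = - (j.+2%:R * y) + ((K + 1 + eta) - eta * y)); last first.
    by rewrite K1; field; rewrite gt_eqF.
  rewrite expRD expRD mulrCA.
  rewrite /laplace_main [leRHS]mulrA [leRHS]mulrC ler_pM2l ?expR_gt0//.
  apply: (@le_trans _ _ (e * laplace_const j.+1)); first by rewrite mulrA [y ^+ _ * _]mulrC.
  rewrite mulrA ler_peMr ?(ltW ec0)// exprn_ege1//.
  by rewrite -[leLHS]sqrtr1 ler_sqrt// ltW.
have pos2 : 0 < 2 * y by rewrite mulr_gt0.
have inU : fine (\int[exp1 R]_(u in W) (f u)%:E) <= (1 + e) ^+ 2 * (1 + 2 * e) * (base * S).
  pose A := (1 - e) * kap / (2 * y).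
  have A0 : 0 < A by rewrite /A divr_gt0// mulr_gt0.
  apply: (@le_trans _ _ ((1 + e) ^+ 2 * base * Num.sqrt (pi / A))).
    apply: (exp1_integral_ub (phi := fun u => expR (- (A * (u - y) ^+ 2)))) => //.
    - exact: measurable_gauss.
    - by rewrite mulr_ge0 ?sqr_ge0// ltW.
    - by rewrite integral_gauss.
    - by move=> u Wu _; case/andP: (fW u Wu).
  have -> : pi / A = (1 - e)^-1 * (pi / (kap / (2 * y))).
    by rewrite /A; field; rewrite !gt_eqF.
  rewrite [Num.sqrt (_^-1 * _)]sqrtrM; last by rewrite invr_ge0 ltW.
  have : Num.sqrt (1 - e)^-1 <= 1 + 2 * e.
    rewrite -[leRHS]ger0_norm; last by clear - e0; lra.
    rewrite -sqrtr_sqr ler_sqrt; last by rewrite sqr_ge0.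
    rewrite -[leLHS]div1r ler_pdivrMr; last by lra.
    by nra.
  have b20 : 0 <= (1 + e) ^+ 2 * base * S.
    by apply: mulr_ge0 (ltW S0); apply: mulr_ge0 (ltW base0); exact: sqr_ge0.
  move=> /(ler_wpM2l b20); rewrite SE; lra.
have inL : (1 - e) ^+ 4 * (base * S) <= fine (\int[exp1 R]_(u in W) (f u)%:E).
  pose A := (1 + e) * kap / (2 * y).
  have A0 : 0 < A by rewrite /A divr_gt0// mulr_gt0.
  have r0 : 0 <= del * y by rewrite mulr_ge0// ltW.
  apply: le_trans (exp1_integral_lb (phi := fun u => expR (- (A * (u - y) ^+ 2)))
     (C := (1 - e) ^+ 2 * base) mW mf f01 _ _ _ (gauss_window_lb y A0 r0) _ _).
  - have -> : pi / (A / 2) = 2 * (pi / A).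
      by field; rewrite gt_eqF.
    rewrite [Num.sqrt (2 * _)]sqrtrM//.
    have -> : pi / A = (1 + e)^-1 * (pi / (kap / (2 * y))).
      by rewrite /A; field; rewrite !gt_eqF.
    rewrite [Num.sqrt (_^-1 * _)]sqrtrM; last by rewrite invr_ge0 ltW.
    rewrite SE.
    have t1 : 1 - e <= Num.sqrt (1 + e)^-1.
      rewrite -[leLHS]ger0_norm; last by lra.
      rewrite -sqrtr_sqr ler_sqrt; last by rewrite invr_ge0 ltW.
      rewrite -[leRHS]div1r ler_pdivlMr; last by lra.
      by nra.
    (* Bound for the Gaussian mass lost outside the window, relative to the full integral. *)
    have t2 : expR (- (A / 2 * (del * y) ^+ 2)) * Num.sqrt 2 <= e.
      apply: le_trans hY2; rewrite mulrC ler_pM ?sqrtr_ge0 ?expR_ge0//.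
        by rewrite -[leRHS]ger0_norm// -sqrtr_sqr ler_sqrt//; lra.
      rewrite ler_expR lerN2.
      rewrite (_ : A / 2 * _ = (1 + e) * (kap * del ^+ 2 / 4 * y)).
        by rewrite ler_peMl//; [rewrite mulr_ge0// ltW|lra].
      by rewrite /A; field; rewrite gt_eqF.
    set q := Num.sqrt (1 + e)^-1 in t1 *; set t := expR _ in t2 *.
    set r2 := Num.sqrt 2 in t2 *.
    rewrite (_ : _ * (q * S - _) = (1 - e) ^+ 2 * (base * S) * (q * (1 - t * r2))); last by ring.
    rewrite (_ : (1 - e) ^+ 4 * _ = (1 - e) ^+ 2 * (base * S) * ((1 - e) * (1 - e))); last by ring.
    rewrite ler_wpM2l//; first by apply: mulr_ge0 (sqr_ge0 _) (ltW (mulr_gt0 base0 S0)).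
    have e1' : 0 <= 1 - e by clear - e8; lra.
    by apply: ler_pM => //; rewrite lerD2l lerN2.
  - exact: measurable_gauss.
  - by move=> u; exact: expR_ge0.
  - by rewrite mulr_ge0 ?sqr_ge0// ltW.
  - move=> u; rewrite /W /= in_itv/= => /andP[h _]; apply: le_trans h.
    by clear - d1 y0; nra.
  - by move=> u Wu; case/andP: (fW u Wu).
rewrite -/w sumE mainE; have bS : 0 < base * S by rewrite mulr_gt0.
rewrite mainE in outU.
have e1 : eps = 8 * e by rewrite /e; field.
set M := base * S in bS outU inU inL *.
apply/andP; split.
  have : 1 - eps <= (1 - e) ^+ 4.
    by rewrite e1 (_ : (1 - e) ^+ 4 = ((1 - e) * (1 - e)) * ((1 - e) * (1 - e))); [nra|ring].
  by move=> /(ler_wpM2r (ltW bS)); lra.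
have : (1 + e) ^+ 2 * (1 + 2 * e) + e <= 1 + eps by rewrite e1; nra.
by move=> /(ler_wpM2r (ltW bS)); lra.
Qed.

End LaplaceAsymptotics.

(** * Paths in the complete graph *)

Section Edges.
Context (V : finType).
Implicit Types (x y z M : V) (s a b : seq V).

Definition edges x s : seq {set V} := pairmap (fun u v => [set u; v]%SET) x s.

Lemma size_edges x s : size (edges x s) = size s.
Proof. exact: size_pairmap. Qed.

Lemma edges_sub x s (e : {set V}) v : e \in edges x s -> v \in e -> v \in x :: s.
Proof.
elim: s x => //= y s IH x; rewrite inE => /predU1P[->|es ve].
  by rewrite !inE => /orP[->|->]; rewrite ?orbT.
by rewrite inE (IH y) ?orbT.
Qed.

Lemma edges_uniq x s : uniq (x :: s) -> uniq (edges x s).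
Proof.
elim: s x => //= y s IH x /andP[xys /IH ->]; rewrite andbT.
apply: contra xys => /edges_sub; apply.
by rewrite !inE eqxx.
Qed.

Lemma edges_card2 x s (e : {set V}) : uniq (x :: s) -> e \in edges x s -> #|e| = 2%N.
Proof.
elim: s x => //= y s IH x /andP[xys /IH {}IH]; rewrite inE => /predU1P[->|/IH//].
by rewrite cards2; case: eqP xys => // ->; rewrite mem_head.
Qed.

Lemma edges_cat x a b : edges x (a ++ b) = edges x a ++ edges (last x a) b.
Proof. exact: pairmap_cat. Qed.

(** On a path with at least two edges no edge joins the two ends, so a shared edge forces a shared
    inner vertex. *)
Lemma edge_inner x s (e : {set V}) : uniq (x :: s) -> (2 <= size s)%N ->
  e \in edges x s -> exists2 v, v \in e & (v \in s) && (v != last x s).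
Proof.
move=> U s2; elim: s x U s2 => //= y s IH x /andP[xys Uys] s2.
rewrite inE => /predU1P[->|es].
  exists y; first by rewrite !inE eqxx orbT.
  rewrite mem_head/=; case: s Uys s2 {IH xys} => //= z s /andP[+ _] _.
  by apply: contraNneq => {1}->; rewrite mem_last.
case: s IH xys Uys s2 es => // z s IH xys Uys _ es.
have [s2|] := leqP 2 (size (z :: s)).
  have [v ve /andP[vs vl]] := IH y Uys s2 es.
  by exists v => //; rewrite inE vs orbT.
case: s xys Uys es {IH} => // xyz /= /andP[yz _]; rewrite inE => /eqP -> _.
exists y; first by rewrite !inE eqxx.
by rewrite mem_head/=; move: yz; rewrite inE.
Qed.

(** Each vertex outside [A] is charged to the edge that leaves it; such an edge cannot belong to
    [F]. *)
Lemma free_new_edges a h t (F : seq {set V}) (A : pred V) :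
  (forall e v, e \in F -> v \in e -> A v) ->
  (count (predC A) (belast h t) <= count [predC F] (edges h t))%N.
Proof.
move=> FA; elim: t h => //= y t IH h.
apply: leq_add; last exact: IH.
case Ah: (A h) => //=; rewrite lt0b.
by apply/negP => /FA /(_ (set21 _ _)); rewrite Ah.
Qed.

Lemma split_common_prefix a b : size a = size b -> a != b ->
  exists c g h a2 b2, [/\ a = c ++ g :: a2, b = c ++ h :: b2 & g != h].
Proof.
elim: a b => [|g a IH] [|h b] //= [sab]; rewrite eqseq_cons.
have [->/= ab|gh _] := eqVneq g h; last by exists [::], g, h, a, b.
have [c [g' [h' [a2 [b2 [-> -> gh]]]]]] := IH b sab ab.
by exists (h :: c), g', h', a2, b2.
Qed.

(* Following [b] from the vertex where it leaves [a], the edge out of that vertex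
   is not an edge of [a], and neither is any edge out of a vertex outside [a]. *)
Lemma new_edges_ge x a b : uniq (x :: a) -> uniq (x :: b) ->
  size a = size b -> last x a = last x b -> a != b ->
  ((count (predC (mem (x :: a))) b).+1 <= count [predC (edges x a)] (edges x b))%N.
Proof.
move=> Ua Ub sab lab ab.
have [c [g [h [a2 [b2 [Ea Eb gh]]]]]] := split_common_prefix sab ab.
pose A : pred V := fun v => v \in x :: a; set F := edges x a.
have -> : count (predC (mem (x :: a))) b = count (predC A) b by [].
(* An edge of [a] lies in the common prefix, leads to [g], or comes after [g]. The first two cases
   would put [h] on the prefix or equal to [g]; the last would make [a] revisit the end of the
   prefix. *)
have new : [set last x c; h]%SET \notin F.
  rewrite /F Ea edges_cat mem_cat /= inE !negb_or; apply/and3P; split.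
  - apply/negP => /edges_sub /(_ (set22 _ _)) hc.
    by move: Ub; rewrite Eb -cat_cons cat_uniq => /and3P[_ /hasPn /(_ h (mem_head _ _))];
      rewrite /= hc.
  - apply/eqP => E; have : h \in [set last x c; g]%SET by rewrite -E set22.
    rewrite !inE => /orP[/eqP hl|/eqP hg]; last by rewrite hg eqxx in gh.
    move: Ub; rewrite Eb -cat_cons cat_uniq => /and3P[_ /hasPn /(_ h (mem_head _ _))].
    by rewrite /= hl mem_last.
  - apply/negP => /edges_sub /(_ (set21 _ _)) lc.
    move: Ua; rewrite Ea -cat_cons cat_uniq => /and3P[_ /hasPn /(_ _ lc)].
    by rewrite /= mem_last.
have lastA : A (last h b2).
  have -> : last h b2 = last x a by rewrite lab Eb last_cat.
  by rewrite /A /= mem_last.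
have cA : count (predC A) c = 0%N.
  apply/eqP; rewrite -leqn0 leqNgt -has_count; apply/hasPn => v vc /=.
  by rewrite negbK /A /= Ea inE mem_cat vc orbT.
(* The prefix and the last vertex lie on [a], so every free vertex of [b] is the start of an edge
   after [h]. *)
have -> : count (predC A) b = count (predC A) (belast h b2).
  rewrite Eb count_cat cA add0n lastI -cats1 count_cat /= lastA/= !addn0.
  by [].
rewrite Eb edges_cat count_cat /= new/= addnA addnAC.
have := @free_new_edges a h b2 F A _; rewrite /F => H.
apply: leq_trans (_ : _ <= 1 + count [predC F] (edges h b2))%N _.
  by rewrite ltnS; apply: H => e v; exact: edges_sub.
by rewrite add1n addn1 ltnS leq_addl.
Qed.

End Edges.

Section Paths.
Context (m : nat).
Notation V := 'I_m.+2.
Implicit Types (q a b : m.+1.-bseq V).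

Definition paths (j : nat) : {set m.+1.-bseq V} :=
  [set q : m.+1.-bseq V | is_path q && (size q == j)]%SET.

Definition path_edges q := edges (ord0 : V) q.

Lemma path_weightE (R : realType) (c : {set V} -> R) q :
  path_weight c q = \sum_(e <- path_edges q) c e.
Proof.
rewrite /path_weight /path_edges /edges.
rewrite (_ : pairmap _ _ _ = map c (pairmap (fun u v => [set u; v]%SET) ord0 q)).
  by rewrite big_map.
by elim: (q : seq V) (ord0 : V) => //= y s IH x; rewrite IH.
Qed.

Lemma path_edges_uniq q : is_path q -> uniq (path_edges q).
Proof. by case/andP => U _; exact: edges_uniq. Qed.

Lemma path_edges_complete q : is_path q ->
  {subset path_edges q <= complete_edges m}.
Proof.
by case/andP => U _ e eq; rewrite inE (edges_card2 U eq).
Qed.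

Lemma size_path_edges q : size (path_edges q) = size q.
Proof. exact: size_edges. Qed.

(** The first vertex is not listed in a path, so for paths this means a common inner vertex. It is
    the dependency relation of the Poisson approximation. *)
Definition meet a b : bool := has (fun v => (v \in (a : seq V)) && (v != ord_max)) b.

Lemma meet_sym a b : meet a b = meet b a.
Proof.
apply/hasP/hasP => -[v v1 /andP[v2 v3]]; exists v => //; by rewrite v1 v3.
Qed.

Lemma not_meet_disjoint k a b (e : {set V}) : (2 <= k)%N ->
  a \in paths k -> b \in paths k -> ~~ meet a b ->
  e \in path_edges a -> e \notin path_edges b.
Proof.
move=> k2; rewrite !inE => /andP[/andP[Ua /eqP la] /eqP sa] /andP[/andP[Ub /eqP lb] /eqP sb].
move=> nab ea; apply/negP => eb.
have sa2 : (2 <= size a)%N by rewrite sa.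
have [v ve /andP[va vl]] := edge_inner Ua sa2 ea.
rewrite la in vl.
have := edges_sub eb ve; rewrite inE => /predU1P[v0|vb].
  by move: Ua; rewrite /= -v0 va.
by move/hasPn: nab => /(_ v vb); rewrite va vl.
Qed.

(** Embeds paths with k edges into all functions from k - 1 positions to vertices, where sums of
    products factor over the positions. *)
Definition inner (k : nat) q : {ffun 'I_k.-1 -> V} :=
  [ffun i : 'I_k.-1 => nth ord0 q i].

Lemma inner_inj k : (1 <= k)%N -> {in paths k &, injective (inner k)}.
Proof.
move=> k1 a b; rewrite !inE => /andP[/andP[_ /eqP la] /eqP sa] /andP[/andP[_ /eqP lb] /eqP sb].
move=> E; apply: val_inj => /=; apply: (@eq_from_nth _ ord0); first by rewrite sa sb.
move=> i; rewrite sa => ik; have [ik1|ki] := ltnP i k.-1.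
  by have := congr1 (fun f : {ffun 'I_k.-1 -> V} => f (Ordinal ik1)) E; rewrite !ffunE.
have -> : i = k.-1 by lia.
have n1 (c : m.+1.-bseq V) : size c = k -> nth ord0 c k.-1 = last ord0 c.
  by move=> sc; rewrite -nth_last sc.
by rewrite !n1// la lb.
Qed.

Lemma card_paths_le j : (1 <= j)%N -> (#|paths j| <= m.+2 ^ j.-1)%N.
Proof.
move=> j1; rewrite -(card_in_imset (inner_inj j1)).
by apply: leq_trans (max_card _) _; rewrite card_ffun !card_ord.
Qed.

Lemma paths_gt0 j q : q \in paths j -> (1 <= j <= m.+1)%N.
Proof.
rewrite inE => /andP[/andP[_ /eqP lq] /eqP <-]; rewrite size_bseq andbT.
by case: (q : seq V) lq => //= /(congr1 val).
Qed.

Lemma card_paths_ge k : (1 <= k)%N -> (m ^_ k.-1 <= #|paths k|)%N.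
Proof.
move=> k1; have [km|mk] := leqP k.-1 m; last by rewrite ffact_small.
pose A := [pred v : V | (v != ord0) && (v != ord_max)].
have cA : #|A| = m.
  have := cardC (pred2 (ord0 : V) ord_max); rewrite card_ord.
  rewrite (_ : #|pred2 _ _| = 2%N); last by rewrite card2.
  have -> : #|A| = #|predC (pred2 (ord0 : V) ord_max)|.
    by apply: eq_card => v; rewrite !inE negb_or.
  by move=> /(congr1 (subn^~ 2%N)); rewrite addKn !subSS subn0 => E; exact: E.
have := card_uniq_tuples k.-1 A; rewrite cA => <-.
pose f (t : k.-1.-tuple V) : m.+1.-bseq V := insub_bseq m.+1 (rcons t ord_max).
have fE (t : k.-1.-tuple V) : f t = rcons t ord_max :> seq V.
  by rewrite /f /insub_bseq val_insubd size_rcons size_tuple ltnS km.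
have finj : injective f.
  move=> t u /(congr1 (fun q : m.+1.-bseq V => q : seq V)); rewrite !fE => /rcons_inj[E].
  exact: val_inj.
rewrite -(card_imset _ finj); apply: subset_leq_card; apply/fintype.subsetP => q.
move=> /imsetP[t]; rewrite inE => /andP[/allP At Ut] ->.
rewrite inE /is_path fE size_rcons size_tuple prednK// eqxx andbT last_rcons eqxx andbT.
rewrite -rcons_cons rcons_uniq /= Ut andbT inE !negb_or/=.
by apply/andP; split; apply/negP => /At /=; rewrite ?eqxx ?andbF.
Qed.

Context (R : realType) (rho : R).
Hypothesis rho0 : 0 <= rho.

Let free a : pred V := predC (mem (ord0 :: (a : seq V))).

(** Distinctness of the vertices is dropped: over all functions, rho to the number of free vertices
    is a product over positions. Meeting [a] forces some position to carry one of at most k + 1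
    vertices; the factor k bounds the choice of that position. The case rho = 1 counts the paths
    that meet [a]. *)
Lemma sum_meet_le k a : (2 <= k)%N -> a \in paths k ->
  \sum_(b in paths k | meet a b) rho ^+ count (free a) b <=
  k%:R * k.+1%:R * (k.+1%:R + m.+2%:R * rho) ^+ k.-2.
Proof.
move=> k2 ak; have k1 : (1 <= k)%N by exact: ltnW.
pose w v : R := if free a v then rho else 1.
have w0 v : 0 <= w v by rewrite /w; case: ifP.
pose G (f : {ffun 'I_k.-1 -> V}) : R := \prod_i w (f i).
have G0 f : 0 <= G f by apply: prodr_ge0.
pose Q (f : {ffun 'I_k.-1 -> V}) := [exists i, ~~ free a (f i)].
have pathG b : b \in paths k -> rho ^+ count (free a) b = G (inner k b).
  rewrite inE => /andP[/andP[_ /eqP lb] /eqP sb].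
  (* The last vertex has weight 1, so only the k - 1 inner positions contribute. *)
  have nfree : free a ord_max = false.
    move: ak; rewrite inE => /andP[/andP[_ /eqP la] _].
    by apply/negbTE; rewrite /free /= negbK -[ord_max]la mem_last.
  have -> : rho ^+ count (free a) b = \prod_(v <- (b : seq V)) w v.
    elim: (b : seq V) => [|v r IH] /=; first by rewrite big_nil.
    rewrite big_cons -IH /w; case: ifP => _ /=; first by rewrite exprS.
    by rewrite mul1r.
  have Eb : (b : seq V) = rcons (take k.-1 b) ord_max.
    rewrite -[LHS](cat_take_drop k.-1) -cats1; congr (_ ++ _).
    rewrite (drop_nth ord0); last by rewrite sb; lia.
    rewrite prednK// drop_oversize ?sb//.
    by rewrite -lb -nth_last sb.
  rewrite Eb -cats1 big_cat /= big_seq1 {2}/w nfree mulr1.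
  rewrite (big_nth ord0) size_takel; last by rewrite sb leq_pred.
  rewrite big_mkord /G; apply: eq_bigr => i _; rewrite ffunE.
  by rewrite nth_take.
have meetQ b : b \in paths k -> meet a b -> Q (inner k b).
  rewrite inE => /andP[/andP[_ /eqP lb] /eqP sb] /hasP[v vb /andP[va vm]].
  apply/existsP; have iv : (index v b < k.-1)%N.
    have : (index v b < size b)%N by rewrite index_mem.
    rewrite sb; have [//|h1 h2] := ltnP (index v b) k.-1.
    have iE : index v b = k.-1 by lia.
    by move: vm; rewrite -(nth_index ord0 vb) iE -lb -nth_last sb eqxx.
  exists (Ordinal iv); rewrite ffunE /= nth_index//.
  have : v \in ord0 :: (a : seq V) by rewrite inE va orbT.
  by rewrite /free /= negbK.
apply: (@le_trans _ _ (\sum_(f | Q f) G f)).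
  apply: (@le_trans _ _ (\sum_(b in paths k) (if Q (inner k b) then G (inner k b) else 0))).
    rewrite big_mkcondr /=; apply: ler_sum => b bk.
    case: ifP => [mb|_]; last by case: ifP.
    by rewrite meetQ// pathG.
  rewrite -(big_imset (fun f => if Q f then G f else 0) (inner_inj k1)) /=.
  rewrite big_mkcond [leRHS]big_mkcond /=; apply: ler_sum => f _.
  by case: ifP => // _; case: ifP.
(* The product [G] with position i forced to be occupied by a vertex of [a] or [ord0]; the sum over
   i dominates the restriction to [Q]. *)
pose H i (f : {ffun 'I_k.-1 -> V}) := \prod_j (if (j == i) && free a (f j) then 0 else w (f j)).
have H0 i f : 0 <= H i f by apply: prodr_ge0 => j _; case: ifP.
apply: (@le_trans _ _ (\sum_(f : {ffun 'I_k.-1 -> V}) \sum_i H i f)).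
  rewrite big_mkcond /=; apply: ler_sum => f _; case: ifP => [/existsP[i fi]|_].
    rewrite (bigD1 i)//= -[leLHS]addr0 lerD ?sumr_ge0//.
    rewrite /H /G le_eqVlt; apply/orP; left; apply/eqP; apply: eq_bigr => j _.
    by case: eqP => //= ->; rewrite (negbTE fi).
  by rewrite sumr_ge0.
rewrite exchange_big /=.
have cardfree : (#|[pred v | ~~ free a v]| <= k.+1)%N.
  apply: (@leq_trans #|ord0 :: (a : seq V)|).
    by apply: subset_leq_card; apply/fintype.subsetP => v; rewrite inE /free /= negbK.
  apply: leq_trans (card_size _) _ => /=.
  by move: ak; rewrite inE => /andP[_ /eqP ->].
have sumw : \sum_v w v <= k.+1%:R + m.+2%:R * rho.
  rewrite /w (bigID (free a)) /= addrC lerD//.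
    rewrite (eq_bigr (fun=> 1)); last by move=> v /negbTE ->.
    rewrite sumr_const ler_nat.
    exact: cardfree.
  rewrite (eq_bigr (fun=> rho)); last by move=> v ->.
  rewrite sumr_const -[leLHS]mulr_natl ler_wpM2r// ler_nat.
  by apply: leq_trans (max_card _) _; rewrite card_ord.
have sumi : \sum_v (if free a v then 0 else w v) <= k.+1%:R.
  rewrite (bigID (free a)) /= big1 ?add0r; last by move=> v ->.
  rewrite (eq_bigr (fun=> 1)); last by move=> v; rewrite /w => /negbTE ->.
  rewrite sumr_const ler_nat.
  exact: cardfree.
have Hi i : \sum_f H i f <= k.+1%:R * (k.+1%:R + m.+2%:R * rho) ^+ k.-2.
  rewrite /H -(bigA_distr_bigA (fun j v => if (j == i) && free a v then 0 else w v)) /=.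
  rewrite (bigD1 i)//= eqxx /=; apply: ler_pM => //.
  - by apply: sumr_ge0 => v _; case: ifP.
  - by apply: prodr_ge0 => j _; apply: sumr_ge0 => v _; case: ifP.
  rewrite (eq_bigr (fun=> \sum_v w v)); last by move=> j /negbTE ->.
  rewrite prodr_const (_ : #|_| = k.-2); last first.
    by have := cardC1 i; rewrite card_ord.
  by rewrite lerXn2r// ?nnegrE ?sumr_ge0// addr_ge0// mulr_ge0.
apply: (@le_trans _ _ (\sum_(i < k.-1) k.+1%:R * (k.+1%:R + m.+2%:R * rho) ^+ k.-2)).
  by apply: ler_sum => i _.
rewrite sumr_const card_ord -[leLHS]mulr_natl -mulrA ler_wpM2r ?ler_nat ?leq_pred//.
by rewrite mulr_ge0// exprn_ge0// addr_ge0// mulr_ge0.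
Qed.

End Paths.

(** * Poisson approximation *)

Section RealProbability.
Context d (T : measurableType d) (R : realType) (P : probability T R).
Implicit Types A B : set T.

Definition pr A : R := fine (P A).

Lemma pr_ge0 A : 0 <= pr A.
Proof. exact: fine_ge0. Qed.

Lemma prE A : measurable A -> P A = (pr A)%:E.
Proof. by move=> mA; rewrite /pr fineK// fin_num_measure. Qed.

Lemma pr_le1 A : measurable A -> pr A <= 1.
Proof. by move=> mA; rewrite -lee_fin -prE// probability_le1. Qed.

Lemma pr_le A B : measurable A -> measurable B -> A `<=` B -> pr A <= pr B.
Proof. by move=> mA mB AB; rewrite -lee_fin -!prE// le_measure ?inE. Qed.

Lemma prT : pr setT = 1.
Proof. by rewrite /pr probability_setT. Qed.

Lemma prU A B : measurable A -> measurable B -> pr (A `|` B) <= pr A + pr B.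
Proof.
move=> mA mB; rewrite -lee_fin EFinD -!prE//; last exact: measurableU.
exact: measureU2.
Qed.

Lemma prID A B : measurable A -> measurable B ->
  pr A = pr (A `&` B) + pr (A `&` ~` B).
Proof.
move=> mA mB; have mB' : measurable (~` B) by exact: measurableC.
apply: EFin_inj; rewrite EFinD -!prE//; [|exact: measurableI..].
rewrite -measureU//; [|exact: measurableI|exact: measurableI|].
  by rewrite -setIUr setUv setIT.
by rewrite setIACA setICr setI0.
Qed.

Lemma prC A : measurable A -> pr (~` A) = 1 - pr A.
Proof.
move=> mA; have := prID measurableT mA; rewrite prT !setTI => ->.
by rewrite addrAC subrr add0r.
Qed.

Lemma pr_bigU (I : eqType) (r : seq I) (Q : pred I) (A : I -> set T) :
  (forall i, measurable (A i)) ->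
  measurable (\big[setU/set0]_(i <- r | Q i) A i) /\
  pr (\big[setU/set0]_(i <- r | Q i) A i) <= \sum_(i <- r | Q i) pr (A i).
Proof.
move=> mA; elim: r => [|i r [mr IH]].
  by rewrite !big_nil /pr measure0.
rewrite !big_cons; case: ifP => // _; split; first exact: measurableU.
by apply: le_trans (prU _ _) _ => //; rewrite lerD2l.
Qed.

End RealProbability.

Section Void.
Context d (T : measurableType d) (R : realType) (P : probability T R).
Context (I : finType) (A : I -> set T) (dep : rel I).
Hypothesis mA : forall i, measurable (A i).

Fixpoint none (r : seq I) : set T :=
  if r is i :: r' then ~` A i `&` none r' else setT.

Lemma measurable_none r : measurable (none r).
Proof.
by elim: r => //= i r IH; apply: measurableI => //; exact: measurableC.
Qed.

Lemma noneP r x : none r x <-> forall i, i \in r -> ~ A i x.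
Proof.
elim: r => [|i r IH] /=; first by split.
split=> [[nA /IH h] j|h]; first by rewrite inE => /predU1P[->//|/h].
split; first by apply: h; rewrite mem_head.
by apply/IH => j jr; apply: h; rewrite inE jr orbT.
Qed.

Hypothesis indep : forall i (r : seq I), (forall j, j \in r -> ~~ dep i j) ->
  pr P (A i `&` none r) = pr P (A i) * pr P (none r).

Notation pr := (pr P).

(** After removal of the events that depend on [A i], independence is exact. Restoring them changes
    P (none) by at most the sum of their probabilities, and P (A i and none) by at most the sum of
    the joint ones. *)
Lemma pr_hit_none i r :
  `|pr (A i `&` none r) - pr (A i) * pr (none r)| <=
  \sum_(j <- r | dep i j) (pr (A i) * pr (A j) + pr (A i `&` A j)).
Proof.
pose r' := [seq j <- r | ~~ dep i j].
pose D := \big[setU/set0]_(j <- r | dep i j) A j.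
have [mD prD] := pr_bigU P r (dep i) mA.
have mn := measurable_none r; have mn' := measurable_none r'.
have sub1 : none r `<=` none r'.
  move=> x /noneP h; apply/noneP => j; rewrite mem_filter => /andP[_].
  exact: h.
have sub2 : none r' `<=` none r `|` D.
  move=> x /noneP h; have [Dx|nDx] := pselect (D x); [by right|left].
  apply/noneP => j jr Ax; have [dij|ndij] := boolP (dep i j).
    by apply: nDx; rewrite /D -bigcup_seq_cond; exists j => //=; rewrite jr dij.
  by apply: (h j) => //; rewrite mem_filter ndij.
have ind : pr (A i `&` none r') = pr (A i) * pr (none r').
  by apply: indep => j; rewrite mem_filter => /andP[].
have up : pr (A i `&` none r) <= pr (A i) * (pr (none r) + \sum_(j <- r | dep i j) pr (A j)).
  apply: (@le_trans _ _ (pr (A i `&` none r'))).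
    by apply: pr_le; [exact: measurableI|exact: measurableI|exact: setIS].
  rewrite ind ler_wpM2l ?pr_ge0//.
  apply: (@le_trans _ _ (pr (none r `|` D))).
    by apply: pr_le => //; exact: measurableU.
  by apply: le_trans (prU _ _ _) _ => //; rewrite lerD2l.
have mAj j : measurable (A i `&` A j) by exact: measurableI.
have [mD2 prD2] := pr_bigU P r (dep i) mAj.
have lo : pr (A i) * pr (none r) <= pr (A i `&` none r) + \sum_(j <- r | dep i j) pr (A i `&` A j).
  apply: (@le_trans _ _ (pr (A i `&` none r'))).
    by rewrite ind ler_wpM2l ?pr_ge0// pr_le.
  have mAn : measurable (A i `&` none r) by exact: measurableI.
  apply: (@le_trans _ _ (pr ((A i `&` none r) `|` \big[setU/set0]_(j <- r | dep i j) (A i `&` A j)))).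
    apply: pr_le; [exact: measurableI|exact: measurableU|].
    move=> x [Ax /sub2[nx|]]; first by left.
    rewrite /D -bigcup_seq_cond => -[j /= jr Ajx]; right.
    by rewrite -bigcup_seq_cond; exists j.
  by apply: le_trans (prU _ _ _) _ => //; rewrite lerD2l.
have S1 : 0 <= \sum_(j <- r | dep i j) pr (A j) by apply: sumr_ge0 => j _; exact: pr_ge0.
have S2 : 0 <= \sum_(j <- r | dep i j) pr (A i `&` A j) by apply: sumr_ge0 => j _; exact: pr_ge0.
rewrite big_split/= -mulr_sumr.
have pi0 : 0 <= pr (A i) by exact: pr_ge0.
have := mulr_ge0 pi0 S1.
rewrite ler_norml; move: up lo; rewrite mulrDr; lra.
Qed.

Lemma expRN_approx (q : R) : 0 <= q -> `|expR (- q) - (1 - q)| <= q ^+ 2.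
Proof.
move=> q0; have h1 := expR_ge1Dx (- q); have h2 := expR_ge1Dx q.
have q1 : 0 < 1 + q by lra.
have h3 : expR (- q) <= 1 - q + q ^+ 2.
  rewrite expRN -[leLHS]div1r ler_pdivrMr ?expR_gt0//.
  apply: le_trans (ler_wpM2l _ h2); last by nra.
  by rewrite (_ : _ * _ = 1 + q ^+ 3); [rewrite lerDl exprn_ge0|ring].
by rewrite ler_norml; nra.
Qed.

(* Adding one event multiplies the probability of [none] by 1 - q, up to [err]. *)
Lemma pr_none_poisson (q : R) (err : I -> R) (S : {set I}) : 0 <= q ->
  (forall i, i \in S -> `|pr (A i) - q| + q ^+ 2 +
    \sum_(j in S | (j != i) && dep i j) (pr (A i) * pr (A j) + pr (A i `&` A j))
    <= err i) ->
  `|pr (none (enum S)) - expR (- (#|S|%:R * q))| <= \sum_(i in S) err i.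
Proof.
move=> q0 herr; rewrite cardE -big_enum /=.
have : {subset enum S <= S} by move=> i; rewrite mem_enum.
elim: (enum S) (enum_uniq S) => [|i r IH] /=.
  by move=> _ _; rewrite big_nil mul0r oppr0 expR0 prT subrr normr0.
move=> /andP[ir Ur] sub; rewrite big_cons.
have iS : i \in S by rewrite sub// mem_head.
have subS : {subset r <= S} by move=> j jr; rewrite sub// inE jr orbT.
have {}IH := IH Ur subS.
have mn := measurable_none r.
have E1 : pr (~` A i `&` none r) = pr (none r) - pr (A i `&` none r).
  rewrite [A i `&` _]setIC [~` A i `&` _]setIC.
  by have -> := prID P mn (mA i); rewrite addrAC subrr add0r.
have hit := pr_hit_none i r.
have sumle : \sum_(j <- r | dep i j) (pr (A i) * pr (A j) + pr (A i `&` A j)) <=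
  \sum_(j in S | (j != i) && dep i j) (pr (A i) * pr (A j) + pr (A i `&` A j)).
  rewrite -big_filter (big_uniq _ (filter_uniq _ Ur)) /= big_mkcond.
  rewrite [leRHS]big_mkcond /=; apply: ler_sum => j _; rewrite mem_filter.
  case: ifP => [/andP[dj jr]|_]; last first.
    by case: ifP => // _; rewrite addr_ge0 ?mulr_ge0 ?pr_ge0.
  rewrite subS// dj andbT/= ifT//.
  by apply: contraNneq ir => <-.
rewrite E1.
have -> : (size r).+1%:R * q = q + (size r)%:R * q by rewrite -natr1; ring.
rewrite opprD expRD.
have n0 := pr_ge0 P (none r); have n1 := pr_le1 P mn.
have a1 := expRN_approx q0.
have e0 := expR_gt0 (- q).
have e1 : expR (- q) <= 1 by rewrite -expR0 ler_expR oppr_le0.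
set Y := expR (- ((size r)%:R * q)) in IH *.
(* Four errors: dependence, the deviation of P (A i) from q, the deviation of e^(-q) from 1 - q, and
   the error inherited from [r]. The last one is damped by e^(-q) <= 1, so the errors merely add
   up. *)
rewrite (_ : _ - _ = (pr (A i) * pr (none r) - pr (A i `&` none r)) +
  (q - pr (A i)) * pr (none r) - (expR (- q) - (1 - q)) * pr (none r) +
  expR (- q) * (pr (none r) - Y)); last by ring.
have B1 : `|(q - pr (A i)) * pr (none r)| <= `|pr (A i) - q|.
  by rewrite normrM distrC ler_piMr// ger0_norm.
have B2 : `|(expR (- q) - (1 - q)) * pr (none r)| <= q ^+ 2.
  by rewrite normrM (ger0_norm n0); apply: le_trans a1; rewrite ler_piMr.
have B3 : `|expR (- q) * (pr (none r) - Y)| <= \sum_(j <- r) err j.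
  by rewrite normrM (gtr0_norm e0); apply: le_trans IH; rewrite ler_piMl.
rewrite distrC in hit.
have := herr i iS.
have := ler_normD ((pr (A i) * pr (none r) - pr (A i `&` none r)) +
  (q - pr (A i)) * pr (none r) - (expR (- q) - (1 - q)) * pr (none r))
  (expR (- q) * (pr (none r) - Y)).
have := ler_normB ((pr (A i) * pr (none r) - pr (A i `&` none r)) +
  (q - pr (A i)) * pr (none r)) ((expR (- q) - (1 - q)) * pr (none r)).
have := ler_normD (pr (A i) * pr (none r) - pr (A i `&` none r))
  ((q - pr (A i)) * pr (none r)).
lra.
Qed.

End Void.

(** * Light paths in a fixed graph *)

Section OptimalPathFacts.
Context (R : realType) (m : nat).
Notation V := 'I_m.+2.
Implicit Types (c : {set V} -> R) (q : m.+1.-bseq V).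

Lemma direct_is_path : is_path ([bseq ord_max] : m.+1.-bseq V).
Proof. by rewrite /is_path /= ?inE ?eqxx. Qed.

Lemma optimal_path_min c : is_path (optimal_path c) /\
  forall q, is_path q -> path_weight c (optimal_path c) <= path_weight c q.
Proof.
rewrite /optimal_path /Order.arg_min; case: extremumP => [x|y x z|x y||q Pq h].
- exact: lexx.
- exact: le_trans.
- exact: le_total.
- exact: direct_is_path.
- by split.
Qed.

Lemma optimal_weight_gt c w :
  (w < optimal_weight c) = [forall q, is_path q ==> (w < path_weight c q)].
Proof.
have [P0 min0] := optimal_path_min c.
apply/idP/forallP => [h q|/(_ (optimal_path c))]; last by rewrite P0.
by apply/implyP => Pq; exact: lt_le_trans h (min0 q Pq).
Qed.

(** The choice of a minimal path consults only comparisons of weights, in case of ties too; this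
    makes the hopcount measurable. *)
Lemma optimal_path_congr c c' :
  (forall q q', (path_weight c q <= path_weight c q') =
                (path_weight c' q <= path_weight c' q')) ->
  optimal_path c = optimal_path c'.
Proof.
move=> h; rewrite /optimal_path /Order.arg_min /extremum; congr (odflt _ _).
apply: eq_pick => q /=; congr (_ && _).
by apply: eq_forallb => q'; rewrite h.
Qed.

End OptimalPathFacts.

Section FixedGraph.
Context (R : realType) (s : R) (s0 : 0 < s) (m : nat).
Context d (T : measurableType d) (P : probability T R).
Notation V := 'I_m.+2.
Context (E : {set V} -> {RV P >-> R}).
Hypothesis iid : iid_exponential (complete_edges m) E.
Implicit Types (q a b : m.+1.-bseq V) (w l : R) (J : {set {set V}}).
Notation Pr := (pr P).

Definition eset q : {set {set V}} := [set e in path_edges q]%SET.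

Lemma eset_complete q : is_path q -> eset q \subset complete_edges m.
Proof.
by move=> Pq; apply/fintype.subsetP => e; rewrite inE; exact: path_edges_complete.
Qed.

Definition light w q : set T :=
  [set x | path_weight (edge_weight s E x) q <= w].

Definition high l J : set T := \bigcap_(e in [set` J]) E e @^-1` `[l, +oo[.

Lemma lightE w q :
  light w q = [set x | \sum_(e <- path_edges q) (E e x) `^ (- s) <= w].
Proof. by apply/seteqP; split=> x; rewrite /light /= path_weightE. Qed.

Lemma light_cylinders w q : <<s cylinders E (eset q) >> (light w q).
Proof.
rewrite lightE; apply: (@sum_powR_le_cylinders R s d T P _ E).
by move=> e; rewrite inE.
Qed.

Lemma high_cylinders l J : <<s cylinders E J >> (high l J).
Proof.
by apply: sub_sigma_algebra; exists (fun=> `[l, +oo[%classic).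
Qed.

Lemma measurable_light w q : measurable (light w q).
Proof.
apply: (@sub_sigma_cylinders _ _ _ P _ E (eset q)); exact: light_cylinders.
Qed.

Lemma measurable_high l J : measurable (high l J).
Proof.
apply: (@sub_sigma_cylinders _ _ _ P _ E J); exact: high_cylinders.
Qed.

Lemma pr_light j w q : q \in paths m j -> Pr (light w q) = sum_cdf s j w.
Proof.
rewrite inE => /andP[Pq /eqP sq]; rewrite /pr lightE.
rewrite (prob_sum_powR s iid w (path_edges_uniq Pq) (path_edges_complete Pq)).
by rewrite size_path_edges sq.
Qed.

Lemma pr_high l J : 0 <= l -> J \subset complete_edges m ->
  Pr (high l J) = expR (- l) ^+ #|J|.
Proof.
move=> l0 JD; have [ind law] := iid; rewrite /pr /high ind//.
rewrite (eq_bigr (fun=> (expR (- l))%:E)).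
  by rewrite prodEFin/= prodr_const.
move=> e eJ; have := law e (fintype.subsetP JD e eJ) `[l, +oo[%classic (measurable_itv _).
by rewrite /distribution /pushforward => ->; exact: exp1_ge.
Qed.

(** The recursion of [sum_cdf] for k edges, with the first exponential confined below l. *)
Definition low_cdf k w l : R :=
  fine (\int[exp1 R]_(u in `]-oo, l[) (sum_cdf s k.-1 (w - u `^ (- s)))%:E).

(** The weight is a symmetric sum, so any edge can be moved to the front. *)
Lemma pr_light_low k w l q (e : {set V}) : q \in paths m k -> e \in path_edges q ->
  Pr (light w q `&` E e @^-1` `]-oo, l[) = low_cdf k w l.
Proof.
rewrite inE => /andP[Pq /eqP sq] eq.
have Pe := perm_to_rem eq.
have Ue : uniq (e :: rem e (path_edges q)).
  by rewrite -(perm_uniq Pe) path_edges_uniq.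
have sube : {subset e :: rem e (path_edges q) <= complete_edges m}.
  by move=> f; rewrite -(perm_mem Pe); exact: path_edges_complete.
have := prob_first_edge s iid w Ue sube (measurable_itv `]-oo, l[).
rewrite size_rem// size_path_edges sq /low_cdf => <-.
rewrite /pr setIC lightE; congr (fine (P (_ `&` _))).
by apply/seteqP; split=> x /=; rewrite (perm_big _ Pe).
Qed.

(** Empty off [paths m k], so that the events are indexed by the whole finite type and the
    independence hypothesis of the Poisson approximation holds for every index. *)
Definition regular k w l q : set T :=
  if q \in paths m k then light w q `&` high l (eset q) else set0.

Lemma measurable_regular k w l q : measurable (regular k w l q).
Proof.
rewrite /regular; case: ifP => // _; apply: measurableI.
  exact: measurable_light.
exact: measurable_high.
Qed.

Lemma regular_cylinders k w l q J : (q \in paths m k -> eset q \subset J) ->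
  <<s cylinders E J >> (regular k w l q).
Proof.
rewrite /regular; case: ifP => [_ /(_ isT) qJ|_ _]; last exact: sigma_algebra0.
apply: (sub_cylinders qJ); apply: (@measurableI _ (g_sigma_algebraType _)).
  exact: light_cylinders.
exact: high_cylinders.
Qed.

Lemma pr_light_regular k w l q : q \in paths m k ->
  measurable (light w q `&` ~` regular k w l q) /\
  Pr (light w q `&` ~` regular k w l q) <= k%:R * low_cdf k w l.
Proof.
move=> qk; have mr := measurable_regular k w l q.
have mD : measurable (light w q `&` ~` regular k w l q).
  by apply: measurableI; [exact: measurable_light|exact: measurableC].
split => //.
pose U e := light w q `&` E e @^-1` `]-oo, l[.
have mU e : measurable (U e).
  apply: measurableI; first exact: measurable_light.
  by rewrite -[X in measurable X]setTI; exact: measurable_funPT.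
have [mbU prU] := pr_bigU P (path_edges q) xpredT mU.
apply: (@le_trans _ _ (Pr (\big[setU/set0]_(e <- path_edges q) U e))).
  apply: pr_le => //; rewrite /regular qk => x [lx nr].
  rewrite -bigcup_seq; have : ~ high l (eset q) x by move=> h; apply: nr.
  move=> /existsNP[e /not_implyP[/= + nel]]; rewrite inE => eq.
  exists e => //; split => //=; rewrite in_itv/=.
  by move: nel; rewrite in_itv/= andbT => /negP; rewrite -ltNge.
apply: (le_trans prU); rewrite big_seq.
rewrite (eq_bigr (fun=> low_cdf k w l)); last by move=> e eq; exact: pr_light_low.
rewrite -big_seq big_const_seq count_predT size_path_edges iter_addr_0 -[leLHS]mulr_natl.
by move: qk; rewrite inE => /andP[_ /eqP ->].
Qed.

Lemma low_cdf_ge0 k w l : 0 <= low_cdf k w l.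
Proof. by apply: fine_ge0; apply: integral_ge0 => u _; rewrite lee_fin sum_cdf_ge0. Qed.

Lemma pr_regular k w l q : q \in paths m k ->
  sum_cdf s k w - k%:R * low_cdf k w l <= Pr (regular k w l q) <= sum_cdf s k w.
Proof.
move=> qk; rewrite -(pr_light w qk).
have mr := measurable_regular k w l q; have ml := measurable_light w q.
have [mD prD] := pr_light_regular w l qk.
have sub : regular k w l q `<=` light w q by rewrite /regular qk => x [].
have := prID P ml mr; rewrite (setIidr sub) => ->.
by apply/andP; split; [lra|rewrite lerDl pr_ge0].
Qed.

(** Paths that do not meet [q] have all their edges outside [eset q], so the second event lies in
    the sigma-algebra of the complementary edges. *)
Lemma regular_indep k w l q (r : seq (m.+1.-bseq V)) : (2 <= k)%N ->
  (forall j, j \in r -> ~~ meet q j) ->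
  Pr (regular k w l q `&` none (regular k w l) r) =
  Pr (regular k w l q) * Pr (none (regular k w l) r).
Proof.
move=> k2 nm; have [qk|nqk] := boolP (q \in paths m k); last first.
  by rewrite /regular (negbTE nqk) set0I /pr measure0 mul0r.
pose J := (complete_edges m :\: eset q)%SET.
have noneJ : <<s cylinders E J >> (none (regular k w l) r).
  elim: r nm => [|j r IH] nm /=.
    exact: (@measurableT _ (g_sigma_algebraType (cylinders E J))).
  apply: (@measurableI _ (g_sigma_algebraType (cylinders E J))); last first.
    by apply: IH => i ir; rewrite nm// inE ir orbT.
  apply: sigma_algebraC; apply: regular_cylinders => jk.
  apply/fintype.subsetP => e; rewrite inE => ej.
  have nqj := nm j (mem_head _ _); rewrite meet_sym in nqj.
  rewrite !inE (not_meet_disjoint k2 jk qk nqj ej)/=.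
  move: jk; rewrite inE => /andP[Pj _].
  by have := path_edges_complete Pj ej; rewrite inE.
have Pq : is_path q by move: qk; rewrite inE => /andP[].
apply: EFin_inj; rewrite EFinM.
have mr := measurable_regular k w l q.
have mn : measurable (none (regular k w l) r).
  by apply: measurable_none => i; exact: measurable_regular.
rewrite -!prE//; last exact: measurableI.
apply: (sigma_indep (proj1 iid) (J1 := eset q) (J2 := J)) => //.
- exact: eset_complete.
- exact: subsetDl.
- by rewrite disjoint_subset; apply/fintype.subsetP => e; rewrite !inE => ->.
- by apply: regular_cylinders.
Qed.

(* The exponentials of the new edges of [b] exceed [l], independently of [a]. *)
Lemma pr_regular2 k w l a b : (2 <= k)%N -> 0 <= l ->
  a \in paths m k -> b \in paths m k -> a != b ->
  Pr (regular k w l a `&` regular k w l b) <= sum_cdf s k w *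
    expR (- l) ^+ (count (predC (mem (ord0 :: (a : seq V)))) b).+1.
Proof.
move=> k2 l0 ak bk ab.
have [Pa sa] : is_path a /\ size a = k.
  by move: ak; rewrite inE => /andP[? /eqP].
have [Pb sb] : is_path b /\ size b = k.
  by move: bk; rewrite inE => /andP[? /eqP].
pose J := (eset b :\: eset a)%SET.
have JD : J \subset complete_edges m.
  by apply: fintype.subset_trans (eset_complete Pb); exact: subsetDl.
have cJ : (count (predC (mem (ord0 :: (a : seq V)))) b < #|J|)%N.
  have [/andP[Ua /eqP la] /andP[Ub /eqP lb]] := (Pa, Pb).
  have ab' : (a : seq V) != b by apply: contra ab => /eqP h; apply/eqP/val_inj.
  have sab : size a = size b by rewrite sa sb.
  apply: leq_trans (new_edges_ge Ua Ub sab _ ab') _; first by rewrite la lb.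
  rewrite -size_filter -(card_uniqP _); last first.
    by rewrite filter_uniq// path_edges_uniq.
  apply: subset_leq_card; apply/fintype.subsetP => e.
  by rewrite mem_filter !inE.
have mra := measurable_regular k w l a; have mrb := measurable_regular k w l b.
have mh := measurable_high l J.
apply: (@le_trans _ _ (Pr (regular k w l a `&` high l J))).
  apply: pr_le; [exact: measurableI|exact: measurableI|].
  rewrite {2}/regular bk => x [ra [_ hb]]; split => // e /= eJ; apply: hb => /=.
  by move: eJ; rewrite !inE => /andP[].
have -> : Pr (regular k w l a `&` high l J) = Pr (regular k w l a) * Pr (high l J).
  apply: EFin_inj; rewrite EFinM -!prE//; last exact: measurableI.
  apply: (sigma_indep (proj1 iid) (J1 := eset a) (J2 := J)) => //.
  - exact: eset_complete.
  - by rewrite disjoint_subset; apply/fintype.subsetP => e; rewrite !inE => ->.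
  - exact: regular_cylinders.
  - exact: high_cylinders.
rewrite pr_high//; have /andP[_ up] := pr_regular w l ak.
apply: ler_pM => //; rewrite ?pr_ge0 ?exprn_ge0 ?expR_ge0//.
by apply: ler_wiXn2l => //; rewrite ?expR_ge0// -expR0 ler_expR oppr_le0.
Qed.

(* Of N paths in a graph with n vertices, each is light with probability F; [low]
   is the probability that moreover a given edge of it is below the cutoff, and
   [rho] the probability that an edge is above it. *)
Definition poisson_error (k : nat) (N n F low rho : R) : R :=
  N * (k%:R * low + F ^+ 2 +
    (F ^+ 2 * (k%:R * k.+1%:R * (k.+1%:R + n) ^+ k.-2) +
     F * rho * (k%:R * k.+1%:R * (k.+1%:R + n * rho) ^+ k.-2))).

(** For a fixed path a, [sum_meet_le] is used twice: with weight 1 for the products of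
    probabilities, each at most F^2, and with weight rho for the joint probabilities from
    [pr_regular2]. *)
Lemma none_regular_poisson k w l : (2 <= k)%N -> 0 <= l ->
  `|Pr (none (regular k w l) (enum (paths m k))) -
    expR (- (#|paths m k|%:R * sum_cdf s k w))| <=
  poisson_error k #|paths m k|%:R m.+2%:R (sum_cdf s k w) (low_cdf k w l) (expR (- l)).
Proof.
move=> k2 l0; rewrite /poisson_error.
set N : R := #|paths m k|%:R; set F := sum_cdf s k w; set n : R := m.+2%:R.
set rho := expR (- l).
have F0 : 0 <= F by exact: sum_cdf_ge0.
have rho0 : 0 <= rho by exact: expR_ge0.
set err := (X in _ <= N * X).
have := @pr_none_poisson _ _ _ P _ (regular k w l) (@meet m)
  (measurable_regular k w l) (fun q r => @regular_indep k w l q r k2) F (fun=> err)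
  (paths m k) F0.
rewrite sumr_const -[X in _ <= X]mulr_natl; apply=> a ak.
have /andP[ra1 ra2] := pr_regular w l ak.
have low0 := low_cdf_ge0 k w l.
have S1 := sum_meet_le (@ler01 R) k2 ak; have S2 := sum_meet_le rho0 k2 ak.
rewrite mulr1 in S1.
rewrite /err; apply: lerD; first apply: lerD => //.
  by rewrite ler_norml; move: ra1 ra2; rewrite -/F; lra.
pose cnt (b : m.+1.-bseq V) := count (predC (mem (ord0 :: (a : seq V)))) b.
apply: (@le_trans _ _ (\sum_(b in paths m k | meet a b)
    (F ^+ 2 * 1 ^+ cnt b + F * rho * rho ^+ cnt b))).
  rewrite big_mkcond [leRHS]big_mkcond /=; apply: ler_sum => b _.
  case: ifP => [/and3P[bk ba mab]|_]; last first.
    by case: ifP => // _; rewrite addr_ge0// !mulr_ge0 ?sqr_ge0 ?exprn_ge0.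
  rewrite bk mab /=; have /andP[_ rb2] := pr_regular w l bk.
  apply: lerD.
    by rewrite expr1n mulr1 expr2 ler_pM ?pr_ge0.
  rewrite -mulrA -exprS; apply: pr_regular2 => //.
  by rewrite eq_sym.
rewrite big_split /= -!mulr_sumr; apply: lerD.
  by rewrite ler_wpM2l ?sqr_ge0.
by rewrite ler_wpM2l// mulr_ge0.
Qed.

(** The index j stands for j + 1 edges, and n^j bounds the number of such paths, so this dominates
    the expected number of light paths of other lengths. *)
Definition other_mean (k : nat) (w : R) : R :=
  \sum_(j < m.+1 | j.+1 != k) m.+2%:R ^+ j * sum_cdf s j.+1 w.

Definition other_light k w : set T :=
  \big[setU/set0]_(q : m.+1.-bseq V | is_path q && (size q != k)) light w q.

Lemma pr_other_light k w :
  measurable (other_light k w) /\ Pr (other_light k w) <= other_mean k w.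
Proof.
have [mU prU] := pr_bigU P (index_enum (m.+1.-bseq V : finType))
  (fun q => is_path q && (size q != k)) (measurable_light w).
split => //; apply: (le_trans prU).
rewrite (eq_bigr (fun q : m.+1.-bseq V => sum_cdf s (size q) w)); last first.
  by move=> q /andP[Pq _]; apply: pr_light; rewrite inE Pq eqxx.
(* Lengths lie between 1 and m + 1, so [inord] does not truncate. *)
rewrite (partition_big (fun q : m.+1.-bseq V => (inord (size q).-1 : 'I_m.+1))
  (fun j => j.+1 != k)) /=; last first.
  move=> q /andP[Pq sk]; have /paths_gt0 : q \in paths m (size q) by rewrite inE Pq eqxx.
  by move=> /andP[q1 q2]; rewrite inordK prednK.
apply: ler_sum => j jk.
apply: (@le_trans _ _ (\sum_(q in paths m j.+1) sum_cdf s j.+1 w)).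
  rewrite big_mkcond [leRHS]big_mkcond; apply: ler_sum => q _.
  case: ifP => [/andP[/andP[Pq sk] /eqP qj]|_]; last first.
    by case: ifP => // _; exact: sum_cdf_ge0.
  have /paths_gt0 /andP[q1 q2] : q \in paths m (size q) by rewrite inE Pq eqxx.
  have sq : size q = j.+1.
    by rewrite -qj inordK prednK.
  by rewrite inE Pq sq eqxx.
rewrite sumr_const -[leLHS]mulr_natl ler_wpM2r ?sum_cdf_ge0//.
by rewrite -natrX ler_nat card_paths_le.
Qed.

Definition heavier w : set T := [set x | w < optimal_weight (edge_weight s E x)].

Lemma heavier_complement w :
  heavier w = ~` \big[setU/set0]_(q : m.+1.-bseq V | is_path q) light w q.
Proof.
apply/seteqP; split=> x; rewrite /heavier /=.
  rewrite optimal_weight_gt => /forallP h; rewrite -bigcup_seq_cond => -[q /= /andP[_ Pq]].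
  by rewrite /light /= leNgt; have := h q; rewrite Pq /= => ->.
move=> h; rewrite optimal_weight_gt; apply/forallP => q; apply/implyP => Pq.
rewrite ltNge; apply/negP => lq; apply: h; rewrite -bigcup_seq_cond.
by exists q => //=; rewrite mem_index_enum Pq.
Qed.

Lemma measurable_heavier w : measurable (heavier w).
Proof.
rewrite heavier_complement; apply: measurableC.
have [] := pr_bigU P (index_enum (m.+1.-bseq V : finType)) (fun q => is_path q)
  (measurable_light w); by [].
Qed.

(** If no regular path exists and yet some path is light, then that path either has k edges and an
    exponential below the cutoff, or has another length. *)
Lemma pr_heavier k w l : (2 <= k)%N ->
  let none_k := none (regular k w l) (enum (paths m k)) in
  Pr (heavier w) <= Pr none_k /\
  Pr none_k <= Pr (heavier w) + #|paths m k|%:R * (k%:R * low_cdf k w l) + other_mean k w.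
Proof.
move=> k2 none_k.
have mn : measurable none_k by apply: measurable_none => i; exact: measurable_regular.
have mh := measurable_heavier w.
have [msh prsh] := pr_other_light k w.
pose D q := light w q `&` ~` regular k w l q.
have mD q : measurable (D q).
  by apply: measurableI; [exact: measurable_light|
    apply: measurableC; exact: measurable_regular].
have [mB prB] := pr_bigU P (enum (paths m k)) xpredT mD.
split.
  apply: pr_le => // x; rewrite /heavier /= optimal_weight_gt => /forallP h.
  apply/noneP => q; rewrite mem_enum => qk; rewrite /regular qk => -[lq _].
  have := h q; have -> /= : is_path q by move: qk; rewrite inE => /andP[].
  by rewrite ltNge => /negP; apply.
apply: (@le_trans _ _ (Pr ((heavier w `|` \big[setU/set0]_(q <- enum (paths m k)) D q)
   `|` other_light k w))).
  apply: pr_le => //; first by do 2 apply: measurableU => //.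
  move=> x /noneP nx; have [hx|nhx] := pselect (heavier w x); first by left; left.
  have : (~` heavier w) x by [].
  rewrite heavier_complement setCK -bigcup_seq_cond => -[q /= /andP[_ Pq] lq].
  have [sk|sk] := eqVneq (size q) k.
    left; right; rewrite -bigcup_seq; exists q => /=.
      by rewrite mem_enum inE Pq sk eqxx.
    by split => //; apply: nx; rewrite mem_enum inE Pq sk eqxx.
  by right; rewrite /other_light -bigcup_seq_cond; exists q => //=;
    rewrite mem_index_enum Pq sk.
apply: (le_trans (prU _ _ _)) => //; first exact: measurableU.
apply: lerD => //; apply: (le_trans (prU _ _ _)) => //; apply: lerD => //.
apply: (le_trans prB); rewrite big_enum /=.
apply: (@le_trans _ _ (\sum_(q in paths m k) k%:R * low_cdf k w l)).
  by apply: ler_sum => q qk; have [] := pr_light_regular w l qk.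
by rewrite sumr_const -[leLHS]mulr_natl.
Qed.

Lemma measurable_path_weight q :
  measurable_fun setT (fun x => path_weight (edge_weight s E x) q).
Proof.
rewrite (_ : (fun _ => _) = (fun x => \sum_(e <- path_edges q) (E e x) `^ (- s))).
  apply: measurable_sum => e; apply: (measurableT_comp (measurable_powR (- s))).
  exact: measurable_funPT.
by apply/funext => x; rewrite path_weightE.
Qed.

Definition comparisons x : {ffun (m.+1.-bseq V) * (m.+1.-bseq V) -> bool} :=
  [ffun qq => path_weight (edge_weight s E x) qq.1 <=
              path_weight (edge_weight s E x) qq.2].

(** The hopcount is constant on each of the finitely many patterns of comparisons, so the event is a
    finite union of pattern events. *)
Lemma measurable_hopcount k :
  measurable [set x | hopcount (edge_weight s E x) = k].
Proof.
have mcmp c : measurable [set x | comparisons x = c].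
  rewrite (_ : [set x | _] = \bigcap_(qq in [set: (m.+1.-bseq V) * (m.+1.-bseq V)])
     [set x | comparisons x qq = c qq]); last first.
    apply/seteqP; split=> x /=; first by move=> <-.
    by move=> h; apply/ffunP => qq; exact: h.
  apply: fin_bigcap_measurable => [|qq _]; first exact: finite_finset.
  have ml : measurable [set x | path_weight (edge_weight s E x) qq.1 <=
              path_weight (edge_weight s E x) qq.2].
    have := measurable_funB (measurable_path_weight qq.1) (measurable_path_weight qq.2).
    move=> /(_ measurableT `]-oo, 0]%classic (measurable_itv _)); rewrite setTI.
    rewrite (_ : _ @^-1` _ = [set x | path_weight (edge_weight s E x) qq.1 <=
              path_weight (edge_weight s E x) qq.2])//.
    by apply/seteqP; split=> x /=; rewrite in_itv/= subr_le0.
  case: (c qq).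
    rewrite (_ : [set x | _] = [set x | path_weight (edge_weight s E x) qq.1 <=
              path_weight (edge_weight s E x) qq.2])//.
    by apply/seteqP; split=> x /=; rewrite ffunE.
  rewrite (_ : [set x | _] = ~` [set x | path_weight (edge_weight s E x) qq.1 <=
              path_weight (edge_weight s E x) qq.2]); first exact: measurableC.
  by apply/seteqP; split=> x /=; rewrite ffunE; [move=> ->|move=> /negP/negbTE].
rewrite (_ : [set x | _] = \bigcup_(c in [set c | exists2 x,
    hopcount (edge_weight s E x) = k & comparisons x = c]) [set x | comparisons x = c]).
  by apply: fin_bigcup_measurable => [|c _]; [exact: finite_finset|exact: mcmp].
apply/seteqP; split=> x /=; first by move=> hk; exists (comparisons x) => //; exists x.
move=> [c [x' <- <-]] /= E1; rewrite /hopcount; congr size.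
congr (bseqval _); apply: optimal_path_congr => q q'.
by have := congr1 (fun f : {ffun _ -> bool} => f (q, q')) E1; rewrite !ffunE.
Qed.

(** If the optimal path is light with a length other than k, it is itself a witness for
    [other_light]. *)
Lemma pr_hopcount k w : 1 - Pr (heavier w) - other_mean k w <=
  Pr [set x | hopcount (edge_weight s E x) = k].
Proof.
have mk := measurable_hopcount k; have mh := measurable_heavier w.
have [msh prsh] := pr_other_light k w.
have : Pr (~` [set x | hopcount (edge_weight s E x) = k]) <=
    Pr (heavier w) + Pr (other_light k w).
  apply: le_trans (prU _ mh msh); apply: pr_le.
  - exact: measurableC.
  - exact: measurableU.
  move=> x /= hk; have [hx|nhx] := pselect (heavier w x); first by left.
  right; rewrite /other_light -bigcup_seq_cond.
  have [P0 _] := optimal_path_min (edge_weight s E x).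
  exists (optimal_path (edge_weight s E x)) => /=.
    by rewrite mem_index_enum P0; apply/eqP.
  by move: nhx => /negP; rewrite -leNgt.
by rewrite prC//; lra.
Qed.

End FixedGraph.

(** * Asymptotics *)

Section Limits.
Context (R : realType).
Implicit Types u v : nat -> R.

Lemma eq_cvgn u v (l : R) : u =1 v -> u @ \oo --> l -> v @ \oo --> l.
Proof. by move=> /funext ->. Qed.

Lemma norm_squeeze0 u v : (\forall m \near \oo, `|u m| <= v m) ->
  v @ \oo --> (0 : R) -> u @ \oo --> (0 : R).
Proof.
move=> uv v0; apply: (@squeeze_cvgr _ _ _ _ (fun m => - v m) v).
- by apply: filterS uv => m; rewrite ler_norml.
- by rewrite -oppr0; exact: cvgN.
- exact: v0.
Qed.

Lemma cvgy_sqrt u : u @ \oo --> +oo -> (fun m => Num.sqrt (u m)) @ \oo --> +oo.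
Proof.
move=> /cvgryPge uy; apply/cvgryPge => A.
apply: filterS (uy (A ^+ 2)) => m h.
have [A0|A0] := leP A 0; first exact: le_trans A0 (sqrtr_ge0 _).
by rewrite -(ger0_norm (ltW A0)) -sqrtr_sqr ler_sqrt// (le_trans (sqr_ge0 _) h).
Qed.

Lemma cvgy_inv u : u @ \oo --> +oo -> (fun m => (u m)^-1) @ \oo --> (0 : R).
Proof.
move=> uy; apply/gtr0_cvgV0 => //.
by move/cvgryPgt : uy; exact.
Qed.

Lemma cvgy_scale (c : R) u : 0 < c -> u @ \oo --> +oo ->
  (fun m => c * u m) @ \oo --> +oo.
Proof.
move=> c0 /cvgryPge uy; apply/cvgryPge => A.
by apply: filterS (uy (A / c)) => m; rewrite ler_pdivrMr// mulrC.
Qed.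

Lemma cvgy_expRN u : u @ \oo --> +oo -> (fun m => expR (- u m)) @ \oo --> (0 : R).
Proof.
move=> uy; apply: (@norm_squeeze0 _ (fun m => (u m)^-1)); last exact: cvgy_inv.
move/cvgryPgt : uy => /(_ 0); apply: filterS => m u0.
rewrite gtr0_norm ?expR_gt0// expRN lef_pV2 ?posrE ?expR_gt0//.
by apply: le_trans (expR_ge1Dx _); rewrite lerDr.
Qed.

Definition ln_size (m : nat) : R := ln m.+2%:R.

Lemma ln_size_gt0 m : 0 < ln_size m.
Proof. by rewrite ln_gt0// ltr1n. Qed.

Lemma expR_ln_size m : expR (ln_size m) = m.+2%:R.
Proof. by rewrite lnK// posrE ltr0n. Qed.

Lemma ln_size_cvgy : ln_size @ \oo --> +oo.
Proof.
apply/cvgryPge => A; near=> m.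
rewrite -ler_expR expR_ln_size; apply: (@le_trans _ _ m%:R); last by rewrite ler_nat; lia.
by near: m; exact: nbhs_infty_ger.
Unshelve. all: by end_near. Qed.

(** With L = r^4 the quotient is 4 ln r / r^2 <= 4/r. *)
Lemma ln_div_sqrt_ln_size :
  (fun m => ln (ln_size m) / Num.sqrt (ln_size m)) @ \oo --> (0 : R).
Proof.
have c : (fun m => 4 * (Num.sqrt (Num.sqrt (ln_size m)))^-1) @ \oo --> (0 : R).
  rewrite -[X in _ --> X](mulr0 4); apply: cvgM; first exact: cvg_cst.
  by apply: cvgy_inv; do 2 apply: cvgy_sqrt; exact: ln_size_cvgy.
apply: norm_squeeze0 c; move/cvgryPge : ln_size_cvgy => /(_ 1).
apply: filterS => m l1; have l0 := ln_size_gt0 m.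
set r := Num.sqrt (Num.sqrt (ln_size m)).
have r0 : 0 < r by rewrite !sqrtr_gt0.
have r2 : Num.sqrt (ln_size m) = r ^+ 2 by rewrite sqr_sqrtr ?sqrtr_ge0.
have r4 : ln_size m = (r ^+ 2) ^+ 2 by rewrite -r2 sqr_sqrtr ?(ltW l0).
have lr : ln r <= r.
  have := @le_ln1Dx R (r - 1); rewrite (_ : 1 + (r - 1) = r); last by ring.
  by move=> h; apply: le_trans (h _) _; lra.
have lnE : ln (ln_size m) = 4 * ln r.
  by rewrite r4 -exprM lnXn// -[LHS]mulr_natl.
rewrite r2 lnE ger0_norm; last first.
  by rewrite divr_ge0 ?sqr_ge0// -lnE ln_ge0.
rewrite -mulrA ler_pM2l// ler_pdivrMr ?exprn_gt0//.
by rewrite expr2 mulrA mulVf ?gt_eqF// mul1r.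
Qed.

Lemma powR_cvg1 (a : R) : (fun x : R => x `^ a) x @[x --> (1 : R)] --> (1 : R).
Proof.
have [d _] := is_derive1_powR a (@ltr01 R).
have : (fun x : R => x `^ a) x @[x --> (1 : R)] --> ((1 : R) `^ a : R).
  exact: differentiable_continuous (proj1 (derivable1_diffP _ _) d).
by rewrite powR1.
Qed.

Lemma cvg_expR u l : u @ \oo --> l -> (fun m => expR (u m)) @ \oo --> expR l.
Proof. by move=> ul; apply: continuous_cvg => //; exact: continuous_expR. Qed.

Lemma cvg_expR1 u : u @ \oo --> (0 : R) -> (fun m => expR (u m)) @ \oo --> (1 : R).
Proof. by move=> /cvg_expR; rewrite expR0. Qed.

Lemma sqrtXn (a : R) (j : nat) : 0 <= a -> Num.sqrt a ^+ j = a `^ (j%:R / 2).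
Proof.
by move=> a0; rewrite -powR12_sqrt// -powR_mulrn ?powR_ge0// -powRrM mulrC.
Qed.

End Limits.

(** * The threshold weight and the mean number of light paths with k edges *)

Section Threshold.
Context (R : realType) (s : R) (s0 : 0 < s) (k : nat) (k2 : (2 <= k)%N) (t : R).
Notation L := (@ln_size R).
Let p := s^-1.
Let K : R := k%:R.
Let gk := g s K.
Let n (m : nat) : R := m.+2%:R.

Let p0 : 0 < p. Proof. by rewrite invr_gt0. Qed.
Let K2 : 2 <= K. Proof. by rewrite ler_nat. Qed.
Let K0 : 0 < K. Proof. by apply: lt_le_trans K2. Qed.
Let K1 : 0 < K - 1. Proof. by have := K2; lra. Qed.
Let gk0 : 0 < gk. Proof. exact: g_gt0. Qed.
Let KE : (k.-1)%:R = K - 1. Proof. by rewrite /K -[in RHS](@prednK k) ?(ltnW k2)// -natr1 addrK. Qed.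

(** [rescaled_weight] is affine in the weight; solving [rescaled_weight] > t for it gives the
    threshold g_s(k) / L^s times 1 + [rel_shift], where [rel_shift] is of order log log n / log
    n. *)
Definition centred (m : nat) : R :=
  t - (K - 1) / 2 * ln (L m) + p * (K - 1) * ln gk / 2.
Definition rel_shift m : R := s * centred m / ((K - 1) * L m).
Definition threshold m : R := gk / L m `^ s * (1 + rel_shift m).
Definition stretch m : R := (1 + rel_shift m) `^ (- p).
(** The common value y of k exponentials with k y^(-s) equal to the threshold; [stretch] is its
    correction for t. *)
Definition level m : R := (K - 1) / K * L m * stretch m.

Lemma rescaled_weight_gt m W :
  (rescaled_weight s k m.+2%:R W > t) = (threshold m < W).
Proof.
have l0 : 0 < L m by exact: ln_size_gt0.
have ls0 : 0 < L m `^ s by exact: powR_gt0.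
have lE : L m `^ (s + 1) = L m `^ s * L m.
  by rewrite powRD ?(gt_eqF l0) ?implybT// powRr1// ltW.
rewrite /rescaled_weight -/(ln_size R m) -/K -/gk lE.
pose C := (K - 1) / (s * gk) * (L m `^ s * L m).
have C0 : 0 < C := (mulr_gt0 (divr_gt0 K1 (mulr_gt0 s0 gk0)) (mulr_gt0 ls0 l0)).
have E : C * (W - threshold m) =
  (K - 1) / (s * gk) * (L m `^ s * L m) * (W - gk / L m `^ s) - centred m.
  rewrite /C /threshold /rel_shift; field.
  by rewrite !gt_eqF.
rewrite -[RHS]subr_gt0 -(pmulr_rgt0 _ C0) E subr_gt0 /centred -/p.
by apply/idP/idP; lra.
Qed.

Lemma centred_div_sqrt : (fun m => centred m / Num.sqrt (L m)) @ \oo --> (0 : R).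
Proof.
have i0 : (fun m => (Num.sqrt (L m))^-1) @ \oo --> (0 : R).
  by apply: cvgy_inv; apply: cvgy_sqrt; exact: ln_size_cvgy.
pose A := t + p * (K - 1) * ln gk / 2.
have : (fun m => A * (Num.sqrt (L m))^-1 - (K - 1) / 2 * (ln (L m) / Num.sqrt (L m)))
   @ \oo --> (A * 0 - (K - 1) / 2 * 0 : R).
  apply: cvgB; apply: cvgM => //; [exact: cvg_cst|exact: cvg_cst|].
  exact: ln_div_sqrt_ln_size.
rewrite !mulr0 subr0; apply: eq_cvgn => m.
by rewrite /centred /A; ring.
Qed.

(** The rate that is required later: L times the square of the shift tends to 0. *)
Lemma sqrt_shift : (fun m => Num.sqrt (L m) * rel_shift m) @ \oo --> (0 : R).
Proof.
have : (fun m => s / (K - 1) * (centred m / Num.sqrt (L m))) @ \oo --> (s / (K - 1) * 0 : R).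
  by apply: cvgM; [exact: cvg_cst|exact: centred_div_sqrt].
rewrite mulr0; apply: eq_cvgn => m.
have l0 : 0 < Num.sqrt (L m) by rewrite sqrtr_gt0 ln_size_gt0.
have lE : L m = Num.sqrt (L m) * Num.sqrt (L m).
  by rewrite -expr2 sqr_sqrtr// ltW// ln_size_gt0.
rewrite [in RHS]/rel_shift {3}lE; field.
by rewrite !gt_eqF.
Qed.

Lemma shift_cvg0 : rel_shift @ \oo --> (0 : R).
Proof.
have i0 : (fun m => (Num.sqrt (L m))^-1) @ \oo --> (0 : R).
  by apply: cvgy_inv; apply: cvgy_sqrt; exact: ln_size_cvgy.
have : (fun m => (Num.sqrt (L m))^-1 * (Num.sqrt (L m) * rel_shift m)) @ \oo --> (0 * 0 : R).
  by apply: cvgM; [exact: i0|exact: sqrt_shift].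
rewrite mulr0; apply: eq_cvgn => m.
have l0 : 0 < Num.sqrt (L m) by rewrite sqrtr_gt0 ln_size_gt0.
by rewrite /= mulrA mulVf ?gt_eqF// mul1r.
Qed.

Lemma shift_near (e : R) : 0 < e -> \forall m \near \oo, `|rel_shift m| <= e.
Proof.
move=> e0; have /cvgrPdist_le /(_ _ e0) := shift_cvg0.
by apply: filterS => m; rewrite sub0r normrN.
Qed.

Lemma stretch_cvg1 : stretch @ \oo --> (1 : R).
Proof.
apply: (@cvg_comp _ _ _ (fun m => 1 + rel_shift m) (fun x => x `^ (- p))) (@powR_cvg1 R (- p)).
have : (fun m => 1 + rel_shift m) @ \oo --> (1 + 0 : R).
  by apply: cvgD; [exact: cvg_cst|exact: shift_cvg0].
by rewrite addr0.
Qed.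

(** In the exponent [stretch] is multiplied by L, so its linear term must be kept exactly; the
    quadratic remainder vanishes by [sqrt_shift]. *)
Lemma stretch_expansion :
  (fun m => (K - 1) * L m * (1 - stretch m - p * rel_shift m)) @ \oo --> (0 : R).
Proof.
pose f (x : R) := x `^ (- p) - 1 + p * (x - 1).
pose D (x : R) := p - p * x `^ (- p - 1).
pose kap := p * (p + 1).
have taylor : \forall x \near (1 : R), `|f x - kap / 2 * (x - 1) ^+ 2| <= 1 * (x - 1) ^+ 2.
  apply: (@taylor2 _ f D) => //.
  - near=> x; have x0 : 0 < x by near: x; exact: lt_nbhsr.
    have dp := is_derive1_powR (- p) x0.
    pose G := (@powR R ^~ (- p)) - cst 1 + p \*: (id - cst 1).
    rewrite (_ : f = G); last by apply/funext => x'; rewrite /G /f /= !fctE.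
    apply: is_derive_eq; rewrite /D /GRing.scale /=; ring.
  - by rewrite /f powR1 !subrr mulr0 addr0.
  - by rewrite /D powR1 mulr1 subrr.
  have dp := is_derive1_powR (- p - 1) (@ltr01 R).
  pose G := cst p - p \*: (@powR R ^~ (- p - 1)).
  rewrite (_ : D = G); last by apply/funext => x'; rewrite /G /D /= !fctE.
  apply: is_derive_eq; rewrite /kap /GRing.scale /= powR1; ring.
have [del del0 hdel] := near_delta taylor.
pose C := (K - 1) * (kap / 2 + 1).
have z2 : (fun m => C * (Num.sqrt (L m) * rel_shift m * (Num.sqrt (L m) * rel_shift m)))
    @ \oo --> (0 : R).
  rewrite -[X in _ --> X](mulr0 C); apply: cvgM; first exact: cvg_cst.
  by rewrite -[X in _ --> X](mulr0 0); apply: cvgM; exact: sqrt_shift.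
apply: norm_squeeze0 z2; apply: filterS (shift_near del0) => m zm.
have l0 : 0 < L m := ln_size_gt0 R m.
have kap0 : 0 < kap by rewrite mulr_gt0// addr_gt0.
have := hdel (1 + rel_shift m).
rewrite (_ : 1 + rel_shift m - 1 = rel_shift m); last by ring.
move=> /(_ zm); rewrite /f (_ : 1 + rel_shift m - 1 = rel_shift m); last by ring.
rewrite -/(stretch m) mul1r => h.
have sq2 : 0 <= rel_shift m ^+ 2 := sqr_ge0 _.
have h2 : `|1 - stretch m - p * rel_shift m| <= (kap / 2 + 1) * rel_shift m ^+ 2.
  by move: h; rewrite !ler_norml; have := mulr_ge0 (ltW kap0) sq2; lra.
rewrite normrM (gtr0_norm (mulr_gt0 K1 l0)).
have lE : L m = Num.sqrt (L m) * Num.sqrt (L m).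
  by rewrite -expr2 sqr_sqrtr// ltW.
rewrite (_ : C * _ = (K - 1) * L m * ((kap / 2 + 1) * rel_shift m ^+ 2)).
  by rewrite ler_pM2l// mulr_gt0.
by rewrite {3}lE /C; ring.
Unshelve. all: by end_near. Qed.

Lemma level_ge : \forall m \near \oo, (K - 1) / K / 2 * L m <= level m.
Proof.
have /cvgrPdist_le /(_ 2^-1) := stretch_cvg1.
rewrite invr_gt0 ltr0n => /(_ isT); apply: filterS => m; rewrite ler_distlC => /andP[h _].
have c0 : 0 < (K - 1) / K * L m by rewrite mulr_gt0 ?divr_gt0 ?ln_size_gt0.
by rewrite /level; have := ler_wpM2l (ltW c0) h; lra.
Qed.

Lemma level_cvgy : level @ \oo --> +oo.
Proof.
have c0 : 0 < (K - 1) / K / 2 by rewrite !divr_gt0.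
have := cvgy_scale c0 (@ln_size_cvgy R) => /cvgryPge h; apply/cvgryPge => A.
near=> m; apply: (@le_trans _ _ ((K - 1) / K / 2 * L m)).
  by near: m; exact: h.
by near: m; exact: level_ge.
Unshelve. all: by end_near. Qed.

(** Because K ((K - 1)/K)^(-s) = g_s(K). The powers of 1 + [rel_shift] cancel once that base is
    positive, hence only for large m. *)
Lemma threshold_level : \forall m \near \oo, threshold m = K * level m `^ (- s).
Proof.
have h2 : (0 : R) < 2^-1 by rewrite invr_gt0.
apply: filterS (shift_near h2) => m; rewrite ler_norml => /andP[z1 z2].
have z0 : 0 < 1 + rel_shift m by lra.
have l0 : 0 < L m by exact: ln_size_gt0.
have c0 : 0 < (K - 1) / K by rewrite divr_gt0.
rewrite /level powRM ?powR_ge0 ?mulr_ge0 ?(ltW c0) ?(ltW l0)//.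
rewrite powRM ?(ltW c0) ?(ltW l0)// /stretch -powRrM.
rewrite /p mulrN mulNr opprK mulVf ?gt_eqF// powRr1 ?(ltW z0)//.
rewrite /threshold /gk /g (powRM _ (ltW K1)) ?invr_ge0 ?(ltW K0)//.
rewrite !powRN -[K^-1]powR_inv1 ?(ltW K0)// -powRrM mulN1r powRN invrK.
rewrite (powRD _ (r := s)) ?(gt_eqF K0) ?implybT// powRr1 ?(ltW K0)//.
- by ring.
- exact: ltW.
- by rewrite invr_ge0 ltW.
Qed.

Lemma sum_cdf_level (e : R) : 0 < e <= 1 -> \forall m \near \oo,
  (1 - e) * laplace_main s k.-1 (level m) <= sum_cdf s k (threshold m) <=
  (1 + e) * laplace_main s k.-1 (level m).
Proof.
move=> e01; have [Y Y0 hY] := sum_cdf_laplace s0 k.-1 e01.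
have /cvgryPge /(_ Y) := level_cvgy => yY.
near=> m; have -> : threshold m = K * level m `^ (- s).
  by near: m; exact: threshold_level.
have := hY (level m); rewrite prednK ?(ltnW k2)//; apply.
by near: m; exact: yY.
Unshelve. all: by end_near. Qed.

Definition limit_const : R := laplace_const s k.-1 *
  Num.sqrt ((K - 1) / K) ^+ k.-1 * gk `^ (p * (K - 1) / 2) * expR t.

Lemma limit_const_gt0 : 0 < limit_const.
Proof.
have c0 : 0 < (K - 1) / K by rewrite divr_gt0.
apply: mulr_gt0 (expR_gt0 _); apply: mulr_gt0 (powR_gt0 _ gk0).
by apply: mulr_gt0; [exact: laplace_const_gt0|rewrite exprn_gt0// sqrtr_gt0].
Qed.

(** By [g_powR] the factor g_s(k)^p contains K/(K - 1), which cancels the (K - 1)/K from [level] and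
    leaves K^(p (k-1)/2); the root of K in [laplace_const] gives the remaining exponent -1/2. *)
Lemma limit_constE : limit_const = a_ s k * expR t.
Proof.
rewrite /limit_const /a_ /laplace_const prednK ?(ltnW k2)// -/K -/p; congr (_ * _).
have sq (a : R) : 0 <= a -> Num.sqrt a ^+ k.-1 = a `^ ((K - 1) / 2).
  by move=> a0; rewrite sqrtXn// KE.
have pi0 := pi_gt0 R.
have s1 : 0 < s + 1 by rewrite addr_gt0.
have c0 : 0 < 2 * pi / (s + 1) by rewrite divr_gt0// mulr_gt0.
have d0 : 0 < (K - 1) / K by rewrite divr_gt0.
rewrite (_ : 2 * pi * p / (1 + p) = 2 * pi / (s + 1)); last first.
  by rewrite /p; field; rewrite !gt_eqF//= addrC gt_eqF.
rewrite !sq ?(ltW c0) ?(ltW d0)// -!mulrA; congr (_ * _).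
have -> : gk `^ (p * ((K - 1) / 2)) = (gk `^ p) `^ ((K - 1) / 2).
  by rewrite -powRrM.
have gp : gk `^ p = K `^ p * (K / (K - 1)) by apply: g_powR => //; have := K2; lra.
have -> : ((K - 1) / K) `^ ((K - 1) / 2) * (gk `^ p) `^ ((K - 1) / 2) =
  K `^ (p * ((K - 1) / 2)).
  rewrite -powRM ?(ltW d0) ?powR_ge0// [RHS]powRrM gp; congr (_ `^ _).
  by field; rewrite !gt_eqF.
rewrite -powR12_sqrt ?(ltW K0)// -powRN -powRD; last by rewrite (gt_eqF K0) implybT.
by congr (_ `^ _); field.
Qed.

(** Here the normalization is accounted for: n^(k-1) cancels the leading part of e^(-K [level]),
    whose linear correction in [rel_shift] is exactly [centred]; the log log n term in [centred]
    cancels (sqrt L)^(k-1). What remains besides the constant tends to 1. *)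
Lemma laplace_main_level m : 0 < 1 + rel_shift m ->
  n m ^+ k.-1 * laplace_main s k.-1 (level m) =
  limit_const * (Num.sqrt (stretch m) ^+ k.-1 *
    expR ((K - 1) * L m * (1 - stretch m - p * rel_shift m))).
Proof.
move=> z0; have l0 : 0 < L m by exact: ln_size_gt0.
have x0 : 0 < stretch m by exact: powR_gt0.
have c0 : 0 < (K - 1) / K by rewrite divr_gt0.
rewrite /laplace_main /limit_const prednK ?(ltnW k2)// -/K.
have -> : n m ^+ k.-1 = expR ((K - 1) * L m).
  by rewrite /n -expR_ln_size -expRM_natl KE.
have -> : Num.sqrt (level m) ^+ k.-1 = Num.sqrt ((K - 1) / K) ^+ k.-1 *
   Num.sqrt (L m) ^+ k.-1 * Num.sqrt (stretch m) ^+ k.-1.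
  rewrite /level; move: ((K - 1) / K) c0 => c c0.
  by rewrite sqrtrM ?(mulr_ge0 (ltW c0) (ltW l0))// sqrtrM ?(ltW c0)// !exprMn.
have lE : Num.sqrt (L m) ^+ k.-1 = expR ((K - 1) / 2 * ln (L m)).
  by rewrite sqrtXn ?(ltW l0)// KE /powR gt_eqF.
have gE : gk `^ (p * (K - 1) / 2) = expR (p * (K - 1) / 2 * ln gk).
  by rewrite /powR gt_eqF.
rewrite lE gE.
have kl : K * level m = (K - 1) * L m * stretch m.
  by rewrite /level; field; rewrite gt_eqF.
have ct : (K - 1) * L m * (p * rel_shift m) = centred m.
  by rewrite /rel_shift /p; field; rewrite !gt_eqF.
rewrite kl.
transitivity (laplace_const s k.-1 * Num.sqrt ((K - 1) / K) ^+ k.-1 *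
  Num.sqrt (stretch m) ^+ k.-1 * (expR ((K - 1) * L m) *
  expR ((K - 1) / 2 * ln (L m)) * expR (- ((K - 1) * L m * stretch m)))); first by ring.
transitivity (laplace_const s k.-1 * Num.sqrt ((K - 1) / K) ^+ k.-1 *
  Num.sqrt (stretch m) ^+ k.-1 * (expR (p * (K - 1) / 2 * ln gk) * expR t *
  expR ((K - 1) * L m * (1 - stretch m - p * rel_shift m)))); last by ring.
congr (_ * _); rewrite -!expRD; congr expR.
rewrite [(K - 1) * L m * (1 - _ - _)]mulrBr ct /centred; ring.
Qed.

Lemma mean_cvg : (fun m => n m ^+ k.-1 * sum_cdf s k (threshold m)) @ \oo --> limit_const.
Proof.
pose M m := Num.sqrt (stretch m) ^+ k.-1 *
    expR ((K - 1) * L m * (1 - stretch m - p * rel_shift m)).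
have M1 : M @ \oo --> (1 : R).
  rewrite -[X in _ --> X](mulr1 1); apply: cvgM.
    have : (fun m => stretch m `^ ((K - 1) / 2)) @ \oo --> (1 : R).
      apply: (@cvg_comp _ _ _ stretch (fun x => x `^ ((K - 1) / 2))) (@powR_cvg1 R _).
      exact: stretch_cvg1.
    apply: eq_cvgn => m.
    by rewrite sqrtXn ?powR_ge0// KE.
  by apply: cvg_expR1; exact: stretch_expansion.
have lc0 := limit_const_gt0.
have : (fun m => limit_const * M m) @ \oo --> limit_const.
  by rewrite -[X in _ --> X]mulr1; apply: cvgM => //; exact: cvg_cst.
move=> lM.
suff d0 : (fun m => n m ^+ k.-1 * sum_cdf s k (threshold m) - limit_const * M m)
    @ \oo --> (0 : R).
  have : (fun m => n m ^+ k.-1 * sum_cdf s k (threshold m) - limit_const * M m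
    + limit_const * M m) @ \oo --> (0 + limit_const : R) by exact: cvgD.
  by rewrite add0r; apply: eq_cvgn => m; rewrite subrK.
apply/cvgrPdist_le => e e0.
(* The limit constant times the bound 2 for [M] converts the relative error into an absolute one. *)
pose e' := Num.min 1 (e / (limit_const * 2)).
have e'0 : 0 < e' by rewrite lt_min ltr01/= divr_gt0// mulr_gt0.
have e'1 : 0 < e' <= 1 by rewrite e'0 /e' ge_min lexx.
have e'e : e' * (limit_const * 2) <= e.
  by rewrite -ler_pdivlMr ?(mulr_gt0 lc0)// /e' ge_min lexx orbT.
have h1 := sum_cdf_level e'1.
have M2 : \forall m \near \oo, M m <= 2.
  have /cvgrPdist_le /(_ 1 ltr01) := M1; apply: filterS => m.
  by rewrite ler_distlC => /andP[_]; rewrite -natr1.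
have h2 : (0 : R) < 2^-1 by rewrite invr_gt0.
near=> m.
have z0 : 0 < 1 + rel_shift m.
  suff : `|rel_shift m| <= 2^-1 by rewrite ler_norml => /andP[]; lra.
  by near: m; exact: shift_near.
have hF : (1 - e') * laplace_main s k.-1 (level m) <= sum_cdf s k (threshold m) <=
  (1 + e') * laplace_main s k.-1 (level m) by near: m.
have mM : M m <= 2 by near: m.
have main := laplace_main_level z0.
have n0 : 0 < n m ^+ k.-1 by rewrite exprn_gt0// ltr0n.
rewrite sub0r normrN -[limit_const * M m]main -mulrBr normrM (gtr0_norm n0).
apply: (@le_trans _ _ (n m ^+ k.-1 * (e' * laplace_main s k.-1 (level m)))).
  by rewrite ler_pM2l// ler_norml; case/andP: hF; lra.
rewrite mulrCA main; apply: le_trans e'e; rewrite ler_pM2l// ler_pM2l//.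
Unshelve. all: by end_near. Qed.

End Threshold.

Lemma ffact_ge (m r : nat) : ((m - r) ^ r <= m ^_ r)%N.
Proof.
elim: r => [|r IH]; first by rewrite ffactn0.
rewrite ffactnSr expnSr; apply: leq_mul; last by rewrite leq_sub2l.
apply: leq_trans IH; case: r => [//|r]; by rewrite leq_exp2r ?leq_sub2l.
Qed.

Section Sequences.
Context (R : realType).
Implicit Types u : nat -> R.

Lemma cvg_exprn u (l : R) r : u @ \oo --> l -> (fun m => u m ^+ r) @ \oo --> (l ^+ r : R).
Proof.
move=> ul; elim: r => [|r IH]; first by rewrite expr0; exact: cvg_cst.
rewrite exprS; apply: (@eq_cvgn _ (fun m => u m * u m ^+ r)) => [m|]; first by rewrite exprS.
exact: cvgM.
Qed.

Lemma vertices_cvgy : (fun m => m.+2%:R : R) @ \oo --> +oo.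
Proof.
apply/cvgryPge => A; near=> m; apply: (@le_trans _ _ m%:R); last by rewrite ler_nat; lia.
by near: m; exact: nbhs_infty_ger.
Unshelve. all: by end_near. Qed.

Lemma card_paths_cvg (k : nat) : (1 <= k)%N ->
  (fun m => #|paths m k|%:R / m.+2%:R ^+ k.-1 : R) @ \oo --> (1 : R).
Proof.
move=> k1; pose r := k.-1.
have i0 : (fun m => (m.+2%:R : R)^-1) @ \oo --> (0 : R).
  exact: cvgy_inv vertices_cvgy.
(* Since n = m + 2, the number m - r from the falling factorial bound is n - (r + 2). *)
have lo : (fun m => (1 - r.+2%:R * (m.+2%:R)^-1) ^+ r) @ \oo --> (1 : R).
  rewrite -[X in _ --> X](expr1n _ r); apply: cvg_exprn.
  have : (fun m => 1 - r.+2%:R * (m.+2%:R)^-1) @ \oo --> (1 - r.+2%:R * 0 : R).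
    by apply: cvgB; [exact: cvg_cst|apply: cvgM; [exact: cvg_cst|exact: i0]].
  by rewrite mulr0 subr0.
apply: (squeeze_cvgr _ lo (@cvg_cst _ (1 : R) _ _ _)).
near=> m.
have n0 : 0 < m.+2%:R ^+ r :> R by rewrite exprn_gt0.
rewrite -/r ler_pdivrMr// ler_pdivlMr// mul1r -exprMn -!natrX; apply/andP; split; last first.
  rewrite ler_nat; exact: card_paths_le.
have -> : (1 - r.+2%:R * (m.+2%:R)^-1) * m.+2%:R = (m - r)%N%:R :> R.
  rewrite mulrBl mul1r -mulrA mulVf ?mulr1 ?pnatr_eq0//.
  rewrite natrB; last by near: m; exact: nbhs_infty_ge.
  by rewrite -(addn2 m) -(addn2 r) !natrD; ring.
rewrite -natrX ler_nat; apply: leq_trans (ffact_ge _ _) _.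
exact: card_paths_ge.
Unshelve. all: by end_near. Qed.

Lemma geometric_le (X : R) (r : nat) : 0 <= X <= 2^-1 ->
  \sum_(i < r) X ^+ i.+1 <= 2 * X.
Proof.
move=> /andP[X0 X2]; elim: r => [|r IH]; first by rewrite big_ord0 mulr_ge0.
rewrite big_ord_recl expr1.
under eq_bigr do rewrite exprS.
rewrite -mulr_sumr; have := ler_wpM2l X0 IH.
by have := ler_wpM2l X0 X2; lra.
Qed.

(** The constant of [sum_meet_le] after k + 1 + x <= (k + 2) x for x >= 1. *)
Definition collision_const (k : nat) : R := k%:R * k.+1%:R * k.+2%:R ^+ k.-2.

(** Rewrites the error in terms of M low and M F, whose limits are known. The square of the mean
    comes with n^(k-2) = M / n, hence with a factor 1/n; the hypothesis 1 <= n rho allows the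
    additive k + 1 to be absorbed. *)
Lemma poisson_error_le (k : nat) (M N n F low rho : R) : (2 <= k)%N -> M = n ^+ k.-1 ->
  1 <= n -> 0 <= N <= M -> 0 <= F -> 0 <= low -> 0 <= rho -> 1 <= n * rho ->
  poisson_error k N n F low rho <=
    k%:R * (M * low) + (1 + collision_const k) * ((M * F) ^+ 2 / n) +
    collision_const k * (M * F * (rho * (n * rho) ^+ k.-2)).
Proof.
move=> k2 ME0 n1 /andP[N0 NM] F0 low0 rho0 nr1; set C := collision_const k.
have n0 : 0 < n by lra.
have ME : M = n * n ^+ k.-2 by rewrite ME0 -exprS; congr (_ ^+ _); lia.
have D1 : (k.+1%:R + n) ^+ k.-2 <= k.+2%:R ^+ k.-2 * n ^+ k.-2.
  rewrite -exprMn lerXn2r ?nnegrE//; first by rewrite addr_ge0// ltW.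
    by rewrite mulr_ge0// ltW.
  rewrite -[k.+2%:R]natr1 mulrDl mul1r lerD2r.
  by rewrite -[leLHS]mulr1 ler_wpM2l.
have D2 : (k.+1%:R + n * rho) ^+ k.-2 <= k.+2%:R ^+ k.-2 * (n * rho) ^+ k.-2.
  rewrite -exprMn lerXn2r ?nnegrE//; first by rewrite addr_ge0//; lra.
    by rewrite mulr_ge0//; lra.
  rewrite -[k.+2%:R]natr1 mulrDl mul1r lerD2r.
  by rewrite -[leLHS]mulr1 ler_wpM2l.
have kk0 : 0 <= k%:R * k.+1%:R :> R by rewrite mulr_ge0.
have C0 : 0 <= C by rewrite mulr_ge0// exprn_ge0.
have FF0 : 0 <= F ^+ 2 by exact: sqr_ge0.
have Fr0 : 0 <= F * rho by exact: mulr_ge0.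
have nM : n <= M.
  by rewrite ME ler_peMr ?(ltW n0)// exprn_ege1.
have M0 : 0 <= M by rewrite (le_trans (ltW n0)).
have B1 : M * F ^+ 2 <= (M * F) ^+ 2 / n.
  rewrite ler_pdivlMr// (_ : (M * F) ^+ 2 = M * F ^+ 2 * M); last by ring.
  by rewrite ler_wpM2l// mulr_ge0.
have E2 : F ^+ 2 * (k%:R * k.+1%:R * (k.+1%:R + n) ^+ k.-2) <= C * (F ^+ 2 * n ^+ k.-2).
  rewrite (_ : C * _ = F ^+ 2 * (k%:R * k.+1%:R * (k.+2%:R ^+ k.-2 * n ^+ k.-2))).
    by rewrite ler_wpM2l// ler_wpM2l.
  by rewrite /C /collision_const; ring.
have B2 : M * (F ^+ 2 * n ^+ k.-2) = (M * F) ^+ 2 / n.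
  by rewrite ME; field; rewrite gt_eqF.
have E3 : F * rho * (k%:R * k.+1%:R * (k.+1%:R + n * rho) ^+ k.-2) <=
    C * (F * (rho * (n * rho) ^+ k.-2)).
  rewrite (_ : C * _ = F * rho * (k%:R * k.+1%:R * (k.+2%:R ^+ k.-2 * (n * rho) ^+ k.-2))).
    by rewrite ler_wpM2l// ler_wpM2l.
  by rewrite /C /collision_const; ring.
apply: (@le_trans _ _ (M * (k%:R * low + F ^+ 2 +
  (C * (F ^+ 2 * n ^+ k.-2) + C * (F * (rho * (n * rho) ^+ k.-2)))))).
  rewrite /poisson_error; apply: le_trans (ler_wpM2r _ NM) _.
    do ?[apply: addr_ge0|apply: mulr_ge0] => //; try exact: exprn_ge0.
    - by apply/exprn_ge0/addr_ge0 => //; lra.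
    - by apply/exprn_ge0/addr_ge0 => //; lra.
  by rewrite ler_wpM2l// lerD// lerD.
rewrite (_ : M * _ = k%:R * (M * low) + (M * F ^+ 2 + C * (M * (F ^+ 2 * n ^+ k.-2)))
  + C * (M * F * (rho * (n * rho) ^+ k.-2))); last by ring.
by rewrite lerD2r lerD2l B2 mulrDl mul1r lerD2r.
Qed.

Lemma poly_expR_cvg0 (j : nat) (eta C : R) u : 0 < eta -> 0 <= C ->
  u @ \oo --> +oo -> (fun m => C * u m ^+ j * expR (- (eta * u m))) @ \oo --> (0 : R).
Proof.
move=> eta0 C0 /cvgryPge uy; apply/cvgrPdist_le => e e0.
have [Y Y0 hY] := poly_expR_small j eta0 e0 C0.
apply: filterS (uy (Num.max Y 0)) => m; rewrite ge_max => /andP[hm um0].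
by rewrite sub0r normrN ger0_norm ?hY// mulr_ge0 ?expR_ge0// mulr_ge0// exprn_ge0.
Qed.

End Sequences.

(** * Decay of the error terms *)

Section Rates.
Context (R : realType) (s : R) (s0 : 0 < s) (k : nat) (k2 : (2 <= k)%N) (t : R).
Notation L := (@ln_size R).
Let p := s^-1.
Let K : R := k%:R.
Let gk := g s K.
Let n (m : nat) : R := m.+2%:R.
Notation threshold := (threshold s k t).
Notation level := (level s k t).
Notation stretch := (stretch s k t).

Let p0 : 0 < p. Proof. by rewrite invr_gt0. Qed.
Let K2 : 2 <= K. Proof. by rewrite ler_nat. Qed.
Let K0 : 0 < K. Proof. by apply: lt_le_trans K2. Qed.
Let K1 : 0 < K - 1. Proof. by have := K2; lra. Qed.
Let gk0 : 0 < gk. Proof. exact: g_gt0. Qed.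

(* Any gap below (k - 1)^(-2) makes the power of n in [collision_cvg0] negative. *)
Definition cut_gap : R := (2 * K ^+ 2)^-1.
Definition cutoff m : R := (1 - cut_gap) * ((K - 1) / K) * L m.

Lemma cut_gap_bounds : 0 < cut_gap < 1.
Proof.
have KK : 0 < 2 * K ^+ 2 by rewrite mulr_gt0// exprn_gt0.
by rewrite invr_gt0 KK/= invf_lt1//; have := K2; nra.
Qed.

Lemma cutoff_bounds m : 0 <= cutoff m <= L m.
Proof.
have l0 : 0 < L m := ln_size_gt0 R m; have /andP[d0 d1] := cut_gap_bounds.
have c0 : 0 <= (K - 1) / K by rewrite divr_ge0// ltW.
have c1 : (K - 1) / K <= 1 by rewrite ler_pdivrMr//; lra.
have d1' : 0 <= 1 - cut_gap by lra.
rewrite /cutoff; apply/andP; split; first exact: (mulr_ge0 (mulr_ge0 d1' c0) (ltW l0)).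
by rewrite ler_piMl ?(ltW l0)// mulr_ile1//; have /andP[] := cut_gap_bounds; lra.
Qed.

Lemma collision_cvg0 :
  (fun m => expR (- cutoff m) * (n m * expR (- cutoff m)) ^+ k.-2) @ \oo --> (0 : R).
Proof.
(* The exponent of n is -c, because (K - 1)^2 / K = K - 2 + 1/K. *)
pose c : R := (1 - cut_gap * (K - 1) ^+ 2) / K.
have c0 : 0 < c.
  rewrite divr_gt0// subr_gt0 /cut_gap mulrC ltr_pdivrMr; last first.
    by rewrite mulr_gt0// exprn_gt0.
  by have := K2; nra.
have := cvgy_expRN (cvgy_scale c0 (@ln_size_cvgy R)); apply: eq_cvgn => m.
rewrite /n -(@expR_ln_size R) -expRD -expRM_natl -expRD; congr expR.
rewrite (_ : k.-2%:R = K - 2); last by rewrite /K -[in RHS](subnK k2) natrD addrK subn2.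
by rewrite /c /cutoff; field; rewrite gt_eqF.
Qed.

(** [mean_cvg] read backwards through the Laplace asymptotics with error 1/2: it bounds the main
    term against which the probability of a low exponential is compared. *)
Lemma laplace_bounded : \forall m \near \oo,
  n m ^+ k.-1 * laplace_main s k.-1 (level m) <= 2 * (limit_const s k t + 1).
Proof.
pose h2 : R := 2^-1; have h01 : 0 < h2 <= 1 by apply/andP; rewrite /h2; split; lra.
near=> m.
have /andP[h _] : (1 - h2) * laplace_main s k.-1 (level m) <= sum_cdf s k (threshold m) <=
    (1 + h2) * laplace_main s k.-1 (level m).
  by near: m; exact: sum_cdf_level.
have mF : n m ^+ k.-1 * sum_cdf s k (threshold m) <= limit_const s k t + 1.
  suff : `|limit_const s k t - n m ^+ k.-1 * sum_cdf s k (threshold m)| <= 1.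
    by rewrite ler_distlC => /andP[]; lra.
  near: m; have /cvgrPdist_le /(_ 1 ltr01) := mean_cvg s0 k2 (t := t); exact.
have n0 : 0 <= n m ^+ k.-1 by rewrite exprn_ge0.
by have := ler_wpM2l n0 h; rewrite /h2; lra.
Unshelve. all: by end_near. Qed.

(** The cutoff stays a fixed fraction below [level], so an exponential below it has a convexity
    defect [eta]. The factor e^(-eta [level]) beats the power [level]^k caused by the parameter 1 -
    1/[level]. *)
Lemma low_cdf_cvg0 :
  (fun m => n m ^+ k.-1 * low_cdf s k (threshold m) (cutoff m)) @ \oo --> (0 : R).
Proof.
have /andP[d0 d1] := cut_gap_bounds.
have dh0 : 0 < cut_gap / 2 by rewrite divr_gt0.
have [eta eta0 away] := convexity_gap_away s0 dh0.
have lc0 := laplace_const_gt0 s0 k.-1.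
pose C1 := 2 * (limit_const s k t + 1) / laplace_const s k.-1.
have C10 : 0 <= C1.
  by rewrite divr_ge0 ?(ltW lc0)// mulr_ge0// addr_ge0// ltW// limit_const_gt0.
have yy := level_cvgy s k2 t.
have C20 : 0 <= C1 * expR (K + eta) by rewrite mulr_ge0// expR_ge0.
apply: norm_squeeze0 (poly_expR_cvg0 k eta0 C20 yy).
near=> m.
have y2 : 2 <= level m by near: m; move/cvgryPge : yy; exact.
have y0 : 0 < level m by lra.
have wE : threshold m = K * level m `^ (- s) by near: m; exact: threshold_level.
have st : `|1 - stretch m| <= cut_gap / 2.
  by near: m; have /cvgrPdist_le /(_ _ dh0) := stretch_cvg1 s k2 t; exact.
have lb : n m ^+ k.-1 * laplace_main s k.-1 (level m) <= 2 * (limit_const s k t + 1).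
  by near: m; exact: laplace_bounded.
have l0 : 0 < L m := ln_size_gt0 R m.
have th01 : 0 < 1 - (level m)^-1 < 1.
  by rewrite subr_gt0 invf_lt1// gtrBl invr_gt0 y0 andbT; lra.
have n0 : 0 < n m ^+ k.-1 by rewrite exprn_gt0// ltr0n.
have low : low_cdf s k (threshold m) (cutoff m) <=
    chernoff_bound s k (threshold m) (level m) (1 - (level m)^-1) (level m * eta).
  have := @sum_cdf_chernoff_gap R s s0 k.-1 `]-oo, cutoff m[%classic (threshold m)
    (level m) (1 - (level m)^-1) eta.
  rewrite prednK ?(ltnW k2)//; apply => // u.
  rewrite /= in_itv/= => uc u0.
  apply: away; first by rewrite divr_gt0.
  (* Half of [cut_gap] absorbs the deviation of [stretch] from 1: (1 - [cut_gap]/2)^2 >= 1 -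
     [cut_gap]. *)
  suff : u / level m < 1 - cut_gap / 2 by move=> h; rewrite ltr0_norm; lra.
  rewrite ltr_pdivrMr//; apply: lt_le_trans uc _.
  have A0 : 0 < (K - 1) / K * L m by rewrite mulr_gt0// divr_gt0.
  rewrite /cutoff /level -mulrA [leRHS]mulrCA [leLHS]mulrC ler_wpM2l ?(ltW A0)//.
  by move: st; rewrite ler_distlC => /andP[st _]; nra.
rewrite ger0_norm ?mulr_ge0 ?low_cdf_ge0// ?(ltW n0)//.
apply: le_trans (ler_wpM2l (ltW n0) low) _.
rewrite /chernoff_bound wE subrr mul0r addr0 opprB addrCA subrr addr0.
rewrite exprVn invrK.
rewrite (_ : - ((1 - (level m)^-1) * (k%:R * level m + level m * eta)) =
   - (K * level m) + (K + eta) - eta * level m); last first.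
  by rewrite -/K; field; rewrite gt_eqF.
rewrite (expRD (- (K * level m) + (K + eta))) (expRD (- (K * level m))).
rewrite (_ : _ * (level m ^+ k * _) = n m ^+ k.-1 * expR (- (K * level m)) *
   (expR (K + eta) * level m ^+ k * expR (- (eta * level m)))); last by ring.
rewrite (_ : C1 * expR _ * _ * _ = C1 *
   (expR (K + eta) * level m ^+ k * expR (- (eta * level m)))); last by ring.
apply: ler_wpM2r.
  by rewrite mulr_ge0 ?expR_ge0// mulr_ge0 ?expR_ge0// exprn_ge0// ltW.
rewrite /C1 ler_pdivlMr//; apply: le_trans lb.
rewrite -[leLHS]mulrA; apply: (ler_wpM2l (ltW n0)).
rewrite /laplace_main prednK ?(ltnW k2)// -/K [leLHS]mulrC.
apply: (ler_wpM2r (expR_ge0 _)); rewrite ler_peMr ?(ltW lc0)// exprn_ege1//.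
by rewrite -[leLHS]sqrtr1 ler_sqrt//; lra.
Unshelve. all: by end_near. Qed.

Definition error_bound m : R :=
  K * (n m ^+ k.-1 * low_cdf s k (threshold m) (cutoff m)) +
  (1 + collision_const R k) * ((n m ^+ k.-1 * sum_cdf s k (threshold m)) ^+ 2 / n m) +
  collision_const R k * (n m ^+ k.-1 * sum_cdf s k (threshold m) *
    (expR (- cutoff m) * (n m * expR (- cutoff m)) ^+ k.-2)).

Lemma error_bound_cvg0 : error_bound @ \oo --> (0 : R).
Proof.
have mc := mean_cvg s0 k2 (t := t); pose A := limit_const s k t.
have i0 : (fun m => (n m)^-1) @ \oo --> (0 : R) by apply: cvgy_inv; exact: vertices_cvgy.
have : error_bound @ \oo --> (K * 0 + (1 + collision_const R k) * (A ^+ 2 * 0)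
    + collision_const R k * (A * 0) : R).
  apply: cvgD; [apply: cvgD|]; (apply: cvgM; first exact: cvg_cst).
  - exact: low_cdf_cvg0.
  - by apply: cvgM; [exact: cvg_exprn|exact: i0].
  - by apply: cvgM; [exact: mc|exact: collision_cvg0].
by rewrite !mulr0 !addr0.
Qed.

Lemma poisson_error_bound m :
  poisson_error k #|paths m k|%:R m.+2%:R (sum_cdf s k (threshold m))
    (low_cdf s k (threshold m) (cutoff m)) (expR (- cutoff m)) <= error_bound m.
Proof.
apply: poisson_error_le => //.
- by rewrite ler1n.
- by rewrite ler0n/= -natrX ler_nat card_paths_le// ltnW.
- exact: sum_cdf_ge0.
- exact: low_cdf_ge0.
rewrite -(@expR_ln_size R) -expRD -expR0 ler_expR subr_ge0.
by have /andP[] := cutoff_bounds m.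
Qed.

Lemma expected_count_cvg :
  (fun m => #|paths m k|%:R * sum_cdf s k (threshold m)) @ \oo --> limit_const s k t.
Proof.
have : (fun m => #|paths m k|%:R / n m ^+ k.-1 *
    (n m ^+ k.-1 * sum_cdf s k (threshold m))) @ \oo --> (1 * limit_const s k t : R).
  by apply: cvgM; [apply: card_paths_cvg; exact: ltnW|exact: mean_cvg].
rewrite mul1r; apply: eq_cvgn => m.
have n0 : 0 < n m ^+ k.-1 by rewrite exprn_gt0// ltr0n.
by rewrite mulrA divfK ?gt_eqF.
Qed.

Hypothesis gap : exists2 c : R, 0 < c &
  forall j, (2 <= j)%N -> j != k -> (1 + c) * gk <= g s j%:R.

(** For j edges and weight G g_s(k) / L^s, Chernoff at y = (j / (G g_s(k)))^p L must beat n^(j-1).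
    By [g_powR], j y / L equals (j - 1) (g_s(j) / (G g_s(k)))^p, which the gap makes larger than j -
    1 by a fixed factor for j >= 2. The margin grows linearly in j, so the bounds can be summed over
    all lengths. *)
Lemma rate_gap : exists G th eta : R, [/\ 1 < G, 0 < th < 1, 0 < eta &
  forall j : nat, (1 <= j)%N -> j != k ->
    j%:R - 1 + eta * j%:R <= th * (j%:R * (j%:R / (G * gk)) `^ p)].
Proof.
have [c c0 hc] := gap.
(* As 1 + c = G^2, one factor G absorbs the shift of the threshold and the other is left for the
   rate. *)
pose G : R := Num.sqrt (1 + c).
have GG : G * G = 1 + c by rewrite -expr2 sqr_sqrtr//; lra.
have G1 : 1 < G by rewrite -[ltLHS]sqrtr1 ltr_sqrt//; lra.
have G0 : 0 < G by lra.
have B1 : 1 < G `^ p.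
  by rewrite /powR gt_eqF// -expR0 ltr_expR mulr_gt0// ln_gt0.
pose b := G `^ p - 1.
have b0 : 0 < b by rewrite /b; lra.
(* Chosen so that th (1 + b) = 1 + b/2. Then (J - 1)(1 + b/2) >= J - 1 + (b/4) J for J >= 2, which
   explains b/4 in [eta]; its second entry serves j = 1, where J - 1 vanishes. *)
pose th := (1 + b / 2) / (1 + b).
have th0 : 0 < th by rewrite divr_gt0; lra.
have thB : th * (1 + b) = 1 + b / 2 by rewrite /th divfK// gt_eqF; lra.
have GK0 : 0 < G * gk by rewrite mulr_gt0.
have q0 : 0 < th * (1 / (G * gk)) `^ p by rewrite mulr_gt0// powR_gt0// divr_gt0.
pose eta := Num.min (b / 4) (th * (1 / (G * gk)) `^ p).
exists G, th, eta; split=> //.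
- by rewrite th0/= ltr_pdivrMr; lra.
- by rewrite lt_min q0 andbT divr_gt0.
move=> j j1 jk; have [j2|] := leqP 2 j; last first.
  move=> jl; have -> : j = 1%N by apply/eqP; rewrite eqn_leq j1 -ltnS jl.
  by rewrite subrr add0r mulr1 mul1r /eta ge_min lexx orbT.
have J2 : 2 <= j%:R :> R by rewrite ler_nat.
set J : R := j%:R in J2 *.
have J0 : 0 < J by lra.
have J1 : 0 < J - 1 by lra.
have gJ : g s J `^ p = J `^ p * (J / (J - 1)) by apply: g_powR => //; lra.
have e1 : J * (J / (G * gk)) `^ p = (J - 1) * (g s J / (G * gk)) `^ p.
  have gJ0 : 0 < g s J := g_gt0 s j2.
  have i0 : 0 <= (G * gk)^-1 by rewrite invr_ge0 ltW.
  rewrite (powRM p (ltW J0) i0) (powRM p (ltW gJ0) i0) gJ; field.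
  by rewrite gt_eqF.
have e2 : 1 + b <= (g s J / (G * gk)) `^ p.
  rewrite (_ : 1 + b = G `^ p); last by rewrite /b; ring.
  apply: ge0_ler_powR; rewrite ?nnegrE ?(ltW p0) ?(ltW G0)//.
    by rewrite divr_ge0 ?(ltW GK0)// ltW// g_gt0.
  by rewrite ler_pdivlMr// mulrA GG; exact: hc.
rewrite e1; have h1 := ler_wpM2l (ltW th0) e2.
have h2 := ler_wpM2l (ltW J1) h1.
have eb : eta <= b / 4 by rewrite ge_min lexx.
have h3 := ler_wpM2r (ltW J0) eb.
rewrite mulrCA; apply: le_trans h2; rewrite thB.
apply: le_trans (lerD (lexx _) h3) _.
by nra.
Qed.

(** The term for j + 1 edges is at most X^(j+1) with X = n^(-eta)/(1 - th), so the prefactors (1 -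
    th)^(-j) are absorbed for all lengths and the geometric sum is at most 2 X. *)
Lemma other_mean_cvg0 : (fun m => other_mean s m k (threshold m)) @ \oo --> (0 : R).
Proof.
have [G [th [eta [G1 th01 eta0 rate]]]] := rate_gap.
have [th0 th1] := andP th01.
have GK0 : 0 < G * gk by rewrite mulr_gt0//; lra.
pose X m := (1 - th)^-1 * expR (- (eta * L m)).
have X0 : X @ \oo --> (0 : R).
  rewrite -[X in _ --> X](mulr0 (1 - th)^-1); apply: cvgM; first exact: cvg_cst.
  by apply: cvgy_expRN; apply: cvgy_scale => //; exact: ln_size_cvgy.
have X20 : (fun m => 2 * X m) @ \oo --> (0 : R).
  by rewrite -[X in _ --> X](mulr0 2); apply: cvgM; [exact: cvg_cst|exact: X0].
apply: norm_squeeze0 X20; near=> m.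
have Xge0 : 0 <= X m by rewrite mulr_ge0 ?expR_ge0// invr_ge0; lra.
have Xle : X m <= 2^-1.
  suff : `|0 - X m| <= 2^-1 by rewrite sub0r normrN ger0_norm.
  near: m; have /cvgrPdist_le := X0; apply; by rewrite invr_gt0.
have l0 : 0 < L m := ln_size_gt0 R m.
have wle : threshold m <= G * gk / L m `^ s.
  have sh : `|rel_shift s k t m| <= G - 1.
    by near: m; apply: shift_near => //; lra.
  rewrite /threshold [leLHS]mulrC -mulrA ler_wpM2r ?divr_ge0 ?powR_ge0 ?(ltW gk0)//.
  by move: sh; rewrite ler_norml => /andP[]; lra.
have term (j : nat) : j.+1 != k ->
    m.+2%:R ^+ j * sum_cdf s j.+1 (threshold m) <= X m ^+ j.+1.
  move=> jk; have hr := rate _ (ltn0Sn j) jk.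
  pose J : R := j.+1%:R; have J0 : 0 < J by rewrite ltr0n.
  have JG0 : 0 < J / (G * gk) by rewrite divr_gt0.
  pose y := (J / (G * gk)) `^ p * L m.
  have y0 : 0 < y by rewrite mulr_gt0// powR_gt0.
  have yw : J * y `^ (- s) = G * gk / L m `^ s.
    rewrite /y powRM ?powR_ge0 ?(ltW l0)// -powRrM.
    rewrite (_ : p * - s = - 1); last by rewrite /p; field; rewrite gt_eqF.
    rewrite powR_inv1 ?(ltW JG0)// powRN; field.
    by apply/and4P; split; rewrite gt_eqF// ?powR_gt0// ?ltr_wpDr//; lra.
  have := sum_cdf_chernoff s0 j.+1 (G * gk / L m `^ s) y0 th01.
  rewrite /chernoff_bound -/J yw subrr mul0r !addr0 => h.
  have h' := le_trans (sum_cdf_homo s j.+1 wle) h.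
  have nE : m.+2%:R ^+ j = expR ((J - 1) * L m).
    by rewrite -(@expR_ln_size R) -expRM_natl /J -natr1 addrK.
  rewrite nE; apply: le_trans (ler_wpM2l (expR_ge0 _) h') _.
  rewrite mulrCA exprMn exprVn -expRM_natl ler_wpM2l//.
    by rewrite invr_ge0 exprn_ge0//; lra.
  rewrite -expRD ler_expR -/J.
  by have := ler_wpM2r (ltW l0) hr; rewrite -/J /y; lra.
rewrite ger0_norm; last first.
  apply: sumr_ge0 => j _; rewrite mulr_ge0 ?exprn_ge0//; exact: sum_cdf_ge0.
apply: le_trans (geometric_le m.+1 _); last by rewrite Xge0.
rewrite /other_mean big_mkcond/=; apply: ler_sum => j _.
by case: ifP => [jk|_]; [exact: term|exact: exprn_ge0].
Unshelve. all: by end_near. Qed.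

End Rates.

(** * Limits of the optimal weight and of the hopcount *)

Section Convergence.
Context (R : realType) (s : R) (s0 : 0 < s) (k : nat) (k2 : (2 <= k)%N).
Context (d : nat -> measure_display) (T : forall m, measurableType (d m)).
Context (P : forall m, probability (T m) R).
Context (E : forall m : nat, {set 'I_m.+2} -> {RV (P m) >-> R}).
Hypothesis iid : forall m, iid_exponential (complete_edges m) (@E m).
Hypothesis gap : exists2 c : R, 0 < c &
  forall j, (2 <= j)%N -> j != k -> (1 + c) * g s k%:R <= g s j%:R.

(** [error_bound] compares the void probability of regular paths with the Poisson value; the two
    further terms pass from that void event to [heavier]. *)
Lemma heavier_cvg (t : R) :
  (fun m => pr (P m) (heavier s (@E m) (threshold s k t m))) @ \oo -->
  expR (- limit_const s k t).
Proof.
have err0 : (fun m => error_bound s k t m +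
    (k%:R * (m.+2%:R ^+ k.-1 * low_cdf s k (threshold s k t m) (cutoff R k m)) +
     other_mean s m k (threshold s k t m))) @ \oo --> (0 : R).
  have : (fun m => error_bound s k t m +
    (k%:R * (m.+2%:R ^+ k.-1 * low_cdf s k (threshold s k t m) (cutoff R k m)) +
     other_mean s m k (threshold s k t m))) @ \oo --> (0 + (k%:R * 0 + 0) : R).
    apply: cvgD; first exact: error_bound_cvg0.
    apply: cvgD; last exact: other_mean_cvg0.
    by apply: cvgM; [exact: cvg_cst|exact: low_cdf_cvg0].
  by rewrite mulr0 !addr0.
have poisson : (fun m => expR (- (#|paths m k|%:R * sum_cdf s k (threshold s k t m))))
    @ \oo --> expR (- limit_const s k t).
  by apply: cvg_expR; apply: cvgN; exact: expected_count_cvg.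
have diff : (fun m => pr (P m) (heavier s (@E m) (threshold s k t m)) -
    expR (- (#|paths m k|%:R * sum_cdf s k (threshold s k t m)))) @ \oo --> (0 : R).
  apply: norm_squeeze0 err0; near=> m.
  have /andP[cut0 _] := cutoff_bounds R k2 m.
  have := none_regular_poisson s (iid m) (threshold s k t m) k2 cut0.
  have := poisson_error_bound s k2 t m.
  have [h1 h2] := pr_heavier s (iid m) (threshold s k t m) (cutoff R k m) k2.
  have Nle : #|paths m k|%:R <= m.+2%:R ^+ k.-1 :> R.
    by rewrite -natrX ler_nat card_paths_le// ltnW.
  have low0 := low_cdf_ge0 s k (threshold s k t m) (cutoff R k m).
  have hN : #|paths m k|%:R * (k%:R * low_cdf s k (threshold s k t m) (cutoff R k m)) <=
      k%:R * (m.+2%:R ^+ k.-1 * low_cdf s k (threshold s k t m) (cutoff R k m)).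
    by rewrite [leRHS]mulrCA ler_wpM2r// mulr_ge0.
  have ss0 : 0 <= other_mean s m k (threshold s k t m).
    by apply: sumr_ge0 => j _; rewrite mulr_ge0 ?exprn_ge0//; exact: sum_cdf_ge0.
  have kl0 : 0 <= k%:R * (m.+2%:R ^+ k.-1 * low_cdf s k (threshold s k t m) (cutoff R k m)).
    by rewrite mulr_ge0// mulr_ge0// exprn_ge0.
  move: h1 h2 hN ss0 kl0; rewrite !ler_norml.
  set a := pr _ (heavier _ _ _); set b := pr _ (none _ _).
  move=> h1 h2 hN ss0 kl0 e1 /andP[e2 e3].
  by apply/andP; split; lra.
have : (fun m => pr (P m) (heavier s (@E m) (threshold s k t m)) -
    expR (- (#|paths m k|%:R * sum_cdf s k (threshold s k t m))) +
    expR (- (#|paths m k|%:R * sum_cdf s k (threshold s k t m))))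
    @ \oo --> (0 + expR (- limit_const s k t) : R) by exact: cvgD.
by rewrite add0r; apply: eq_cvgn => m; rewrite subrK.
Unshelve. all: by end_near. Qed.

Lemma rescaled_weight_cvg (t : R) :
  P m [set w | rescaled_weight s k m.+2%:R
                 (optimal_weight (edge_weight s (@E m) w)) > t]
    @[m --> \oo] --> (expR (- a_ s k * expR t))%:E.
Proof.
apply: cvg_EFin.
  apply: nearW => m; apply: fin_num_measure.
  rewrite (_ : [set w | _] = heavier s (@E m) (threshold s k t m)).
    exact: measurable_heavier.
  by apply/seteqP; split=> w /=; rewrite rescaled_weight_gt.
have := @heavier_cvg t; rewrite limit_constE// -mulNr; apply: eq_cvgn => m.
rewrite /= /pr; congr (fine (P m _)).
by apply/seteqP; split=> w /=; rewrite rescaled_weight_gt.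
Qed.

Lemma hopcount_cvg :
  P m [set w | hopcount (edge_weight s (@E m) w) = k] @[m --> \oo] --> 1%E.
Proof.
apply: cvg_EFin.
  by apply: nearW => m; apply: fin_num_measure; exact: measurable_hopcount.
apply/cvgrPdist_le => e e0.
have a0 : 0 < a_ s k.
  by rewrite -(pmulr_lgt0 _ (@expR_gt0 R 0)) -limit_constE// limit_const_gt0.
(* Here a_k e^t = 3/e, so the limit e^(-3/e) is at most e/3; the convergence to it and the light
   paths of other lengths cost e/3 each. *)
pose t := ln ((a_ s k * (e / 3))^-1).
have ae0 : 0 < a_ s k * (e / 3) by rewrite mulr_gt0// divr_gt0.
have limE : limit_const s k t = (e / 3)^-1.
  rewrite limit_constE// /t lnK ?posrE ?invr_gt0// invfM mulrA divff ?mul1r//.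
  by rewrite gt_eqF.
have small : expR (- limit_const s k t) <= e / 3.
  rewrite limE expRN -[leRHS]invrK lef_pV2 ?posrE ?expR_gt0 ?invr_gt0 ?divr_gt0//.
  by apply: le_trans (expR_ge1Dx _); rewrite lerDr.
have e30 : 0 < e / 3 by rewrite divr_gt0.
near=> m.
have h1 : pr (P m) (heavier s (@E m) (threshold s k t m)) <= e / 3 + e / 3.
  have : `|expR (- limit_const s k t) - pr (P m) (heavier s (@E m) (threshold s k t m))| <= e / 3.
    by near: m; have /cvgrPdist_le := @heavier_cvg t; apply.
  by rewrite ler_distlC => /andP[_]; lra.
have h2 : other_mean s m k (threshold s k t m) <= e / 3.
  have : `|0 - other_mean s m k (threshold s k t m)| <= e / 3.
    near: m; have /cvgrPdist_le := other_mean_cvg0 s0 k2 t gap; apply; exact: e30.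
  by rewrite ler_distlC => /andP[_]; lra.
have := pr_hopcount s (iid m) k (threshold s k t m).
have := pr_le1 (P m) (measurable_hopcount s (@E m) k).
rewrite [X in `|1 - X|](_ : _ = pr (P m) [set x | hopcount (edge_weight s (@E m) x) = k])//.
by rewrite ler_norml => p1 p2; apply/andP; split; lra.
Unshelve. all: by end_near. Qed.

End Convergence.

Theorem theorem2p1 (R : realType) (s : R)
    (d : nat -> measure_display) (T : forall m : nat, measurableType (d m))
    (P : forall m : nat, probability (T m) R)
    (E : forall m : nat, {set 'I_m.+2} -> {RV (P m) >-> R})
    (s_gt0 : 0 < s) (s_generic : ~ exceptional_set s)
    (E_iid : forall m : nat, iid_exponential (complete_edges m) (E m)) :
  exists k : nat,
    [/\ unique (minimizes_g s) k,
        k%:Z = Num.floor (s + 1) \/ k%:Z = Num.ceil (s + 1),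
        P m [set w | hopcount (edge_weight s (E m) w) = k]
          @[m --> \oo] --> 1%E
      & forall t : R,
          P m [set w | rescaled_weight s k m.+2%:R
                         (optimal_weight (edge_weight s (E m) w)) > t]
            @[m --> \oo] --> (expR (- a_ s k * expR t))%:E].
Proof.
have [k [k2 kE gap]] := g_minimizer s_gt0 s_generic.
exists k; split=> //.
- exact: minimizes_g_unique.
- exact: hopcount_cvg.
- by move=> t; exact: rescaled_weight_cvg.
Qed.
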